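(* Let $(M,g)$ be a smooth Lorentzian manifold of dimension $n\ge 2$ and let $\gamma:[0,l]\rightarrow M$ be a non-self-conjugate timelike geodesic loop on $(M,g)$. Then either $\gamma$ is a closed timelike geodesic, or else there exist $\delta>0$ and a smooth $TG$-homotopy $\sigma:[-\delta,\delta]\times[0,l]\rightarrow M$ such that, writing $\sigma_s:=\sigma(s,\cdot)$, one has $\sigma_0\equiv\gamma$ and $$\mathrm{length}(\sigma_s)<\mathrm{length}(\gamma)<\mathrm{length}(\sigma_{s'})\quad\text{whenever } -\delta\le s<0<s'\le\delta.$$
   Context: The Lorentzian manifold $(M,g)$ is not assumed compact or geodesically complete. A nonzero tangent vector $v$ is timelike if $g(v,v)<0$; a timelike geodesic is a geodesic with timelike velocity. Write $|v|=\sqrt{|g(v,v)|}$. The length of a timelike geodesic segment $\alpha:[a,b]\to M$ is $\mathrm{length}(\alpha)=\int_a^b|\dot\alpha(t)|\,dt$. A timelike geodesic loop is a timelike geodesic segment $\gamma:[a,b]\to M$ with $\gamma(a)=\gamma(b)$ (the velocities at the endpoints need not agree). It is a closed timelike geodesic if in addition $\dot\gamma(a)=c\,\dot\gamma(b)$ for some $c>0$. A timelike geodesic loop $\gamma:[a,b]\to M$ is self-conjugate if $\gamma(b)$ is conjugate to $\gamma(a)=\gamma(b)$ along $\gamma$ (equivalently, there is a nonzero Jacobi field along $\gamma$ vanishing at both $a$ and $b$), and non-self-conjugate otherwise. A smooth $TG$-homotopy $\sigma:[-\delta,\delta]\times[0,l]\to M$ is a smooth map such that for each $s\in[-\delta,\delta]$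 the longitudinal curve $\sigma_s: t\in[0,l]\mapsto\sigma(s,t)$ is a timelike geodesic loop. *)

(* Defs.v *)
From HB Require Import structures.
From mathcomp Require Import all_boot all_order all_algebra.
From mathcomp Require Import all_classical all_reals all_analysis.

Set Implicit Arguments.
Unset Strict Implicit.
Unset Printing Implicit Defensive.

Import Order.TTheory GRing.Theory Num.Theory.
Import numFieldNormedType.Exports.

Local Open Scope classical_set_scope.
Local Open Scope ring_scope.

(* Differential calculus.  [Ck] and [smooth] are meant for U open and V, W
   finite-dimensional (here R, R * R, 'rV[R]_n and 'M[R]_n), where the existence
   and continuity of all iterated directional derivatives is the usual notion. *)

Fixpoint Ck (R : realType) (V W : normedModType R) (k : nat)
    (U : set V) (f : V -> W) : Prop :=
  (forall x, U x -> {for x, continuous f}) /\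
  match k with
  | 0%N => True
  | k'.+1 => (forall x v, U x -> derivable f x v) /\
             (forall v, Ck k' U (fun x => 'D_v f x))
  end.

Definition smooth (R : realType) (V W : normedModType R)
    (U : set V) (f : V -> W) : Prop := forall k, Ck k U f.

(* Smoothness on a set that need not be open, such as a closed interval or
   rectangle: local existence of smooth extensions. *)
Definition smooth_within (R : realType) (V W : normedModType R)
    (A : set V) (f : V -> W) : Prop :=
  forall x, A x -> exists (U : set V) (F : V -> W),
    [/\ open U, U x, smooth U F & forall y, A y -> U y -> f y = F y].

(* Derivative with t + h restricted to I: one-sided at an end of I. *)
Definition derive_within (R : realType) (W : normedModType R)
    (I : set R) (f : R -> W) (t : R) : W :=
  lim (h^-1 *: (f (t + h) - f t) @[h --> within [set h | I (t + h)] 0^']).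

(* A smooth atlas on M with a preferred chart at every point.  The values of
   [chart_map i] outside [chart_dom i], and of [chart_inv i] outside
   [chart_img i], are irrelevant. *)
Record manifold (R : realType) (n : nat) (M : topologicalType) := Manifold {
  chart_idx : Type ;
  chart_dom : chart_idx -> set M ;
  chart_map : chart_idx -> M -> 'rV[R]_n ;
  chart_inv : chart_idx -> 'rV[R]_n -> M ;
  chart_at : M -> chart_idx ;
  manifold_hausdorff : hausdorff_space M ;
  manifold_second_countable : @second_countable M ;
  chart_at_dom : forall p, chart_dom (chart_at p) p ;
  chart_dom_open : forall i, open (chart_dom i) ;
  chart_img_open : forall i, open (chart_map i @` chart_dom i) ;
  chart_mapK : forall i p, chart_dom i p -> chart_inv i (chart_map i p) = p ;
  chart_map_continuous :
    forall i p, chart_dom i p -> {for p, continuous (chart_map i)} ;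
  chart_inv_continuous :
    forall i x, (chart_map i @` chart_dom i) x ->
      {for x, continuous (chart_inv i)} ;
  chart_transition_smooth : forall i j,
    smooth (chart_map i @` (chart_dom i `&` chart_dom j))
           (chart_map j \o chart_inv i) }.

Definition chart_img (R : realType) (n : nat) (M : topologicalType)
    (X : manifold R n M) (i : chart_idx X) : set 'rV[R]_n :=
  chart_map i @` chart_dom i.

(* The tangent space at p is represented by 'rV[R]_n, a row vector standing for
   the tangent vector at p with these components in the chart [chart_at X p].
   [tangent_change i j p] is the change of components from chart i to chart j. *)
Definition tangent_change (R : realType) (n : nat) (M : topologicalType)
    (X : manifold R n M) (i j : chart_idx X) (p : M) (v : 'rV[R]_n) : 'rV[R]_n :=
  'D_v (chart_map j \o chart_inv i) (chart_map i p).

Definition basis_vec (R : realType) (n : nat) (a : 'I_n) : 'rV[R]_n :=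
  delta_mx 0 a.

(* The form on the tangent space at p with Gram matrix G p. *)
Definition tensor_form (R : realType) (n : nat) (M : topologicalType)
    (G : M -> 'M[R]_n) (p : M) (u v : 'rV[R]_n) : R :=
  (u *m G p *m v^T) 0 0.

Definition tensor_coef (R : realType) (n : nat) (M : topologicalType)
    (X : manifold R n M) (G : M -> 'M[R]_n) (i : chart_idx X) (x : 'rV[R]_n) :
    'M[R]_n :=
  let p := chart_inv i x in
  \matrix_(a, b) tensor_form G p
    (tangent_change i (chart_at X p) p (basis_vec R a))
    (tangent_change i (chart_at X p) p (basis_vec R b)).

Definition minkowski_mx (R : realType) (n : nat) : 'M[R]_n :=
  diag_mx (\row_a (if val a == 0%N then -1 else 1)).

(* [gram p] is symmetric of signature (-,+,...,+) in every tangent space. *)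
Record lorentz_metric (R : realType) (n : nat) (M : topologicalType)
    (X : manifold R n M) := LorentzMetric {
  gram : M -> 'M[R]_n ;
  gram_sym : forall p, (gram p)^T = gram p ;
  gram_lorentzian : forall p, exists2 P : 'M[R]_n,
    P \in unitmx & P *m gram p *m P^T = minkowski_mx R n ;
  gram_smooth : forall i : chart_idx X,
    smooth (chart_img i) (tensor_coef gram i) }.

Definition smooth_map (R : realType) (n : nat) (M : topologicalType)
    (X : manifold R n M) (V : normedModType R) (A : set V) (f : V -> M) : Prop :=
  forall i : chart_idx X, forall x, A x -> chart_dom i (f x) ->
    exists (U : set V) (F : V -> 'rV[R]_n),
      [/\ open U, U x, smooth U F &
          forall y, A y -> U y -> chart_dom i (f y) /\ chart_map i (f y) = F y].

Section LorentzGeometry.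
Variables (R : realType) (n : nat) (M : topologicalType).
Variables (X : manifold R n M) (g : lorentz_metric X).

Definition inner (p : M) (u v : 'rV[R]_n) : R := tensor_form (gram g) p u v.

Definition vnorm (p : M) (v : 'rV[R]_n) : R := Num.sqrt `|inner p v v|.

Definition timelike (p : M) (v : 'rV[R]_n) : Prop := v != 0 /\ inner p v v < 0.

Definition metric_coef (i : chart_idx X) (a b : 'I_n) (x : 'rV[R]_n) : R :=
  tensor_coef (gram g) i x a b.

Definition inv_metric_coef (i : chart_idx X) (a b : 'I_n) (x : 'rV[R]_n) : R :=
  invmx (tensor_coef (gram g) i x) a b.

Definition partial (a : 'I_n) (f : 'rV[R]_n -> R) (x : 'rV[R]_n) : R :=
  'D_(basis_vec R a) f x.

(* Gamma^k_(a b) *)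
Definition christoffel (i : chart_idx X) (k a b : 'I_n) (x : 'rV[R]_n) : R :=
  2^-1 * \sum_(c < n) inv_metric_coef i k c x *
    (partial a (metric_coef i b c) x + partial b (metric_coef i a c) x
     - partial c (metric_coef i a b) x).

(* R^k_(c a b), the component along e_k of R(e_a, e_b) e_c, where
   R(u, v) w = D_u D_v w - D_v D_u w - D_[u, v] w. *)
Definition riemann (i : chart_idx X) (k c a b : 'I_n) (x : 'rV[R]_n) : R :=
  partial a (christoffel i k b c) x - partial b (christoffel i k a c) x
  + \sum_(d < n) (christoffel i k a d x * christoffel i d b c x
                  - christoffel i k b d x * christoffel i d a c x).

(* R(u, v) w at p *)
Definition curvature (p : M) (u v w : 'rV[R]_n) : 'rV[R]_n :=
  let i := chart_at X p in
  \row_k \sum_(c < n) \sum_(a < n) \sum_(b < n)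
    riemann i k c a b (chart_map i p) * w 0 c * u 0 a * v 0 b.

(* Curves defined on [a, b], and vector fields V along them: V t is a tangent
   vector at gam t. *)

Definition velocity (a b : R) (gam : R -> M) (t : R) : 'rV[R]_n :=
  derive_within `[a, b] (chart_map (chart_at X (gam t)) \o gam) t.

Definition field_coord (gam : R -> M) (V : R -> 'rV[R]_n) (i : chart_idx X)
    (t : R) : 'rV[R]_n :=
  tangent_change (chart_at X (gam t)) i (gam t) (V t).

Definition smooth_field (a b : R) (gam : R -> M) (V : R -> 'rV[R]_n) : Prop :=
  forall i : chart_idx X,
    smooth_within (`[a, b] `&` [set t | chart_dom i (gam t)])
                  (field_coord gam V i).

Definition covariant_derivative (a b : R) (gam : R -> M) (V : R -> 'rV[R]_n)
    (t : R) : 'rV[R]_n :=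
  let i := chart_at X (gam t) in
  let v := velocity a b gam t in
  derive_within `[a, b] (field_coord gam V i) t +
  \row_k \sum_(c < n) \sum_(d < n)
    christoffel i k c d (chart_map i (gam t)) * v 0 c * V t 0 d.

Definition geodesic (a b : R) (gam : R -> M) : Prop :=
  smooth_map X `[a, b] gam /\
  forall t, `[a, b]%classic t ->
    covariant_derivative a b gam (velocity a b gam) t = 0.

Definition timelike_geodesic (a b : R) (gam : R -> M) : Prop :=
  geodesic a b gam /\
  forall t, `[a, b]%classic t -> timelike (gam t) (velocity a b gam t).

Definition curve_length (a b : R) (gam : R -> M) : R :=
  \int[lebesgue_measure]_(t in `[a, b]) vnorm (gam t) (velocity a b gam t).

Definition timelike_geodesic_loop (a b : R) (gam : R -> M) : Prop :=
  timelike_geodesic a b gam /\ gam a = gam b.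

Definition closed_timelike_geodesic (a b : R) (gam : R -> M) : Prop :=
  timelike_geodesic_loop a b gam /\
  exists2 c : R, 0 < c & velocity a b gam a = c *: velocity a b gam b.

Definition jacobi_field (a b : R) (gam : R -> M) (J : R -> 'rV[R]_n) : Prop :=
  smooth_field a b gam J /\
  forall t, `[a, b]%classic t ->
    covariant_derivative a b gam (covariant_derivative a b gam J) t
    + curvature (gam t) (J t) (velocity a b gam t) (velocity a b gam t) = 0.

(* gam b is conjugate to gam a along gam *)
Definition conjugate_ends (a b : R) (gam : R -> M) : Prop :=
  exists J : R -> 'rV[R]_n,
    [/\ jacobi_field a b gam J, J a = 0, J b = 0 &
        exists2 t, `[a, b]%classic t & J t != 0].

Definition self_conjugate (a b : R) (gam : R -> M) : Prop :=
  timelike_geodesic_loop a b gam /\ conjugate_ends a b gam.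

Definition rectangle (a b c d : R) : set (R * R)%type :=
  [set z | a <= z.1 <= b /\ c <= z.2 <= d].

Definition longitudinal (sigma : R * R -> M) (s : R) : R -> M :=
  fun t => sigma (s, t).

Definition smooth_TG_homotopy (delta l : R) (sigma : R * R -> M) : Prop :=
  smooth_map X (rectangle (- delta) delta 0 l) sigma /\
  forall s, - delta <= s <= delta ->
    timelike_geodesic_loop 0 l (longitudinal sigma s).

End LorentzGeometry.

(* Main.v *)
Require Import Defs.
From HB Require Import structures.
From mathcomp Require Import all_boot all_order all_algebra.
From mathcomp Require Import all_classical all_reals all_analysis.
From mathcomp Require Import ring lra.

Set Implicit Arguments.
Unset Strict Implicit.
Unset Printing Implicit Defensive.

Import Order.TTheory GRing.Theory Num.Theory.
Import numFieldNormedType.Exports.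

Local Open Scope classical_set_scope.
Local Open Scope ring_scope.


(** A loop [gam] that fails to be a closed geodesic has an initial and a final
    velocity that differ in the tangent space at the base point, say by [u].
    The metric being nondegenerate, there is a direction [a] with
    [g (a, u) < 0].  Suppose that [gam] is embedded in a smooth family of
    geodesic loops [sigma_s] whose base points move with velocity [a] at
    [s = 0].  By the first variation formula only the boundary terms contribute
    to the derivative of the energy [g (sigma_s', sigma_s')]: it is a positive
    multiple of [g (a, u)], hence negative.  The energy of a geodesic is
    constant and that of [gam] is negative, so the length of [sigma_s] is [l]
    times the square root of minus the energy; near [s = 0] the [sigma_s] are
    timelike, shorter than [gam] for [s < 0] and longer for [s > 0].

    The family exists because [gam] is not self-conjugate.  Geodesics with
    initial position [x] and velocity [v] near those of [gam] are defined up to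
    time [l] ([geodesic_family_along]); let [G (x, v)] be the end point in a
    chart at the base point.  The derivative of [G] in the direction [(0, w)] is
    the value at [l] of the Jacobi field along [gam] with initial value [0] and
    initial derivative [w], so it is injective in [w]
    ([endpoint_injective]).  Hence [(x, v)] can be moved along an integral curve
    of a vector field chosen so that [x] and [G (x, v)] have the same derivative
    [a] ([continuation]), and the geodesics remain loops ([loop_family]).

    The analysis underneath is developed from the definitions: a calculus of
    [Ck] functions with the chain rule and the symmetry of second derivatives;
    flows of smooth vector fields and their smooth dependence on initial
    conditions ([smooth_time_one], [local_flow]); and covariant differentiation
    along families of curves.  The last rests on the transformation law of the
    Christoffel symbols ([chr_change]), and yields the Ricci identity
    ([cov_commute]), the Jacobi equation for variation fields ([jacobi_family])
    and the first variation formula ([first_variation]).  The geodesic flow is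
    obtained in charts from the geodesic spray and continued along [gam] from
    chart to chart ([flows_step]). *)
(** * Directional derivatives *)

Section Directional.
Variables (R : realType) (V W : normedModType R).

Lemma is_derive_cvg (f : V -> W) x v d :
  (fun h => h^-1 *: (f (h *: v + x) - f x)) @ 0^' --> d -> is_derive x v f d.
Proof.
move=> fd; split; last by apply/cvg_lim.
by apply/cvg_ex; exists d.
Qed.

Lemma cvg_is_derive (f : V -> W) x v d :
  is_derive x v f d -> (fun h => h^-1 *: (f (h *: v + x) - f x)) @ 0^' --> d.
Proof. by move=> [fv <-]; exact: fv. Qed.

Lemma is_derive_line_continuous (f : V -> W) x v d :
  is_derive x v f d -> (fun h : R => f (h *: v + x)) @ 0^' --> f x.
Proof.
move=> [fd _].
have : {for 0, continuous (fun h : R => f (h *: v + x))}.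
  exact/differentiable_continuous/derivable1_diffP/(derivable1P _ _ _).1.
by move=> /continuous_withinNx; rewrite scale0r add0r.
Qed.

End Directional.

Section DirectionalRules.
Variables (R : realType) (V W : normedModType R).

Lemma is_derive_linear_comp (Z : normedModType R) (L : {linear W -> Z})
    (f : V -> W) x v d :
  continuous L -> is_derive x v f d -> is_derive x v (L \o f) (L d).
Proof.
move=> Lc /cvg_is_derive fd; apply: is_derive_cvg.
rewrite (_ : (fun h => _) = L \o (fun h => h^-1 *: (f (h *: v + x) - f x))).
  by apply: continuous_cvg fd; exact: Lc.
by apply/funext => h /=; rewrite linearZ_LR /= (raddfB L).
Qed.

Lemma is_derive_affine_comp (V' : normedModType R) (A : V' -> V)
    (f : V -> W) x v w d :
  (forall h, A (h *: v + x) = h *: w + A x) ->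
  is_derive (A x) w f d -> is_derive x v (f \o A) d.
Proof.
move=> Aaff /cvg_is_derive fd; apply: is_derive_cvg.
rewrite (_ : (fun h => _) = (fun h => h^-1 *: (f (h *: w + A x) - f (A x)))) //.
by apply/funext => h /=; rewrite Aaff.
Qed.

Lemma is_derive_affine (A : V -> W) x v w :
  (forall h, A (h *: v + x) = h *: w + A x) -> is_derive x v A w.
Proof.
move=> Aaff; apply: is_derive_cvg; apply: cvg_near_cst.
near=> h.
have h0 : h != 0 by near: h; exact: nbhs_dnbhs_neq.
by rewrite Aaff addrK scalerA mulVf// scale1r.
Unshelve. all: by end_near. Qed.

Lemma is_derive_scale (f : V -> W) x v d (c : R) :
  is_derive x v f d -> is_derive x (c *: v) f (c *: d).
Proof.
have [-> _|c0 /cvg_is_derive fd] := eqVneq c 0.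
  rewrite !scale0r; exact: is_derive0.
apply: is_derive_cvg.
have hc : (fun h : R => h * c) @ 0^' --> 0^'.
  move=> A [e /= e0 eA]; exists (e / `|c|) => /=.
    by rewrite divr_gt0 ?normr_gt0.
  move=> h /= hh h0; apply: eA => /=; last by rewrite mulf_neq0.
  move: hh; rewrite !sub0r !normrN normrM.
  by rewrite ltr_pdivlMr ?normr_gt0.
have := @cvgZl_tmp _ _ _ _ _ c _ _ (cvg_comp _ _ hc fd).
move=> fcd; apply: cvg_trans (fcd _); apply: near_eq_cvg; near=> h => /=.
have h0 : h != 0 by near: h; exact: nbhs_dnbhs_neq.
by rewrite scalerA invfM mulrC -mulrA mulVf// mulr1 scalerA.
Unshelve. all: by end_near. Qed.

Lemma is_derive_fscale (c : V -> R) (f : V -> W) x v dc d :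
  is_derive x v c dc -> is_derive x v f d ->
  is_derive x v (fun y => c y *: f y) (c x *: d + dc *: f x).
Proof.
move=> cd fd; apply: is_derive_cvg.
rewrite (_ : (fun h => _) = (fun h => c (h *: v + x) *:
   (h^-1 *: (f (h *: v + x) - f x)) + (h^-1 *: (c (h *: v + x) - c x)) *: f x)).
  apply: cvgD.
    apply: cvgZ; first exact: is_derive_line_continuous cd.
    exact: cvg_is_derive.
  by apply: cvgZr_tmp; exact: cvg_is_derive.
apply/funext => h; rewrite scalerA [c _ * _]mulrC -!scalerA -scalerDr.
by congr (_ *: _); rewrite scalerBr scalerBl subrKA.
Qed.

Lemma is_derive_unique (f : V -> W) x v d d' :
  is_derive x v f d -> is_derive x v f d' -> d = d'.
Proof. by move=> [_ <-] [_ <-]. Qed.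

End DirectionalRules.

Section Pairs.
Variables (R : realType) (V : normedModType R).

Lemma is_derive_mx (p q : nat) (f : V -> 'M[R]_(p, q)) x v d :
  is_derive x v f d <-> forall i j, is_derive x v (fun y => f y i j) (d i j).
Proof.
split=> [[fd <-] i j|fd].
  rewrite derive_mx// mxE; apply: derivableP.
  by move/derivable_mxP : fd; exact.
have fdx : derivable f x v by apply/derivable_mxP => i j; have [] := fd i j.
split=> //; rewrite derive_mx//; apply/matrixP => i j; rewrite mxE.
by have [] := fd i j.
Qed.

Lemma mx_norm_le (p q : nat) (A : 'M[R]_(p, q)) (c : R) :
  0 <= c -> (forall i j, `|A i j| <= c) -> `|A| <= c.
Proof.
move=> c0 Ac; rewrite [leLHS]/Num.Def.normr/= mx_normrE.
by rewrite (bigmax_le _ c0)//= => ij _; exact: Ac.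
Qed.

Lemma le_mx_norm (p q : nat) (A : 'M[R]_(p, q)) i j : `|A i j| <= `|A|.
Proof.
rewrite [leRHS]/Num.Def.normr/= mx_normrE.
exact: (le_bigmax _ (fun ij => `|A ij.1 ij.2|) (i, j)).
Qed.

Lemma cvg_mx (T : Type) (F : set_system T) (FF : Filter F) (p q : nat)
    (f : T -> 'M[R]_(p, q)) (a : 'M[R]_(p, q)) :
  (forall i j, (f x i j @[x --> F]) --> a i j) -> f @ F --> a.
Proof.
move=> fa; apply/cvgrPdist_le => e e0.
have H : \forall x \near F, forall ij : 'I_p * 'I_q,
    `|a ij.1 ij.2 - f x ij.1 ij.2| <= e.
  apply: filter_forall => -[i' j'] /=.
  by have /cvgrPdist_le/(_ _ e0) := fa i' j'.
apply: filterS H => x Hx; apply: mx_norm_le; first exact: ltW.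
by move=> i j; rewrite !mxE; exact: (Hx (i, j)).
Qed.

Lemma eq_continuous_at (T T' : topologicalType) (f g : T -> T') x :
  f =1 g -> {for x, continuous f} -> {for x, continuous g}.
Proof. by move=> /funext ->. Qed.

Lemma continuous_at_cst (T T' : topologicalType) (c : T') (x : T) :
  {for x, continuous (fun _ : T => c)}.
Proof. exact: (@cvg_cst T' c T (nbhs x)). Qed.

Lemma continuous_mx (T : topologicalType) (p q : nat) (f : T -> 'M[R]_(p, q)) x :
  (forall i j, {for x, continuous (fun y => f y i j)}) -> {for x, continuous f}.
Proof. by move=> fc; apply: (@cvg_mx T (nbhs x)) => i j; exact: fc. Qed.

Lemma continuous_pair (T T1 T2 : topologicalType) (f : T -> T1) (g : T -> T2) x :
  {for x, continuous f} -> {for x, continuous g} ->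
  {for x, continuous (fun y => (f y, g y))}.
Proof. by move=> fc gc; exact: (@cvg_pair _ _ _ (nbhs x)). Qed.

End Pairs.

(** * The classes of continuously differentiable functions *)

Section CkBasics.
Variables (R : realType) (V W : normedModType R).
Implicit Types (U : set V) (f g : V -> W) (k : nat).

Lemma Ck_continuous k U f x : Ck k U f -> U x -> {for x, continuous f}.
Proof. by case: k => [|k] [fc _]; exact: fc. Qed.

Lemma Ck_is_derive k U f x v :
  Ck k.+1 U f -> U x -> is_derive x v f ('D_v f x).
Proof. by move=> [_ [fd _]] Ux; apply: derivableP; exact: fd. Qed.

Lemma Ck_derive k U f v : Ck k.+1 U f -> Ck k U ('D_v f).
Proof. by move=> [_ [_]]; exact. Qed.

Lemma Ck_pred k U f : Ck k.+1 U f -> Ck k U f.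
Proof.
elim: k f => [|k IH] f [fc [fd fD]]; first by split.
by split=> //; split=> // v; exact: IH.
Qed.

Lemma Ck_sub k U U' f : U' `<=` U -> Ck k U f -> Ck k U' f.
Proof.
move=> sU; elim: k f => [|k IH] f [fc fD]; split=> //.
- by move=> x /sU; exact: fc.
- by move=> x /sU; exact: fc.
- case: fD => fd fD; split=> [x v /sU Ux|v]; first exact: fd.
  by apply: IH; exact: fD.
Qed.

Lemma Ck_local k U f :
  (forall x, U x -> exists2 U', U' x & Ck k U' f) -> Ck k U f.
Proof.
elim: k f => [|k IH] f fU; split=> //.
- by move=> x /fU [U' U'x fU']; exact: Ck_continuous fU' U'x.
- by move=> x /fU [U' U'x fU']; exact: Ck_continuous fU' U'x.
- split=> [x v /fU [U' U'x [_ [fd _]]]|v]; first exact: fd.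
  by apply: IH => x /fU [U' U'x fU']; exists U' => //; exact: Ck_derive.
Qed.

Lemma near_open_eq (T : Type) U (f g : V -> T) x :
  open U -> U x -> (forall y, U y -> f y = g y) -> {near x, f =1 g}.
Proof.
by move=> oU Ux fg; apply: filterS fg _; exact: open_nbhs_nbhs.
Qed.

Lemma Ck_eq k U f g :
  open U -> (forall x, U x -> f x = g x) -> Ck k U f -> Ck k U g.
Proof.
move=> oU; elim: k f g => [|k IH] f g fg [fc fD].
- split=> // x Ux; rewrite /prop_for /continuous_at -fg//.
  apply: cvg_trans (fc x Ux); apply: near_eq_cvg.
  exact: near_open_eq fg.
- split=> [x Ux|].
    rewrite /prop_for /continuous_at -fg//.
    apply: cvg_trans (fc x Ux); apply: near_eq_cvg.
    exact: near_open_eq fg.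
  case: fD => fd fD; split=> [x v Ux|v].
    by apply: near_eq_derivable (fd x v Ux); exact: near_open_eq fg.
  apply: IH (fD v) => x Ux; apply: near_eq_derive.
  exact: near_open_eq fg.
Qed.

Lemma Ck_succ k U f (df : V -> V -> W) :
  open U -> (forall x, U x -> {for x, continuous f}) ->
  (forall x v, U x -> is_derive x v f (df v x)) ->
  (forall v, Ck k U (df v)) -> Ck k.+1 U f.
Proof.
move=> oU fc fd dfC; split=> //; split=> [x v Ux|v]; first by have [] := fd x v Ux.
apply: Ck_eq (dfC v) => // x Ux.
by have [_ ->] := fd x v Ux.
Qed.

Lemma Ck_cst k U (c : W) : Ck k U (fun=> c).
Proof.
elim: k c => [|k IH] c; split=> //; try by move=> x _; exact: cvg_cst.
split=> [x v _|v]; first exact: derivable_cst.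
have -> : 'D_v (fun=> c) = (fun=> 0) :> (V -> W); last exact: IH.
by apply/funext => x; exact: derive_cst.
Qed.

Lemma Ck_affine k U (A : V -> W) (DA : V -> W) :
  open U -> continuous A -> (forall x v h, A (h *: v + x) = h *: DA v + A x) ->
  Ck k U A.
Proof.
move=> oU Ac Aaff; case: k => [|k]; first by split=> // x _; exact: Ac.
apply: (Ck_succ (df := fun v _ => DA v)) => // [x _|x v _|v].
- exact: Ac.
- by apply: is_derive_affine => h.
- exact: Ck_cst.
Qed.

End CkBasics.

Section CkAlgebra.
Variables (R : realType) (V W : normedModType R).
Implicit Types (U : set V) (f g : V -> W) (k : nat).

Lemma Ck_linear_comp (Z : normedModType R) (L : {linear W -> Z}) k U f :
  open U -> continuous L -> Ck k U f -> Ck k U (L \o f).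
Proof.
move=> oU Lc; elim: k f => [|k IH] f fC.
  split=> // x Ux; apply: continuous_comp; last exact: Lc.
  exact: Ck_continuous fC Ux.
apply: (Ck_succ (df := fun v => L \o 'D_v f)) => // [x Ux|x v Ux|v].
- by apply: continuous_comp; [exact: Ck_continuous fC Ux|exact: Lc].
- by apply: is_derive_linear_comp => //; exact: Ck_is_derive fC Ux.
- by apply: IH; exact: Ck_derive.
Qed.

Lemma Ck_affine_comp (V' : normedModType R) (A DA : V' -> V) k U f :
  open U -> continuous A ->
  (forall x v h, A (h *: v + x) = h *: DA v + A x) ->
  Ck k U f -> Ck k (A @^-1` U) (f \o A).
Proof.
move=> oU Ac Aaff; have oAU : open (A @^-1` U) by apply: open_comp.
elim: k f => [|k IH] f fC.
  split=> // x Ux; apply: continuous_comp; first exact: Ac.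
  exact: Ck_continuous fC Ux.
apply: (Ck_succ (df := fun v => 'D_(DA v) f \o A)) => // [x Ux|x v Ux|v].
- by apply: continuous_comp; [exact: Ac|exact: Ck_continuous fC Ux].
- apply: (@is_derive_affine_comp _ _ _ _ _ _ _ _ (DA v)) => //.
  exact: Ck_is_derive fC Ux.
- by apply: IH; exact: Ck_derive.
Qed.

Lemma Ck_add k U f g :
  open U -> Ck k U f -> Ck k U g -> Ck k U (fun x => f x + g x).
Proof.
move=> oU; elim: k f g => [|k IH] f g fC gC.
  split=> // x Ux; apply: cvgD.
    exact: Ck_continuous fC Ux.
  exact: Ck_continuous gC Ux.
apply: (Ck_succ (df := fun v x => 'D_v f x + 'D_v g x)) => // [x Ux|x v Ux|v].
- by apply: cvgD; [exact: Ck_continuous fC Ux|exact: Ck_continuous gC Ux].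
- by apply: is_deriveD; [exact: Ck_is_derive fC Ux|exact: Ck_is_derive gC Ux].
- by apply: IH; exact: Ck_derive.
Qed.

Lemma Ck_fscale k U (c : V -> R) f :
  open U -> Ck k U c -> Ck k U f -> Ck k U (fun x => c x *: f x).
Proof.
move=> oU; elim: k c f => [|k IH] c f cC fC.
  split=> // x Ux; apply: cvgZ.
    exact: Ck_continuous cC Ux.
  exact: Ck_continuous fC Ux.
apply: (Ck_succ (df := fun v x => c x *: 'D_v f x + 'D_v c x *: f x))
  => // [x Ux|x v Ux|v].
- by apply: cvgZ; [exact: Ck_continuous cC Ux|exact: Ck_continuous fC Ux].
- apply: is_derive_fscale.
    exact: Ck_is_derive cC Ux.
  exact: Ck_is_derive fC Ux.
- apply: Ck_add => //.
    by apply: IH; [exact: Ck_pred|exact: Ck_derive].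
  by apply: IH; [exact: Ck_derive|exact: Ck_pred].
Qed.

End CkAlgebra.

Section CkAlgebraMore.
Variables (R : realType) (V W : normedModType R).
Implicit Types (U : set V) (f g : V -> W) (k : nat).

Lemma Ck_scale k U (c : R) f : open U -> Ck k U f -> Ck k U (fun x => c *: f x).
Proof. by move=> oU; apply: Ck_fscale => //; exact: Ck_cst. Qed.

Lemma Ck_opp k U f : open U -> Ck k U f -> Ck k U (fun x => - f x).
Proof.
move=> oU fC; apply: Ck_eq (Ck_scale (-1) oU fC) => // x _.
by rewrite scaleN1r.
Qed.

Lemma Ck_sub_fun k U f g :
  open U -> Ck k U f -> Ck k U g -> Ck k U (fun x => f x - g x).
Proof. by move=> oU fC gC; apply: Ck_add => //; exact: Ck_opp. Qed.

Lemma Ck_sum (I : Type) (r : seq I) (P : pred I) k U (f : I -> V -> W) :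
  open U -> (forall i, Ck k U (f i)) ->
  Ck k U (fun x => \sum_(i <- r | P i) f i x).
Proof.
move=> oU fC; elim: r => [|i r IH].
  by apply: Ck_eq (Ck_cst k U 0) => // x _; rewrite big_nil.
case Pi : (P i).
  by apply: Ck_eq (Ck_add oU (fC i) IH) => // x _; rewrite big_cons Pi.
by apply: Ck_eq IH => // x _; rewrite big_cons Pi.
Qed.

End CkAlgebraMore.

Section CkScalar.
Variables (R : realType) (V : normedModType R).
Implicit Types (U : set V) (k : nat).

Lemma Ck_mul k U (f g : V -> R) :
  open U -> Ck k U f -> Ck k U g -> Ck k U (fun x => f x * g x).
Proof. by move=> oU fC gC; exact: (Ck_fscale oU fC gC). Qed.

Lemma Ck_prod (I : Type) (r : seq I) k U (f : I -> V -> R) :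
  open U -> (forall i, Ck k U (f i)) ->
  Ck k U (fun x => \prod_(i <- r) f i x).
Proof.
move=> oU fC; elim: r => [|i r IH].
  by apply: Ck_eq (Ck_cst k U (1 : R)) => // x _; rewrite big_nil.
by apply: Ck_eq (Ck_mul oU (fC i) IH) => // x _; rewrite big_cons.
Qed.

Lemma Ck_inv k U (f : V -> R) : open U -> (forall x, U x -> f x != 0) ->
  Ck k U f -> Ck k U (fun x => (f x)^-1).
Proof.
move=> oU f0; elim: k => [|k IH] fC.
  split=> // x Ux; apply: cvgV; first exact: f0.
  exact: Ck_continuous fC Ux.
apply: (Ck_succ (df := fun v x => - ((f x)^-1 * (f x)^-1 * 'D_v f x)))
  => // [x Ux|x v Ux|v].
- by apply: cvgV; [exact: f0|exact: Ck_continuous fC Ux].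
- have [fd _] := Ck_is_derive v fC Ux.
  split; first exact: (derivableV (f0 x Ux) fd).
  rewrite (deriveV (f0 x Ux) fd) /GRing.scale/= mulNr.
  by rewrite expr2 invfM.
- have fC' : Ck k U (fun x => (f x)^-1) by apply: IH; exact: Ck_pred.
  apply: Ck_opp => //; apply: Ck_mul => //; last exact: Ck_derive.
  exact: Ck_mul.
Qed.

Lemma Ck_mx k (p q : nat) U (M : V -> 'M[R]_(p, q)) : open U ->
  Ck k U M <-> forall i j, Ck k U (fun x => M x i j).
Proof.
move=> oU; elim: k M => [|k IH] M; split.
- move=> [Mc _] i j; split=> // x Ux.
  apply: (@continuous_comp _ _ _ M (fun A : 'M[R]_(p, q) => A i j)).
    exact: Mc.
  exact: coord_continuous.
- move=> MC; split=> // x Ux; apply: continuous_mx => i j.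
  exact: Ck_continuous (MC i j) Ux.
- move=> MC i j.
  apply: (Ck_succ (df := fun v x => ('D_v M x) i j)) => // [x Ux|x v Ux|v].
  + apply: (@continuous_comp _ _ _ M (fun A : 'M[R]_(p, q) => A i j)).
      exact: Ck_continuous MC Ux.
    exact: coord_continuous.
  + by have /is_derive_mx := Ck_is_derive v MC Ux; exact.
  + by apply IH; exact: Ck_derive.
- move=> MC.
  apply: (Ck_succ (df := fun v x => \matrix_(i, j) 'D_v (fun x => M x i j) x))
    => // [x Ux|x v Ux|v].
  + by apply: continuous_mx => i j; exact: Ck_continuous (MC i j) Ux.
  + by apply/is_derive_mx => i j; rewrite mxE; exact: Ck_is_derive (MC i j) Ux.
  + apply IH => i j; apply: Ck_eq (Ck_derive v (MC i j)) => // x _.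
    by rewrite mxE.
Qed.

End CkScalar.

(** * The chain rule *)

Section MeanValue.
Variables (R : realType).

Lemma mean_value_line (V : normedModType R) (f : V -> R) x v :
  (forall s : R, 0 <= s <= 1 -> derivable f (s *: v + x) v) ->
  exists2 c : R, 0 <= c <= 1 & f (v + x) - f x = 'D_v f (c *: v + x).
Proof.
move=> fd.
pose phi (s : R) := f (s *: v + x).
have phid (s : R) : 0 <= s <= 1 -> is_derive s 1 phi ('D_v f (s *: v + x)).
  move=> s01; apply: (@is_derive_affine_comp _ _ _ _ (fun s : R => s *: v + x) _ _ _ v).
    by move=> h /=; rewrite scalerDl addrA [h *: 1]mulr1.
  by apply: derivableP; exact: fd.
have phic : {within `[0, 1], continuous phi}.
  apply: derivable_within_continuous => s; rewrite in_itv/= => s01.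
  by have [] := phid s s01.
have phid' (s : R) : s \in `]0, 1[ -> is_derive s 1 phi ('D_v f (s *: v + x)).
  by rewrite in_itv/= => /andP[s0 s1]; apply: phid; rewrite !ltW.
have [c cab] := MVT_segment ler01 phid' phic.
rewrite subr0 mulr1 /phi scale1r scale0r add0r => fE.
by exists c; rewrite ?(itvP cab).
Qed.

(** Moving one coordinate at a time reduces an increment to increments along
   the axes, so that only partial derivatives are needed. *)
Lemma partial_increments (m : nat) (g : 'rV[R]_m -> R) (y0 y : 'rV[R]_m) :
  (forall z j, `|z - y0| <= `|y - y0| -> derivable g z (delta_mx 0 j)) ->
  exists2 xi : 'I_m -> 'rV[R]_m,
    (forall k, `|xi k - y0| <= `|y - y0|) &
    g y - g y0 = \sum_k (y - y0) 0 k * 'D_(delta_mx 0 k) g (xi k).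
Proof.
move=> gd.
pose p (k : nat) : 'rV[R]_m := \row_j (if (j < k)%N then y 0 j else y0 0 j).
pose d (k : 'I_m) := (y - y0) 0 k.
have pS (k : 'I_m) : p k.+1 = d k *: delta_mx 0 k + p k.
  apply/rowP => j; rewrite !mxE eqxx/= ltnS.
  have [<-|jk] := eqVneq j k; first by rewrite leqnn ltnn mulr1 /d !mxE subrK.
  rewrite mulr0 add0r.
  by rewrite leq_eqVlt (negbTE jk : (j == k :> nat) = false).
have seg (k : 'I_m) (s : R) : 0 <= s <= 1 ->
    `|s *: (d k *: delta_mx 0 k) + p k - y0| <= `|y - y0|.
  move=> /andP[s0 s1]; apply: mx_norm_le => // i j; rewrite ord1 {i} !mxE eqxx/=.
  have [<-|jk] := eqVneq j k.
    rewrite ltnn addrK mulr1 normrM ger0_norm//.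
    by apply: le_trans (le_mx_norm _ 0 j); rewrite ler_piMl.
  rewrite !mulr0 add0r; case: ifP => _; last by rewrite subrr normr0.
  by have := le_mx_norm (y - y0) 0 j; rewrite !mxE.
have step (k : 'I_m) : exists xi : 'rV[R]_m, `|xi - y0| <= `|y - y0| /\
    g (p k.+1) - g (p k) = d k * 'D_(delta_mx 0 k) g xi.
  have gdd (s : R) : 0 <= s <= 1 -> is_derive (s *: (d k *: delta_mx 0 k) + p k)
      (d k *: delta_mx 0 k) g (d k *: 'D_(delta_mx 0 k) g
         (s *: (d k *: delta_mx 0 k) + p k)).
    by move=> s01; apply/is_derive_scale/derivableP/gd/seg.
  have [c c01 E] := mean_value_line (fun s s01 =>
    @ex_derive _ _ _ _ _ _ _ (gdd s s01)).
  exists (c *: (d k *: delta_mx 0 k) + p k); split; first exact: seg.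
  by rewrite pS E; have [_ ->] := gdd _ c01.
have [xi xiP] := choice step.
exists xi; first by move=> k; have [] := xiP k.
have pm : p m = y by apply/rowP => j; rewrite !mxE ltn_ord.
have p0 : p 0%N = y0 by apply/rowP => j; rewrite !mxE.
rewrite -{1}pm -{1}p0 -(telescope_sumr (fun k => g (p k)) (leq0n m)) big_mkord.
by apply: eq_bigr => k _; have [_ ->] := xiP k.
Qed.

Lemma cvg_sum_fun (V : normedModType R) (T I : Type) (F : set_system T)
    (FF : Filter F) (r : seq I) (f : I -> T -> V) (l : I -> V) :
  (forall i, f i @ F --> l i) ->
  (fun x => \sum_(i <- r) f i x) @ F --> \sum_(i <- r) l i.
Proof.
move=> fl; elim: r => [|i r IH].
  rewrite big_nil; under eq_fun do rewrite big_nil; exact: cvg_cst.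
rewrite big_cons; under eq_fun do rewrite big_cons; exact: cvgD.
Qed.

Lemma cvg_ball_eq (V : normedModType R) (T : Type) (F : set_system T)
  (FF : Filter F) (f : T -> V) l : (`|f x - l| @[x --> F] --> (0 : R)) -> f @ F --> l.
Proof.
move=> fl; apply/cvgrPdist_lt => e e0.
move/cvgrPdist_lt : fl => /(_ e e0); apply: filterS => x.
by rewrite sub0r normrN normr_id distrC.
Qed.

Lemma scalar_chain_rule (V : normedModType R) (m : nat) (U : set 'rV[R]_m)
    (g : 'rV[R]_m -> R) (f : V -> 'rV[R]_m) x v d :
  open U -> U (f x) -> Ck 1 U g -> is_derive x v f d ->
  is_derive x v (g \o f) (\sum_k d 0 k * 'D_(delta_mx 0 k) g (f x)).
Proof.
move=> oU Ux gC fd; apply: is_derive_cvg.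
have [r /= r0 rU] := (nbhs_ballP _ _).1 (open_nbhs_nbhs (conj oU Ux)).
have fcont := is_derive_line_continuous fd.
have near_r : \forall h \near 0^', `|f (h *: v + x) - f x| < r.
  move/cvgrPdist_lt : fcont => /(_ r r0); apply: filterS => h.
  by rewrite distrC.
have xiP h : exists xi : 'I_m -> 'rV[R]_m,
    `|f (h *: v + x) - f x| < r ->
    (forall k, `|xi k - f x| <= `|f (h *: v + x) - f x|) /\
    g (f (h *: v + x)) - g (f x) = \sum_k (f (h *: v + x) - f x) 0 k *
      'D_(delta_mx 0 k) g (xi k).
  have [lr|_] := boolP (`|f (h *: v + x) - f x| < r); last by exists (fun=> 0).
  have [z j zle|xi xi1 xi2] := @partial_increments m g (f x) (f (h *: v + x)).
    have [] // := Ck_is_derive (delta_mx 0 j) gC (_ : U z).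
    by apply: rU; rewrite -ball_normE /ball_/= distrC (le_lt_trans zle).
  by exists xi.
have [xi {}xiP] := choice xiP.
have xi_cvg k : xi h k @[h --> 0^'] --> f x.
  apply: cvg_ball_eq; apply: (@squeeze_cvgr _ _ _ _ (fun=> 0)
    (fun h => `|f (h *: v + x) - f x|)); last 2 first.
  - exact: cvg_cst.
  - rewrite -[X in _ --> X](normr0 'rV[R]_m) -(subrr (f x)).
    by apply: cvg_norm; apply: cvgB => //; exact: cvg_cst.
  near=> h; rewrite normr_ge0/=.
  have [] // := xiP h _; near: h; exact: near_r.
have lim_sum : (fun h => \sum_k (h^-1 *: (f (h *: v + x) - f x)) 0 k *
    'D_(delta_mx 0 k) g (xi h k)) @ 0^' -->
    \sum_k d 0 k * 'D_(delta_mx 0 k) g (f x).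
  apply: (@cvg_sum_fun R _ _ _ _ _ (fun k h => (h^-1 *: (f (h *: v + x) - f x)) 0 k *
    'D_(delta_mx 0 k) g (xi h k)) (fun k => d 0 k * 'D_(delta_mx 0 k) g (f x))) => k.
  apply: cvgM.
    have := cvg_is_derive ((is_derive_mx f x v d).1 fd 0 k).
    by apply: cvg_trans; apply: near_eq_cvg; near=> h; rewrite !mxE.
  exact: (cvg_comp (fun h => xi h k) ('D_(delta_mx 0 k) g) (xi_cvg k)
    (Ck_continuous (Ck_derive (delta_mx 0 k) gC) Ux)).
apply: cvg_trans lim_sum; apply: near_eq_cvg; near=> h.
have [|_ /= ->] := xiP h; first by near: h; exact: near_r.
rewrite scaler_sumr; apply: eq_bigr => k _.
by rewrite !mxE /GRing.scale/= mulrA.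
Unshelve. all: by end_near. Qed.

End MeanValue.

(** Spaces with a finite system of continuous linear coordinates; they make
    the chain rule available for functions on, say, [R * 'rV[R]_m]. *)
Definition findim (R : realType) (V : normedModType R) : Prop :=
  exists m (A : {linear 'rV[R]_m -> V}) (B : {linear V -> 'rV[R]_m}),
    [/\ continuous A, continuous B & cancel B A].

Section FiniteDimension.
Variable R : realType.

Lemma findim_rV m : findim 'rV[R]_m.
Proof. by exists m, idfun, idfun; split=> // x; exact: cvg_id. Qed.

Lemma findim_mx p q : findim 'M[R]_(p, q).
Proof.
exists (p * q)%N, vec_mx, mxvec; split=> [x|x|]; last exact: mxvecK.
- apply: continuous_mx => i j.
  apply: (@eq_continuous_at _ _ (fun y : 'rV[R]_(p * q) => y 0 (mxvec_index i j))).
    by move=> y; rewrite mxE.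
  exact: coord_continuous.
- apply: continuous_mx => i j; rewrite ord1.
  case/mxvec_indexP: j => j k.
  apply: (@eq_continuous_at _ _ (fun y : 'M[R]_(p, q) => y j k)).
    by move=> y; rewrite mxvecE.
  exact: coord_continuous.
Qed.

Lemma findim_R : findim (R : normedModType R).
Proof.
have Al : linear (fun A : 'rV[R]_1 => A 0 0).
  by move=> a u v; rewrite !mxE.
have Bl : linear (fun x : R => x%:M : 'rV[R]_1).
  by move=> a u v; rewrite raddfD /= scale_scalar_mx.
pose A := HB.pack (fun A : 'rV[R]_1 => A 0 0 : R)
  (GRing.isLinear.Build R 'rV[R]_1 R *:%R _ Al) : {linear 'rV[R]_1 -> R}.
pose B := HB.pack (fun x : R => x%:M : 'rV[R]_1)
  (GRing.isLinear.Build R R 'rV[R]_1 *:%R _ Bl) : {linear R -> 'rV[R]_1}.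
exists 1%N, A, B; split=> [x|x|x].
- exact: coord_continuous.
- apply: continuous_mx => i j; rewrite /= !ord1.
  by apply: (@eq_continuous_at _ _ id) => [y|]; [rewrite mxE|exact: cvg_id].
- by rewrite /= mxE.
Qed.

Lemma continuous_row_mx p q r : continuous
  (fun z : 'M[R]_(p, q) * 'M[R]_(p, r) => row_mx z.1 z.2).
Proof.
move=> z; apply: continuous_mx => i j.
have rowE (y : 'M[R]_(p, q) * 'M[R]_(p, r)) : row_mx y.1 y.2 i j =
    (match fintype.split j with inl k => y.1 i k | inr k => y.2 i k end).
  by rewrite mxE.
apply: (eq_continuous_at (fun y => esym (rowE y))).
case: splitP => k _.
- apply: (@continuous_comp _ _ _ fst (fun A : 'M[R]_(p, q) => A i k)).
    exact: cvg_fst.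
  exact: coord_continuous.
- apply: (@continuous_comp _ _ _ snd (fun A : 'M[R]_(p, r) => A i k)).
    exact: cvg_snd.
  exact: coord_continuous.
Qed.

Lemma findim_prod (V1 V2 : normedModType R) :
  findim V1 -> findim V2 -> findim (V1 * V2)%type.
Proof.
move=> [m1 [A1 [B1 [A1c B1c K1]]]] [m2 [A2 [B2 [A2c B2c K2]]]].
have Al : linear (fun z : 'rV[R]_(m1 + m2) => (A1 (lsubmx z), A2 (rsubmx z))).
  by move=> a u v; rewrite !linearP.
have Bl : linear (fun z : V1 * V2 => row_mx (B1 z.1) (B2 z.2)).
  by move=> a u v; rewrite /= !linearP scale_row_mx add_row_mx.
pose A := HB.pack (fun z : 'rV[R]_(m1 + m2) => (A1 (lsubmx z), A2 (rsubmx z)))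
  (GRing.isLinear.Build R 'rV[R]_(m1 + m2) (V1 * V2)%type *:%R _ Al)
  : {linear 'rV[R]_(m1 + m2) -> (V1 * V2)%type}.
pose B := HB.pack (fun z : V1 * V2 => row_mx (B1 z.1) (B2 z.2))
  (GRing.isLinear.Build R (V1 * V2)%type 'rV[R]_(m1 + m2) *:%R _ Bl)
  : {linear (V1 * V2)%type -> 'rV[R]_(m1 + m2)}.
exists (m1 + m2)%N, A, B; split=> [z|z|z].
- apply: (@continuous_pair _ _ _ (A1 \o lsubmx) (A2 \o rsubmx)).
    by apply: continuous_comp; [exact: continuous_lsubmx|exact: A1c].
  by apply: continuous_comp; [exact: continuous_rsubmx|exact: A2c].
- apply: (@continuous_comp _ _ _ (fun z => (B1 z.1, B2 z.2))
    (fun z : 'rV[R]_m1 * 'rV[R]_m2 => row_mx z.1 z.2)).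
    apply: (@continuous_pair _ _ _ (B1 \o fst) (B2 \o snd)).
      by apply: continuous_comp; [exact: cvg_fst|exact: B1c].
    by apply: continuous_comp; [exact: cvg_snd|exact: B2c].
  exact: continuous_row_mx.
- by rewrite /= row_mxKl row_mxKr K1 K2; case: z.
Qed.

End FiniteDimension.

Section ChainRule.
Variable R : realType.

Lemma chain_rule_coordinates (V V' W : normedModType R) (m : nat)
    (A : {linear 'rV[R]_m -> V}) (B : {linear V -> 'rV[R]_m})
    (U : set V) (g : V -> W) (f : V' -> V) x v d :
  continuous A -> continuous B -> cancel B A -> findim W ->
  open U -> U (f x) -> Ck 1 U g -> is_derive x v f d ->
  is_derive x v (g \o f) (\sum_k B d 0 k *: 'D_(A (delta_mx 0 k)) g (f x)).
Proof.
move=> Ac Bc K [q [AW [BW [AWc BWc KW]]]] oU Ux gC fd.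
have oAU : open (A @^-1` U) by apply: open_comp.
have Bfd : is_derive x v (B \o f) (B d) by exact: is_derive_linear_comp.
have gAC : Ck 1 (A @^-1` U) (g \o A).
  by apply: (Ck_affine_comp (DA := A)) => // z w h; rewrite linearP.
have gAd k : 'D_(delta_mx 0 k) (g \o A) (B (f x)) =
    'D_(A (delta_mx 0 k)) g (f x).
  have := Ck_is_derive (A (delta_mx 0 k)) gC Ux; rewrite -{1}[f x]K => gd.
  have [_ ->] := is_derive_affine_comp (A := A) (x := B (f x))
    (v := delta_mx 0 k) (fun h => linearP A h _ _) gd.
  by [].
suff H : is_derive x v (BW \o (g \o f))
    (BW (\sum_k B d 0 k *: 'D_(A (delta_mx 0 k)) g (f x))).
  have := is_derive_linear_comp AWc H; rewrite KW.
  by congr is_derive; apply/funext => y /=; rewrite KW.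
apply/is_derive_mx => i j; rewrite ord1 {i}.
have gjC : Ck 1 (A @^-1` U) (fun y => BW (g (A y)) 0 j).
  have := Ck_linear_comp oAU BWc gAC.
  by move/(Ck_mx _ _ oAU)/(_ 0 j).
have UB : (A @^-1` U) (B (f x)) by rewrite /= K.
have := scalar_chain_rule (f := B \o f) oAU UB gjC Bfd.
rewrite (_ : _ \o _ = fun y => (BW \o (g \o f)) y 0 j); last first.
  by apply/funext => y /=; rewrite K.
move=> H; apply: is_derive_eq H _.
rewrite linear_sum summxE; apply: eq_bigr => k _.
rewrite linearZ_LR mxE; congr (_ * _).
rewrite -gAd; have := Ck_is_derive (delta_mx 0 k) gAC UB => H.
have := is_derive_linear_comp BWc H => /is_derive_mx/(_ 0 j) [_ ->].
by [].
Qed.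

Lemma derive_coordinates (V W : normedModType R) (m : nat)
    (A : {linear 'rV[R]_m -> V}) (B : {linear V -> 'rV[R]_m})
    (U : set V) (g : V -> W) x d :
  continuous A -> continuous B -> cancel B A -> findim W ->
  open U -> U x -> Ck 1 U g ->
  'D_d g x = \sum_k B d 0 k *: 'D_(A (delta_mx 0 k)) g x.
Proof.
move=> Ac Bc K fW oU Ux gC.
have := chain_rule_coordinates (f := id) (x := x) (v := d) Ac Bc K fW oU Ux gC
  (is_derive_id _ _).
by case.
Qed.

Lemma chain_rule (V V' W : normedModType R) (U : set V) (g : V -> W)
    (f : V' -> V) x v d :
  findim V -> findim W -> open U -> U (f x) -> Ck 1 U g -> is_derive x v f d ->
  is_derive x v (g \o f) ('D_d g (f x)).
Proof.
move=> [m [A [B [Ac Bc K]]]] fW oU Ux gC fd.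
rewrite (derive_coordinates _ Ac Bc K fW oU Ux gC).
exact: chain_rule_coordinates gC fd.
Qed.

Lemma derive_linear (V W : normedModType R) (U : set V) (g : V -> W) x (a : R) d e :
  findim V -> findim W -> open U -> U x -> Ck 1 U g ->
  'D_(a *: d + e) g x = a *: 'D_d g x + 'D_e g x.
Proof.
move=> [m [A [B [Ac Bc K]]]] fW oU Ux gC.
rewrite !(derive_coordinates _ Ac Bc K fW oU Ux gC).
rewrite scaler_sumr -big_split/=; apply: eq_bigr => k _.
by rewrite linearP !mxE scalerDl scalerA.
Qed.

Lemma deriveDv (V W : normedModType R) (U : set V) (g : V -> W) x d e :
  findim V -> findim W -> open U -> U x -> Ck 1 U g ->
  'D_(d + e) g x = 'D_d g x + 'D_e g x.
Proof.
move=> fV fW oU Ux gC; have := derive_linear 1 d e fV fW oU Ux gC.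
by rewrite !scale1r.
Qed.

Lemma deriveZv (V W : normedModType R) (U : set V) (g : V -> W) x (a : R) d :
  U x -> Ck 1 U g -> 'D_(a *: d) g x = a *: 'D_d g x.
Proof.
by move=> Ux gC; have [_ ->] := is_derive_scale a (Ck_is_derive d gC Ux).
Qed.

Lemma Ck_comp (V V' W : normedModType R) k (U : set V) (U' : set V') (g : V -> W)
    (f : V' -> V) :
  findim V -> findim W -> open U -> open U' -> (forall x, U' x -> U (f x)) ->
  Ck k U g -> Ck k U' f -> Ck k U' (g \o f).
Proof.
move=> fV fW oU oU' UU; have [m [A [B [Ac Bc K]]]] := fV.
elim: k g => [|k IH] g gC fC.
  split=> // x Ux; apply: continuous_comp.
    exact: Ck_continuous fC Ux.
  by apply: Ck_continuous gC _; exact: UU.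
have g1 : Ck 1 U g by elim: k gC {IH fC} => // k IH gC; apply: IH; exact: Ck_pred.
apply: (Ck_succ (df := fun v x =>
  \sum_k (B \o 'D_v f) x 0 k *: ('D_(A (delta_mx 0 k)) g \o f) x))
  => // [x Ux|x v Ux|v].
- apply: continuous_comp.
    exact: Ck_continuous fC Ux.
  by apply: Ck_continuous gC _; exact: UU.
- apply: chain_rule_coordinates g1 _ => //; first exact: UU.
  exact: Ck_is_derive fC Ux.
- apply: Ck_sum => // i; apply: Ck_fscale => //.
    have /Ck_mx : Ck k U' (B \o 'D_v f) by apply: Ck_linear_comp => //; exact: Ck_derive.
    by apply.
  by apply: IH; [exact: Ck_derive|exact: Ck_pred].
Qed.

End ChainRule.

Section SecondDerivatives.
Variable R : realType.

(** Two applications of the mean value theorem express the second difference,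
    which is symmetric in [u] and [v], by an iterated derivative nearby; hence
    the symmetry of second derivatives. *)
Lemma second_difference (V : normedModType R) (U : set V) (f : V -> R) x u v (r h : R) :
  ball x r `<=` U -> Ck 2 U f -> `|h| * (`|u| + `|v|) < r ->
  exists2 xi, `|xi - x| <= `|h| * (`|u| + `|v|) &
  f (h *: v + (h *: u + x)) - f (h *: u + x) - (f (h *: v + x) - f x) =
    h * h * 'D_v ('D_u f) xi.
Proof.
move=> rU fC hr.
have near (s s' : R) : 0 <= s <= 1 -> 0 <= s' <= 1 ->
    `|s' *: (h *: v) + (s *: (h *: u) + x) - x| <= `|h| * (`|u| + `|v|).
  move=> /andP[s0 s1] /andP[s'0 s'1]; rewrite addrA addrK mulrDr addrC.
  apply: le_trans (ler_normD _ _) _.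
  by apply: lerD; rewrite normrZ ger0_norm// normrZ ler_piMl// mulr_ge0.
have inU (s s' : R) : 0 <= s <= 1 -> 0 <= s' <= 1 ->
    U (s' *: (h *: v) + (s *: (h *: u) + x)).
  move=> s01 s'01; apply: rU; rewrite -ball_normE /ball_/= distrC.
  by apply: le_lt_trans hr; exact: near.
have i1 : 0 <= (1 : R) <= 1 by rewrite ler01 lexx.
have i0 : 0 <= (0 : R) <= 1 by rewrite ler01 lexx.
pose phi y := f (h *: v + y) - f y.
have phid (s : R) : 0 <= s <= 1 -> is_derive (s *: (h *: u) + x) (h *: u) phi
    (h * ('D_u f (h *: v + (s *: (h *: u) + x)) - 'D_u f (s *: (h *: u) + x))).
  move=> s01; have U1 := inU s 1 s01 i1; have U0 := inU s 0 s01 i0.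
  rewrite scale1r in U1; rewrite scale0r add0r in U0.
  rewrite mulrBr; apply: is_deriveB.
    apply: (@is_derive_affine_comp _ _ _ _ (fun y => h *: v + y) _ _ _ (h *: u)).
      by move=> k; rewrite addrCA.
    by apply: is_derive_scale; exact: Ck_is_derive fC U1.
  by apply: is_derive_scale; exact: Ck_is_derive fC U0.
have [c c01 E] := mean_value_line (fun s s01 =>
  @ex_derive _ _ _ _ _ _ _ (phid s s01)).
have D2 (s : R) : 0 <= s <= 1 -> is_derive (s *: (h *: v) + (c *: (h *: u) + x))
    (h *: v) ('D_u f) (h * 'D_v ('D_u f) (s *: (h *: v) + (c *: (h *: u) + x))).
  move=> s01; apply: is_derive_scale.
  by apply: Ck_is_derive (Ck_derive u fC) _; exact: inU.
have [c' c'01 E'] := mean_value_line (fun s s01 =>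
  @ex_derive _ _ _ _ _ _ _ (D2 s s01)).
exists (c' *: (h *: v) + (c *: (h *: u) + x)); first exact: near.
have [_ Dphi] := phid c c01; have [_ Dphi2] := D2 c' c'01.
by rewrite -/(phi (h *: u + x)) -/(phi x) E Dphi E' Dphi2 mulrA.
Qed.

Lemma derive_commute (V W : normedModType R) (U : set V) (f : V -> W) x u v :
  findim W -> open U -> U x -> Ck 2 U f ->
  'D_v ('D_u f) x = 'D_u ('D_v f) x.
Proof.
move=> [q [A [B [Ac Bc K]]]] oU Ux fC.
apply: (can_inj K); apply/rowP => j.
have fjC : Ck 2 U (fun y => B (f y) 0 j).
  by have := Ck_linear_comp oU Bc fC; move/(Ck_mx _ _ oU)/(_ 0 j).
have coordE k (g : V -> W) w y : Ck k.+1 U g -> U y ->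
    'D_w (fun y => B (g y) 0 j) y = B ('D_w g y) 0 j.
  move=> gC Uy.
  have := is_derive_linear_comp Bc (Ck_is_derive w gC Uy).
  by move=> /is_derive_mx /(_ 0 j)[].
have coordE2 w w' : 'D_w ('D_w' (fun y => B (f y) 0 j)) x =
    B ('D_w ('D_w' f) x) 0 j.
  rewrite -(coordE 0%N _ _ _ (Ck_derive w' fC) Ux); apply: near_eq_derive.
  by apply: near_open_eq oU Ux _ => y Uy; exact: coordE fC Uy.
rewrite -!coordE2; move: (fun y => B (f y) 0 j) fjC => {coordE coordE2}g gC.
have [r /= r0 rU] := (nbhs_ballP _ _).1 (open_nbhs_nbhs (conj oU Ux)).
have step w w' (h : R) : exists xi, `|h| * (`|w| + `|w'|) < r ->
    `|xi - x| <= `|h| * (`|w| + `|w'|) /\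
    g (h *: w' + (h *: w + x)) - g (h *: w + x) - (g (h *: w' + x) - g x) =
    h * h * 'D_w' ('D_w g) xi.
  have [hr|_] := boolP (`|h| * (`|w| + `|w'|) < r); last by exists 0.
  by have [xi ? ?] := second_difference rU gC hr; exists xi.
have lim w w' : (fun h => (h * h)^-1 * (g (h *: w' + (h *: w + x)) -
    g (h *: w + x) - (g (h *: w' + x) - g x))) @ 0^' --> 'D_w' ('D_w g) x.
  have [xi xiP] := choice (step w w').
  have small : (fun h : R => `|h| * (`|w| + `|w'|)) @ 0^' --> (0 : R).
    rewrite -[X in _ --> X](mul0r (`|w| + `|w'|)); apply: cvgM; last exact: cvg_cst.
    rewrite -[X in _ --> X](@normr0 _ R); apply: cvg_norm.
    exact: cvg_within.
  have nr : \forall h \near (0 : R)^', `|h| * (`|w| + `|w'|) < r.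
    move/cvgrPdist_lt : (small) => /(_ r r0); apply: filterS => h.
    by rewrite sub0r normrN; apply: le_lt_trans; exact: ler_norm.
  have xi_cvg : xi @ 0^' --> x.
    apply: cvg_ball_eq; apply: (@squeeze_cvgr _ _ _ _ (fun=> 0)
      (fun h => `|h| * (`|w| + `|w'|))); [|exact: cvg_cst|exact: small].
    near=> h; rewrite normr_ge0/=.
    by have [] := xiP h _; first by near: h; exact: nr.
  have := cvg_comp _ _ xi_cvg
    (Ck_continuous (Ck_derive w' (Ck_derive w gC)) Ux).
  apply: cvg_trans; apply: near_eq_cvg; near=> h.
  have [|_ ->] := xiP h; first by near: h; exact: nr.
  have h0 : h != 0 by near: h; exact: nbhs_dnbhs_neq.
  by rewrite mulrA mulVf ?mul1r// mulf_neq0.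
have := lim v u.
rewrite (_ : (fun h : R => _) = (fun h : R => (h * h)^-1 *
   (g (h *: v + (h *: u + x)) - g (h *: u + x) - (g (h *: v + x) - g x)))).
  by apply: cvg_unique (lim u v).
apply/funext => h; congr (_ * _).
rewrite [h *: u + (h *: v + x)]addrCA; move: (g _) (g _) (g _) (g _) => a b c e.
by ring.
Unshelve. all: by end_near. Qed.

End SecondDerivatives.

Section SmoothMatrices.
Variables (R : realType) (V : normedModType R).
Implicit Types (U : set V) (k : nat).

Lemma Ck_mulmx k U p q r (A : V -> 'M[R]_(p, q)) (B : V -> 'M[R]_(q, r)) :
  open U -> Ck k U A -> Ck k U B -> Ck k U (fun x => A x *m B x).
Proof.
move=> oU /(Ck_mx _ _ oU) AC /(Ck_mx _ _ oU) BC; apply/Ck_mx => // i j.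
apply: (@Ck_eq _ _ _ _ _ (fun x => \sum_h A x i h * B x h j)) => //.
  by move=> x _; rewrite mxE.
by apply: Ck_sum => // h; apply: Ck_mul.
Qed.

Lemma Ck_trmx k U p q (A : V -> 'M[R]_(p, q)) :
  open U -> Ck k U A -> Ck k U (fun x => (A x)^T).
Proof.
move=> oU /(Ck_mx _ _ oU) AC; apply/Ck_mx => // i j.
by apply: Ck_eq (AC j i) => // x _; rewrite mxE.
Qed.

Lemma Ck_det k U p (A : V -> 'M[R]_p) :
  open U -> Ck k U A -> Ck k U (fun x => \det (A x)).
Proof.
move=> oU /(Ck_mx _ _ oU) AC; apply: Ck_sum => // s.
by apply: Ck_mul => //; [exact: Ck_cst|apply: Ck_prod].
Qed.

Lemma Ck_invmx k U p (A : V -> 'M[R]_p) :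
  open U -> (forall x, U x -> A x \in unitmx) -> Ck k U A ->
  Ck k U (fun x => invmx (A x)).
Proof.
move=> oU Au AC.
apply: (@Ck_eq _ _ _ _ _ (fun x => (\det (A x))^-1 *: \adj (A x))) => //.
  by move=> x /Au Axu; rewrite /invmx Axu.
apply: Ck_fscale => //.
  apply: Ck_inv => //; last exact: Ck_det.
  by move=> x /Au; rewrite unitmxE unitfE.
apply/Ck_mx => // i j.
apply: (@Ck_eq _ _ _ _ _ (fun x => cofactor (A x) j i)) => //.
  by move=> x _; rewrite mxE.
apply: Ck_mul => //; first exact: Ck_cst.
apply: Ck_det => //; apply/Ck_mx => // i' j'.
have /(Ck_mx _ _ oU) AC' := AC.
by apply: Ck_eq (AC' (lift j i') (lift i j')) => // x _; rewrite !mxE.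
Qed.

Lemma Ck_row_mx k U p q r (A : V -> 'M[R]_(p, q)) (B : V -> 'M[R]_(p, r)) :
  open U -> Ck k U A -> Ck k U B -> Ck k U (fun x => row_mx (A x) (B x)).
Proof.
move=> oU /(Ck_mx _ _ oU) AC /(Ck_mx _ _ oU) BC; apply/Ck_mx => // i j.
apply: (@Ck_eq _ _ _ _ _ (fun x => match fintype.split j with
    inl k => A x i k | inr k => B x i k end)) => //.
  by move=> x _; rewrite mxE.
by case: fintype.split.
Qed.

Lemma Ck_lsubmx k U p q r (A : V -> 'M[R]_(p, q + r)) :
  open U -> Ck k U A -> Ck k U (fun x => lsubmx (A x)).
Proof.
move=> oU /(Ck_mx _ _ oU) AC; apply/Ck_mx => // i j.
by apply: Ck_eq (AC i (lshift _ j)) => // x _; rewrite mxE.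
Qed.

Lemma Ck_rsubmx k U p q r (A : V -> 'M[R]_(p, q + r)) :
  open U -> Ck k U A -> Ck k U (fun x => rsubmx (A x)).
Proof.
move=> oU /(Ck_mx _ _ oU) AC; apply/Ck_mx => // i j.
by apply: Ck_eq (AC i (rshift _ j)) => // x _; rewrite mxE.
Qed.

Lemma Ck_pair (W1 W2 : normedModType R) k U (f : V -> W1) (g : V -> W2) :
  open U -> Ck k U f -> Ck k U g -> Ck k U (fun x => (f x, g x)).
Proof.
move=> oU; elim: k f g => [|k IH] f g fC gC.
  split=> // x Ux; apply: continuous_pair.
    exact: Ck_continuous fC Ux.
  exact: Ck_continuous gC Ux.
apply: (Ck_succ (df := fun v x => ('D_v f x, 'D_v g x))) => // [x Ux|x v Ux|v].
- apply: continuous_pair.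
    exact: Ck_continuous fC Ux.
  exact: Ck_continuous gC Ux.
- apply: is_derive_cvg.
  have fd := cvg_is_derive (Ck_is_derive v fC Ux).
  have gd := cvg_is_derive (Ck_is_derive v gC Ux).
  exact: cvg_pair fd gd.
- by apply: IH; exact: Ck_derive.
Qed.

End SmoothMatrices.

(** * Differential inequalities *)

Section Gronwall.
Variables (R : realType) (m : nat).
Implicit Types (f u : R -> 'rV[R]_m) (a b s t : R).

Lemma mean_value_inequality f df (phi dphi : R -> R) a b :
  a <= b -> {within `[a, b], continuous f} -> {within `[a, b], continuous phi} ->
  (forall t, a < t < b -> is_derive t 1 f (df t)) ->
  (forall t, a < t < b -> is_derive t 1 phi (dphi t)) ->
  (forall t, a < t < b -> `|df t| <= dphi t) ->
  `|f b - f a| <= phi b - phi a.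
Proof.
move=> ab fc phic fd phid dle.
have fjc (j : 'I_m) : {within `[a, b], continuous (fun t => f t 0 j)}.
  move=> t; apply: (@continuous_comp (subspace `[a, b]) _ _ f
    (fun A : 'rV[R]_m => A 0 j)); first exact: fc.
  exact: coord_continuous.
have fjd (j : 'I_m) t : a < t < b -> is_derive t 1 (fun t => f t 0 j) (df t 0 j).
  by move=> /fd /is_derive_mx/(_ 0 j).
have one (s : R) (j : 'I_m) : `|s| = 1 -> s * (f b 0 j - f a 0 j) <= phi b - phi a.
  move=> s1.
  pose h t := phi t - s * f t 0 j.
  have hc : {within `[a, b], continuous h}.
    move=> t; apply: cvgB; first exact: phic.
    by apply: cvgM; [exact: cvg_cst|exact: fjc].
  have hd t : t \in `]a, b[ -> is_derive t 1 h (dphi t - s * df t 0 j).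
    rewrite in_itv/= => tab.
    by apply: is_deriveB; [exact: phid|exact: (is_deriveZ s (fjd j t tab))].
  have [->|anb] := eqVneq a b; first by rewrite !subrr mulr0.
  have altb : a < b by rewrite lt_neqAle anb.
  have [c cab E] := MVT altb hd hc.
  suff : 0 <= h b - h a by rewrite /h; lra.
  have {}cab : a < c < b by move: cab; rewrite in_itv.
  rewrite E mulr_ge0 ?subr_ge0// (le_trans _ (dle c _))//.
  rewrite (le_trans _ (le_mx_norm _ 0 j))// (le_trans (ler_norm _))//.
  by rewrite normrM s1 mul1r.
have phi0 : 0 <= phi b - phi a.
  have [->|anb] := eqVneq a b; first by rewrite subrr.
  have altb : a < b by rewrite lt_neqAle anb.
  have phid' t : t \in `]a, b[ -> is_derive t 1 phi (dphi t).
    by rewrite in_itv/=; exact: phid.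
  have [c cab E] := MVT altb phid' phic.
  have {}cab : a < c < b by move: cab; rewrite in_itv.
  by rewrite E mulr_ge0 ?subr_ge0//; apply: le_trans (dle c _).
apply: mx_norm_le => // i j; rewrite ord1 !mxE ler_norml.
have := one 1 j (normr1 _); have := one (-1) j; rewrite normrN1 => /(_ erefl).
by lra.
Qed.

Lemma is_derive_expR_lin (k t : R) :
  is_derive t 1 (fun t => expR (k * t)) (k * expR (k * t)).
Proof.
have kd : is_derive t 1 (fun t : R => k * t) k.
  by apply: is_derive_affine => h /=; rewrite mulrDr /GRing.scale/= mulr1 mulrC.
have ed := is_derive_expR (k * t).
have := is_derive1_comp ed kd.
by rewrite mulrC.
Qed.

Lemma continuous_expR_lin (k : R) : continuous (fun t : R => expR (k * t)).
Proof.
move=> t; apply: continuous_comp; last exact: continuous_expR.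
by apply: cvgM; [exact: cvg_cst|exact: cvg_id].
Qed.

(** The bound is obtained at a maximum point of [|u t| * exp (- (L + 1) t)];
    this avoids solving the integral inequality. *)
Lemma gronwall u du (L K : R) :
  0 <= L -> 0 <= K -> {within `[0, 1], continuous u} ->
  (forall t, 0 < t < 1 -> is_derive t 1 u (du t)) ->
  (forall t, 0 < t < 1 -> `|du t| <= L * `|u t| + K) ->
  forall t, 0 <= t <= 1 -> `|u t| <= (L + 1) * expR (L + 1) * (`|u 0| + K).
Proof.
move=> L0 K0 uc ud dle t t01.
pose k := L + 1.
have k0 : 0 < k by rewrite /k; lra.
pose w t := `|u t| * expR (- k * t).
have wc : {within `[0, 1], continuous w}.
  move=> s; apply: cvgM; first by apply: cvg_norm; exact: uc.
  by apply: continuous_subspaceT; exact: continuous_expR_lin.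
have [t1] := EVT_max (ler01 : (0 : R) <= 1) wc.
rewrite in_itv/= => /andP[t1_ge0 t1_le1] wmax.
pose M := w t1; pose E := expR (k * t1).
have wE s : `|u s| = w s * expR (k * s).
  by rewrite /w -mulrA -expRD mulNr addNr expR0 mulr1.
have ule s : 0 <= s <= 1 -> `|u s| <= M * expR (k * s).
  by move=> s01; rewrite wE ler_wpM2r ?expR_ge0// wmax// in_itv.
have M0 : 0 <= M by rewrite mulr_ge0// expR_ge0.
pose phi s := M * L / k * expR (k * s) + K * s.
have phid s : is_derive s 1 phi (M * L * expR (k * s) + K).
  apply: is_deriveD.
    apply: (is_derive_eq (is_deriveZ (M * L / k) (is_derive_expR_lin k s))).
    rewrite /GRing.scale/= mulrA; congr (_ * _).
    by rewrite divfK// gt_eqF.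
  by apply: is_derive_affine => h /=; rewrite mulrDr /GRing.scale/= mulr1 mulrC.
have phic : {within `[0, t1], continuous phi}.
  by apply: derivable_within_continuous => s _; have [] := phid s.
have uc1 : {within `[0, t1], continuous u}.
  apply: continuous_subspaceW uc => s /=; rewrite !in_itv/= => /andP[-> /=].
  by move/le_trans; apply.
have st1 s : 0 < s < t1 -> 0 < s < 1.
  by move=> /andP[-> st]; rewrite (lt_le_trans st).
have H := mean_value_inequality t1_ge0 uc1 phic (fun s st => ud s (st1 s st))
  (fun s _ => phid s) _.
have {}H : `|u t1 - u 0| <= phi t1 - phi 0.
  apply: H => s /st1 s01; apply: (le_trans (dle s s01)); rewrite lerD2r.
  rewrite -mulrA mulrCA ler_wpM2l//; apply: ule.
  by case/andP: s01 => /ltW -> /ltW ->.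
have E1 : 1 <= E by rewrite /E -expR0 ler_expR mulr_ge0// ltW.
have u1E : `|u t1| = M * E by rewrite wE.
have tri : `|u t1| <= `|u t1 - u 0| + `|u 0|.
  by rewrite -{1}[u t1](subrK (u 0)) ler_normD.
have ME : M <= k * (`|u 0| + K).
  have phi0 : 0 <= phi 0.
    by rewrite /phi !mulr0 addr0 !mulr_ge0// ?expR_ge0// invr_ge0 ltW.
  have Kt : K * t1 <= K by rewrite ler_piMr.
  have H1 : M * E <= M * L / k * E + (K + `|u 0|).
    rewrite -u1E (le_trans tri)// addrA lerD2r (le_trans H)//.
    by rewrite /phi -/E; move: phi0; rewrite /phi; lra.
  have H2 : M * E * k <= M * L * E + (K + `|u 0|) * k.
    have := ler_wpM2r (ltW k0) H1; rewrite mulrDl.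
    have -> : M * L / k * E * k = M * L * E by field; rewrite gt_eqF.
    by [].
  have H3 : M <= M * E by rewrite ler_peMr.
  have H4 : M * E <= (K + `|u 0|) * k.
    by move: H2; rewrite {1}/k; nra.
  by rewrite (le_trans H3)// (le_trans H4)// mulrC [K + _]addrC.
apply: le_trans (ule t t01) _.
rewrite -/k [leRHS]mulrAC ler_pM ?expR_ge0//.
by case/andP: t01 => ? ?; rewrite ler_expR ler_piMr// ltW.
Qed.

End Gronwall.

Section Clamp.
Variable R : realType.
Implicit Types (a b d s t : R).

Definition clamp a b t := Num.max a (Num.min b t).

Lemma clamp_itv a b t : a <= b -> a <= clamp a b t <= b.
Proof. by move=> ab; rewrite /clamp le_max lexx/= ge_max ab/= ge_min lexx. Qed.

Lemma clamp_id a b t : a <= t <= b -> clamp a b t = t.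
Proof. by move=> /andP[at_ tb]; rewrite /clamp min_r// max_r. Qed.

Lemma continuous_clamp a b : continuous (clamp a b).
Proof.
move=> t; apply: (@continuous_max _ _ (fun=> a) (fun t => Num.min b t)).
  exact: cvg_cst.
apply: (@continuous_min _ _ (fun=> b) id); first exact: cvg_cst.
exact: cvg_id.
Qed.

Lemma clamp_norm d t : 0 <= d -> `|clamp (- d) d t| <= `|t|.
Proof.
move=> d0; rewrite /clamp.
have [dt|td] := leP d t; last first.
  have [//|?] := leP (- d) t.
  by rewrite normrN ger0_norm// ltr0_norm; lra.
have -> : Num.max (- d) d = d by rewrite max_r; lra.
by rewrite !ger0_norm; lra.
Qed.

Lemma clamp_lipschitz d s t :
  `|clamp (- d) d s - clamp (- d) d t| <= `|s - t|.
Proof.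
have Hst := ler_norm (s - t); have := ler_norm (t - s); rewrite distrC => Hts.
rewrite /clamp ler_norml; apply/andP; split; rewrite /Order.max /Order.min;
  by repeat case: ifPn; rewrite -?leNgt => *; lra.
Qed.

Lemma continuous_clamp_comp (T : topologicalType) a b (f : R -> T) : a <= b ->
  (forall t, a <= t <= b -> {for t, continuous f}) -> continuous (f \o clamp a b).
Proof.
move=> ab fc t; apply: continuous_comp; first exact: continuous_clamp.
by apply: fc; exact: clamp_itv.
Qed.

Lemma near_clamp_id a b t : a < t < b -> \forall s \near t, clamp a b s = s.
Proof.
move=> tab; have : t \in `]a, b[ by rewrite in_itv.
move=> /near_in_itvoo; apply: filterS => s; rewrite in_itv/= => /andP[as_ sb].
by apply: clamp_id; rewrite !ltW.
Qed.

Lemma is_derive_clamp_comp (W : normedModType R) a b (f : R -> W) t df :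
  a < t < b -> is_derive t 1 f df -> is_derive t 1 (f \o clamp a b) df.
Proof.
move=> tab; apply: near_eq_is_derive.
by apply: filterS (near_clamp_id tab) => s /= ->.
Qed.

End Clamp.

(** * Existence of solutions *)

Section Picard.
Variables (R : realType) (m : nat).
Implicit Types s t : R.

Lemma exists_antiderivative_scalar (f : R -> R) : continuous f ->
  exists2 G : R -> R, continuous G & G 0 = 0 /\
    forall t, 0 < t < 1 -> is_derive t 1 G (f t).
Proof.
move=> fc.
pose F x := (\int[lebesgue_measure]_(t in `[-1, x]) f t)%R.
have Fd t : -1 < t < 2 -> is_derive t 1 F (f t).
  move=> /andP[t1 t2].
  have fi : lebesgue_measure.-integrable `[-1, 2] (EFin \o f).
    apply: continuous_compact_integrable; first exact: segment_compact.
    exact: continuous_subspaceT.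
  have [Fd FE] := continuous_FTC1_closed t2 fi t1 (fc t).
  by apply: DeriveDef; [exact: Fd|rewrite -derive1E; exact: FE].
exists (fun t => F (clamp 0 1 t) - F 0); last split.
- move=> t; apply: cvgB; last exact: cvg_cst.
  apply: (@continuous_clamp_comp _ _ 0 1 F) => // s /andP[s0 s1].
  have [|Fd' _] := Fd s; first by lra.
  exact/differentiable_continuous/derivable1_diffP.
- by rewrite clamp_id ?subrr// lexx ler01.
- move=> t t01; rewrite -[f t]subr0; apply: is_deriveB.
  apply: (@is_derive_clamp_comp _ _ 0 1 F) => //.
  by apply: Fd; lra.
Qed.

Lemma exists_antiderivative (f : R -> 'rV[R]_m) : continuous f ->
  exists2 G : R -> 'rV[R]_m, continuous G & G 0 = 0 /\
    forall t, 0 < t < 1 -> is_derive t 1 G (f t).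
Proof.
move=> fc.
have /choice[G GP] (j : 'I_m) : exists G : R -> R, continuous G /\ (G 0 = 0 /\
    forall t, 0 < t < 1 -> is_derive t 1 G (f t 0 j)).
  have fjc : continuous (fun t => f t 0 j).
    move=> t; apply: (@continuous_comp _ _ _ f (fun A : 'rV[R]_m => A 0 j)).
      exact: fc.
    exact: coord_continuous.
  by have [G] := exists_antiderivative_scalar fjc; exists G.
exists (fun t => \row_j G j t); last split.
- move=> t; apply: continuous_mx => i j.
  apply: (@eq_continuous_at _ _ (G j)) => [s|]; first by rewrite [RHS]mxE.
  by have [Gc _] := GP j; exact: Gc.
- by apply/rowP => j; rewrite !mxE; have [_ []] := GP j.
- move=> t t01; apply/is_derive_mx => i j; rewrite ord1.
  rewrite (_ : (fun y => _) = G j); last by apply/funext => s; rewrite mxE.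
  by have [_ [_ Gd]] := GP j; exact: Gd.
Qed.

Section Iteration.
Variables (H : R -> 'rV[R]_m -> 'rV[R]_m) (L : R) (z : 'rV[R]_m).
Hypothesis L0 : 0 <= L.
Hypothesis Hc : forall y : R -> 'rV[R]_m,
  continuous y -> continuous (fun t => H t (y t)).
Hypothesis HL : forall t v w, `|H t v - H t w| <= L * `|v - w|.

Let step (y y' : R -> 'rV[R]_m) := continuous y ->
  [/\ continuous y', y' 0 = z &
      forall t, 0 < t < 1 -> is_derive t 1 y' (H t (y t))].

Let step_total y : exists y', step y y'.
Proof.
have [yc|nyc] := pselect (continuous y); last by exists y.
have [G Gc [G0 Gd]] := exists_antiderivative (Hc yc).
exists (fun t => z + G t) => _; split.
- by move=> t; apply: cvgD; [exact: cvg_cst|exact: Gc].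
- by rewrite G0 addr0.
- by move=> t t01; rewrite -[H _ _]add0r; apply: is_deriveD; exact: Gd.
Qed.

(** Picard iteration; consecutive iterates differ by at most
    [C 2^-k exp (2 L t)], the weight [exp (2 L t)] making the integral operator
    a contraction on the whole of [[0, 1]]. *)
Lemma picard_existence : exists y : R -> 'rV[R]_m, [/\ continuous y, y 0 = z &
  forall t, 0 < t < 1 -> is_derive t 1 y (H t (y t))].
Proof.
have [P PP] := choice step_total.
pose y k := iter k P (fun=> z).
have yc k : continuous (y k).
  elim: k => [|k IH]; first by move=> t; exact: cvg_cst.
  by have [] := PP (y k) IH.
have yP k : [/\ continuous (y k.+1), y k.+1 0 = z &
    forall t, 0 < t < 1 -> is_derive t 1 (y k.+1) (H t (y k t))].
  exact: (PP (y k) (yc k)).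
have [t0 _ t0max] : exists2 c, c \in `[0, 1] &
    forall t, t \in `[0, 1] -> `|y 1%N t - y 0%N t| <= `|y 1%N c - y 0%N c|.
  apply: EVT_max => //; apply: continuous_subspaceT => t.
  by apply: cvg_norm; apply: cvgB; exact: yc.
pose C := `|y 1%N t0 - y 0%N t0|.
have C0 : 0 <= C by exact: normr_ge0.
have ind k t : 0 <= t <= 1 ->
    `|y k.+1 t - y k t| <= C / 2 ^+ k * expR (2 * L * t).
  elim: k t => [|k IH] t /andP[t_ge0 t_le1].
    rewrite expr0 divr1 (le_trans (t0max t _)) ?in_itv/= ?t_ge0//.
    by rewrite ler_peMr// -expR0 ler_expR !mulr_ge0.
  have [c1 y10 d1] := yP k; have [c2 y20 d2] := yP k.+1.
  pose phi s := C / 2 ^+ k.+1 * expR (2 * L * s).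
  have phid s : is_derive s 1 phi (L * (C / 2 ^+ k * expR (2 * L * s))).
    apply: (is_derive_eq (is_deriveZ _ (is_derive_expR_lin (2 * L) s))).
    by rewrite /GRing.scale/= exprS invfM; field; rewrite expf_neq0.
  have := @mean_value_inequality R m (fun s => y k.+2 s - y k.+1 s)
    (fun s => H s (y k.+1 s) - H s (y k s)) phi
    (fun s => L * (C / 2 ^+ k * expR (2 * L * s))) 0 t t_ge0.
  rewrite y20 y10 subrr subr0 => Hm; apply: le_trans (Hm _ _ _ _ _) _.
  - by apply: continuous_subspaceT => s; apply: cvgB; exact: yc.
  - by apply: derivable_within_continuous => s _; have [] := phid s.
  - move=> s /andP[s0 st]; have s01 : 0 < s < 1 by rewrite s0 (lt_le_trans st).
    by apply: is_deriveB; [exact: d2|exact: d1].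
  - move=> s /andP[s0 st]; apply: (le_trans (HL _ _ _)); rewrite ler_wpM2l// IH//.
    by rewrite ltW// ltW// (lt_le_trans st).
  - rewrite lerBlDr lerDl; apply: mulr_ge0; last exact: expR_ge0.
    by apply: divr_ge0; [exact: normr_ge0|exact: exprn_ge0].
pose A := C * expR (2 * L).
have A0 : 0 <= A by rewrite mulr_ge0 ?expR_ge0.
have step1 k t : 0 <= t <= 1 -> `|y k.+1 t - y k t| <= A / 2 ^+ k.
  move=> t01; apply: (le_trans (ind k t t01)); rewrite /A mulrAC.
  rewrite ler_wpM2r ?invr_ge0 ?exprn_ge0// ler_wpM2l// ler_expR.
  by case/andP: t01 => _ t1; rewrite ler_piMr// mulr_ge0.
have steps k p t : 0 <= t <= 1 -> `|y (k + p)%N t - y k t| <= 2 * A / 2 ^+ k.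
  move=> t01; suff : `|y (k + p)%N t - y k t| <= 2 * A / 2 ^+ k - 2 * A / 2 ^+ (k + p).
    by move/le_trans; apply; rewrite lerBlDr lerDl !mulr_ge0// invr_ge0 exprn_ge0.
  elim: p => [|p IH]; first by rewrite addn0 !subrr normr0.
  rewrite -(subrKA (y (k + p)%N t)) (le_trans (ler_normD _ _))//.
  have := step1 (k + p)%N t t01; rewrite addnS exprS => S1.
  have -> : 2 * A / (2 * 2 ^+ (k + p)) = A / 2 ^+ (k + p).
    by rewrite invfM mulrACA divff// mul1r.
  by move: IH S1; rewrite -!mulrA; lra.
have small (e : R) : 0 < e -> \forall k \near \oo, 2 * A / 2 ^+ k < e.
  move=> e0; have := @cvg_geometric R (2 * A) 2^-1.
  rewrite ger0_norm ?invr_ge0// invf_lt1// ltr1n => /(_ isT).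
  move=> /cvgrPdist_lt/(_ e e0).
  apply: filterS => k; rewrite /geometric/= sub0r normrN exprVn.
  by apply: le_lt_trans; exact: ler_norm.
have ycvg t : cvg ((fun k => y k (clamp 0 1 t)) @ \oo).
  apply/cauchy_cvgP/cauchy_exP => e e0.
  have [k _ kP] := small e e0.
  exists (y k (clamp 0 1 t)); exists k => // p /= kp.
  rewrite -ball_normE /ball_/= distrC -(subnKC kp).
  apply: le_lt_trans (kP k (leqnn k)); apply: steps; exact: clamp_itv.
pose Y t := lim ((fun k => y k (clamp 0 1 t)) @ \oo).
have Yy k t : `|Y t - y k (clamp 0 1 t)| <= 2 * A / 2 ^+ k.
  have nc : (fun p => `|y p (clamp 0 1 t) - y k (clamp 0 1 t)|) @ \oo -->
      `|Y t - y k (clamp 0 1 t)|.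
    by apply: cvg_norm; apply: cvgB; [exact: ycvg|exact: cvg_cst].
  apply: (cvgr_to_le nc); exists k => // p /= kp.
  by rewrite -(subnKC kp) steps// clamp_itv.
have Yc : continuous Y.
  move=> t; apply/cvgrPdist_lt => e e0.
  have e30 : 0 < e / 3 by rewrite divr_gt0.
  have [k _ /(_ k (leqnn k)) /= kP] := small _ e30.
  have : \forall s \near t, `|y k (clamp 0 1 t) - y k (clamp 0 1 s)| < e / 3.
    have : {for t, continuous (y k \o clamp 0 1)}.
      by apply: continuous_comp; [exact: continuous_clamp|exact: yc].
    by move=> /cvgrPdist_lt; apply; lra.
  apply: filterS => s ys.
  have Y1 := Yy k t; have Y2 := Yy k s.
  rewrite -(subrKA (y k (clamp 0 1 t))) (le_lt_trans (ler_normD _ _))//.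
  rewrite -[X in _ + `|X|](subrKA (y k (clamp 0 1 s))).
  have := ler_normD (y k (clamp 0 1 t) - y k (clamp 0 1 s))
    (y k (clamp 0 1 s) - Y s).
  by rewrite [`|_ - Y s|]distrC; move: ys kP Y1 Y2; lra.
have [PYc PY0 PYd] := PP Y Yc.
have PYE t : 0 <= t <= 1 -> P Y t = Y t.
  move=> /[dup] t01 /andP[t_ge0 t_le1].
  have bnd k : `|P Y t - y k.+1 t| <= 2 * L * A / 2 ^+ k.
    have [c1 y10 d1] := yP k.
    have phid s : is_derive s 1 (fun s => 2 * L * A / 2 ^+ k * s)
        (2 * L * A / 2 ^+ k).
      by apply: is_derive_affine => h /=; rewrite mulrDr /GRing.scale/= mulr1 mulrC.
    have B0 : 0 <= 2 * L * A / 2 ^+ k by rewrite !mulr_ge0// invr_ge0 exprn_ge0.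
    have := @mean_value_inequality R m (fun s => P Y s - y k.+1 s)
      (fun s => H s (Y s) - H s (y k s)) (fun s => 2 * L * A / 2 ^+ k * s)
      (fun s => 2 * L * A / 2 ^+ k) 0 t t_ge0.
    rewrite PY0 y10 subrr subr0 mulr0 subr0 => Hm; apply: le_trans (Hm _ _ _ _ _) _.
    - by apply: continuous_subspaceT => s; apply: cvgB; [exact: PYc|exact: yc].
    - by apply: derivable_within_continuous => s _; have [] := phid s.
    - move=> s /andP[s0 st]; have s01 : 0 < s < 1 by rewrite s0 (lt_le_trans st).
      by apply: is_deriveB; [exact: PYd|exact: d1].
    - move=> s /andP[s0 st]; apply: (le_trans (HL _ _ _)).
      have s01 : 0 < s < 1 by rewrite s0 (lt_le_trans st).
      have -> : 2 * L * A / 2 ^+ k = L * (2 * A / 2 ^+ k).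
        by move: (2 ^+ k)^-1 => q; ring.
      have := Yy k s; rewrite clamp_id => [|//]; first by move=> /ler_wpM2l; apply.
      by case/andP: s01 => /ltW -> /ltW ->.
    - by rewrite ler_piMr.
  apply/eqP; rewrite -subr_eq0 -normr_eq0 eq_le normr_ge0 andbT.
  apply/ler_addgt0Pl => e e0; rewrite addr0.
  have K0 : 0 < 1 + L := ltr_pwDl ltr01 L0.
  have [k _ /(_ k (leqnn k)) /= kP] := small (e / (1 + L)) (divr_gt0 e0 K0).
  have B1 := bnd k; have := Yy k.+1 t; rewrite clamp_id// exprS => Y1.
  move: kP B1 Y1; rewrite ltr_pdivlMr// => kP B1 Y1.
  have q0 : 0 <= 2 * A / 2 ^+ k by rewrite !mulr_ge0// invr_ge0 exprn_ge0.
  have E1 : 2 * L * A / 2 ^+ k = L * (2 * A / 2 ^+ k).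
    by move: (2 ^+ k)^-1 => q; ring.
  have E2 : 2 * A / (2 * 2 ^+ k) = (2 * A / 2 ^+ k) / 2.
    by rewrite invfM; ring.
  rewrite -(subrKA (y k.+1 t)) (le_trans (ler_normD _ _))// [X in _ + X]distrC.
  by move: kP B1 Y1 q0; rewrite E1 E2; move: (2 * A / 2 ^+ k) => q; lra.
exists (P Y); split=> // t t01.
rewrite PYE; first exact: PYd.
by case/andP: t01 => /ltW -> /ltW ->.
Qed.

End Iteration.

End Picard.

(** * Uniform estimates along a compact curve *)

Section LocalEstimates.
Variables (R : realType) (m : nat).
Implicit Types (U : set 'rV[R]_m) (s t : R) (x y z p : 'rV[R]_m).

Lemma derive_partials (W : normedModType R) U (f : 'rV[R]_m -> W) x v :
  findim W -> open U -> U x -> Ck 1 U f ->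
  'D_v f x = \sum_k v 0 k *: 'D_(delta_mx 0 k) f x.
Proof.
by move=> fW oU Ux fC; apply: (derive_coordinates (A := idfun) (B := idfun)
  _ _ _ _ fW oU Ux fC) => // y; exact: cvg_id.
Qed.

Lemma continuous_lt_ball (T : topologicalType) (f : T -> R) (c : R) (a : T) :
  {for a, continuous f} -> f a < c -> \forall b \near a, f b < c.
Proof. by move=> fc fx; apply: (cvgr_lt _ fc). Qed.

Lemma near_norm_lt (V : normedModType R) (P : V -> Prop) (v : V) :
  (\forall w \near v, P w) -> \forall d \near (0 : R)^'+, forall w, `|w - v| < d -> P w.
Proof.
move=> /nbhs_ballP[r /= r0 rP]; apply: filterS (nbhs_right_lt r0) => d dr w wd.
by apply: rP; rewrite -ball_normE /ball_/= distrC (lt_trans wd).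
Qed.

(** The constant is the inverse of the radius so that a single quantity going
    to zero controls both, as needed by the compactness argument below. *)
Lemma locally_lipschitz U (f : 'rV[R]_m -> R) p : open U -> U p -> Ck 1 U f ->
  \forall d \near (0 : R)^'+, forall y z, `|y - p| < d -> `|z - p| < d ->
    `|f y - f z| <= d^-1 * `|y - z|.
Proof.
move=> oU Up fC.
pose B := \sum_k (`|'D_(delta_mx 0 k) f p| + 1).
have B0 : 0 <= B by apply: sumr_ge0 => k _; rewrite addr_ge0.
have bnd : \forall d \near (0 : R)^'+, forall w, `|w - p| < d ->
    U w /\ forall k, `|'D_(delta_mx 0 k) f w| <= `|'D_(delta_mx 0 k) f p| + 1.
  have Dc k : {for p, continuous (fun w => `|'D_(delta_mx 0 k) f w|)}.
    apply: continuous_comp; last exact: norm_continuous.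
    exact: Ck_continuous (Ck_derive _ fC) Up.
  have Dlt : \forall w \near p, forall k,
      `|'D_(delta_mx 0 k) f w| < `|'D_(delta_mx 0 k) f p| + 1.
    apply: (@filter_forall _ _ (fun k w => `|'D_(delta_mx 0 k) f w| <
      `|'D_(delta_mx 0 k) f p| + 1) (nbhs p)) => k.
    by apply: (continuous_lt_ball (Dc k)); rewrite ltrDl.
  have := @filterI _ (nbhs p) (nbhs_filter p) _ _
    (open_nbhs_nbhs (conj oU Up)) Dlt.
  move=> /near_norm_lt; apply: filterS => d H w /H [Uw Dw]; split=> // k.
  exact/ltW/Dw.
near (0 : R)^'+ => d0.
have d00 : 0 < d0 by near: d0; exact: nbhs_right_gt.
have d0P : forall w, `|w - p| < d0 -> U w /\ forall k,
    `|'D_(delta_mx 0 k) f w| <= `|'D_(delta_mx 0 k) f p| + 1 by near: d0.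
near=> d => y z yd zd.
have dd0 : d < d0 / 3 by near: d; apply: nbhs_right_lt; rewrite divr_gt0.
have d_gt0 : 0 < d by near: d; exact: nbhs_right_gt.
have yz : `|y - z| < 2 * d.
  rewrite -(subrKA p) (le_lt_trans (ler_normD _ _))// [`|p - z|]distrC.
  by move: yd zd; lra.
have inb w : `|w - z| <= `|y - z| -> `|w - p| < d0.
  move=> wz; rewrite -(subrKA z) (le_lt_trans (ler_normD _ _))//.
  by move: wz yz zd dd0; lra.
have [w k wz|xi xi1 ->] := @partial_increments _ _ f z y.
  have [Uw _] := d0P w (inb w wz).
  by have [] := Ck_is_derive (delta_mx 0 k) fC Uw.
rewrite (le_trans (ler_norm_sum _ _ _))//.
apply: (@le_trans _ _ (\sum_k `|y - z| * (`|'D_(delta_mx 0 k) f p| + 1))).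
  apply: ler_sum => k _; rewrite normrM ler_pM//; first exact: le_mx_norm.
  by have [_] := d0P _ (inb _ (xi1 k)); apply.
rewrite -mulr_sumr mulrC ler_wpM2r// -/B.
have : d <= (B + 1)^-1 by near: d; apply: nbhs_right_le; rewrite invr_gt0; lra.
rewrite -lef_pV2 ?posrE// ?invr_gt0; last by lra.
by rewrite invrK; lra.
Unshelve. all: by end_near. Qed.

Lemma locally_quadratic U (f : 'rV[R]_m -> R) p : open U -> U p -> Ck 2 U f ->
  \forall d \near (0 : R)^'+, forall y z, `|y - p| < d -> `|z - p| < d ->
    `|f z - f y - 'D_(z - y) f y| <= d^-1 * `|z - y| ^+ 2.
Proof.
move=> oU Up fC.
have nU : \forall d \near (0 : R)^'+, forall w, `|w - p| < d -> U w.
  by apply: near_norm_lt; exact: open_nbhs_nbhs.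
have nL : \forall d \near (0 : R)^'+, forall k y z, `|y - p| < d -> `|z - p| < d ->
    `|'D_(delta_mx 0 k) f y - 'D_(delta_mx 0 k) f z| <= d^-1 * `|y - z|.
  apply: filter_forall => k; apply: locally_lipschitz oU Up _; exact: Ck_derive.
near (0 : R)^'+ => d0.
have d00 : 0 < d0 by near: d0; exact: nbhs_right_gt.
have d0U : forall w, `|w - p| < d0 -> U w by near: d0.
have d0L : forall k y z, `|y - p| < d0 -> `|z - p| < d0 ->
    `|'D_(delta_mx 0 k) f y - 'D_(delta_mx 0 k) f z| <= d0^-1 * `|y - z|.
  by near: d0.
have md : d0^-1 *+ m < d0^-1 *+ m.+1 by rewrite ltr_pMn2l ?invr_gt0.
have md0 : 0 < d0^-1 *+ m.+1 by rewrite pmulrn_lgt0 ?invr_gt0.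
near=> d => y z yd zd.
have dd0 : d < d0 / 3 by near: d; apply: nbhs_right_lt; rewrite divr_gt0.
have d_gt0 : 0 < d by near: d; exact: nbhs_right_gt.
have zy : `|z - y| < 2 * d.
  rewrite -(subrKA p) (le_lt_trans (ler_normD _ _))// [`|p - y|]distrC.
  by move: yd zd; lra.
have inb w : `|w - y| <= `|z - y| -> `|w - p| < d0.
  move=> wz; rewrite -(subrKA y) (le_lt_trans (ler_normD _ _))//.
  by move: wz zy yd dd0; lra.
have yb : `|y - p| < d0 by move: yd dd0; lra.
have Uy := d0U y yb.
have [w k wz|xi xi1 ->] := @partial_increments _ _ f y z.
  have Uw := d0U w (inb w wz).
  by have [] := Ck_is_derive (delta_mx 0 k) fC Uw.
rewrite (derive_partials _ (@findim_R R) oU Uy (Ck_pred fC)) -sumrB.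
rewrite (le_trans (ler_norm_sum _ _ _))//.
apply: (@le_trans _ _ (\sum_(k < m) `|z - y| * (d0^-1 * `|z - y|))).
  apply: ler_sum => k _; rewrite /GRing.scale/= -mulrBr normrM ler_pM//.
    exact: le_mx_norm.
  apply: (le_trans (d0L _ _ _ (inb _ (xi1 k)) yb)).
  by rewrite ler_wpM2l// invr_ge0 ltW.
rewrite sumr_const card_ord mulrCA -expr2 -mulrnAl ler_wpM2r ?exprn_ge0//.
have : d <= (d0^-1 *+ m.+1)^-1 by near: d; apply: nbhs_right_le; rewrite invr_gt0.
rewrite -lef_pV2 ?posrE// ?invr_gt0// invrK; apply: le_trans; exact: ltW.
Unshelve. all: by end_near. Qed.

Definition taylor_ball U (F : 'rV[R]_m -> 'rV[R]_m) p (d : R) :=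
  forall y z, `|y - p| < d -> `|z - p| < d ->
    [/\ U y, `|F y - F z| <= d^-1 * `|y - z| &
        `|F z - F y - 'D_(z - y) F y| <= d^-1 * `|z - y| ^+ 2].

Lemma taylor_ball_near U F p : open U -> U p -> Ck 2 U F ->
  \forall d \near (0 : R)^'+, taylor_ball U F p d.
Proof.
move=> oU Up FC.
have FjC j : Ck 2 U (fun x => F x 0 j) by move/(Ck_mx _ _ oU) : FC; exact.
have nU : \forall d \near (0 : R)^'+, forall w, `|w - p| < d -> U w.
  by apply: near_norm_lt; exact: open_nbhs_nbhs.
have nL : \forall d \near (0 : R)^'+, forall j y z, `|y - p| < d -> `|z - p| < d ->
    `|F y 0 j - F z 0 j| <= d^-1 * `|y - z|.
  apply: filter_forall => j; apply: (locally_lipschitz oU Up).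
  exact: Ck_pred.
have nQ : \forall d \near (0 : R)^'+, forall j y z, `|y - p| < d -> `|z - p| < d ->
    `|F z 0 j - F y 0 j - 'D_(z - y) (fun x => F x 0 j) y| <= d^-1 * `|z - y| ^+ 2.
  by apply: filter_forall => j; exact: (locally_quadratic oU Up (FjC j)).
near=> d => y z yd zd.
have d0 : 0 <= d^-1 by rewrite invr_ge0; near: d; exact: nbhs_right_ge.
have Uy : U y by apply: (near nU d).
split=> //.
- apply: mx_norm_le => [|i j]; first by rewrite mulr_ge0.
  by rewrite ord1 !mxE; apply: (near nL d).
- apply: mx_norm_le => [|i j]; first by rewrite mulr_ge0// exprn_ge0.
  have /is_derive_mx/(_ 0 j)[_ E] := Ck_is_derive (z - y) FC Uy.
  by rewrite ord1 !mxE -E; apply: (near nQ d).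
Unshelve. all: by end_near. Qed.

Lemma near_segment (P : R -> R -> Prop) a b :
  (forall t, a <= t <= b ->
    exists2 d0 : R, 0 < d0 & \forall s \near t, forall d, 0 < d < d0 -> P s d) ->
  \forall d \near (0 : R)^'+, forall t, a <= t <= b -> P t d.
Proof.
move=> aP.
have := @segment_compact R a b; move/compact_near_coveringP.
move=> /(_ _ ((0 : R)^'+) (fun d t => P t d) _) H.
apply: filterS (H _) => [d dP t tab|t].
  by apply: dP; rewrite /= in_itv.
rewrite /= in_itv/= => /aP[d0 d00 nP].
exists ([set s | forall d, 0 < d < d0 -> P s d], [set d | 0 < d < d0]) => /=.
  split=> //; near=> d; apply/andP; split.
    by near: d; exact: nbhs_right_gt.
  by near: d; exact: nbhs_right_lt.
by move=> [s d] [/= sP dd0]; exact: sP.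
Unshelve. all: by end_near. Qed.

Lemma taylor_tube U F (x : R -> 'rV[R]_m) a b : open U -> Ck 2 U F ->
  continuous x -> (forall t, a <= t <= b -> U (x t)) ->
  \forall d \near (0 : R)^'+, forall t, a <= t <= b -> taylor_ball U F (x t) d.
Proof.
move=> oU FC xc xU; apply: near_segment => t tab.
near (0 : R)^'+ => d0.
have d00 : 0 < d0 by near: d0; exact: nbhs_right_gt.
have T0 : taylor_ball U F (x t) d0.
  by near: d0; exact: (taylor_ball_near oU (xU t tab) FC).
exists (d0 / 2); first by rewrite divr_gt0.
near=> s => d /andP[d_gt0 dd0] y z yd zd.
have xs : `|x s - x t| < d0 / 2.
  near: s; have /cvgrPdist_lt/(_ (d0 / 2)) := xc t.
  by rewrite divr_gt0// => /(_ isT); apply: filterS => s; rewrite distrC.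
have close w : `|w - x s| < d -> `|w - x t| < d0.
  move=> wd; rewrite -(subrKA (x s)) (le_lt_trans (ler_normD _ _))//.
  by move: wd xs dd0; lra.
have dV : d0^-1 <= d^-1 by rewrite lef_pV2 ?posrE//; move: dd0 d_gt0; lra.
have [Uy L1 Q1] := T0 y z (close y yd) (close z zd).
split=> //.
- by rewrite (le_trans L1)// ler_wpM2r.
- by rewrite (le_trans Q1)// ler_wpM2r// exprn_ge0.
Unshelve. all: by end_near. Qed.

End LocalEstimates.

(** * The time-one map of a vector field *)

Section TimeOne.
Variable R : realType.
Implicit Types s t : R.

(** Continuity is imposed on the whole line so that restrictions to [[0, 1]] need
    not be mentioned; freezing a curve outside the interval achieves it. *)
Definition integral_curve m (U : set 'rV[R]_m) (F : 'rV[R]_m -> 'rV[R]_m)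
    (z : 'rV[R]_m) (x : R -> 'rV[R]_m) : Prop :=
  [/\ continuous x, x 0 = z, forall t, 0 <= t <= 1 -> U (x t) &
      forall t, 0 < t < 1 -> is_derive t 1 x (F (x t))].

Definition time_one_domain m (U : set 'rV[R]_m) F : set 'rV[R]_m :=
  [set z | exists x, integral_curve U F z x].

Definition time_one m (U : set 'rV[R]_m) F (z : 'rV[R]_m) : 'rV[R]_m :=
  xget (fun=> 0) (integral_curve U F z) 1.

Section Uniqueness.
Variables (m : nat) (U : set 'rV[R]_m) (F : 'rV[R]_m -> 'rV[R]_m).
Hypotheses (oU : open U) (FC : Ck 2 U F).

(** The two solutions are compared wherever they are: close to each other the
    field is Lipschitz, and where they differ the quotient of
    [|F (x t) - F (y t)|] by [|x t - y t|] is locally bounded. *)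
Lemma lipschitz_two_curves (x y : R -> 'rV[R]_m) :
  continuous x -> continuous y -> (forall t, 0 <= t <= 1 -> U (x t)) ->
  (forall t, 0 <= t <= 1 -> U (y t)) ->
  \forall d \near (0 : R)^'+, forall t, 0 <= t <= 1 ->
    `|F (x t) - F (y t)| <= d^-1 * `|x t - y t|.
Proof.
move=> xc yc xU yU; apply: near_segment => t t01.
have [xy|xy] := eqVneq (x t) (y t).
  have nT := taylor_ball_near oU (xU t t01) FC.
  near (0 : R)^'+ => d0.
  have d00 : 0 < d0 by near: d0; exact: nbhs_right_gt.
  have T0 : taylor_ball U F (x t) d0 by near: d0; exact: nT.
  exists d0 => //; near=> s => d /andP[d_gt0 dd0].
  have xs : `|x s - x t| < d0.
    near: s; have /cvgrPdist_lt/(_ d0 d00) := xc t; apply: filterS => s.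
    by rewrite distrC.
  have ys : `|y s - x t| < d0.
    rewrite xy; near: s; have /cvgrPdist_lt/(_ d0 d00) := yc t.
    by apply: filterS => s; rewrite distrC.
  have [_ L1 _] := T0 _ _ xs ys; rewrite (le_trans L1)// ler_wpM2r//.
  by rewrite lef_pV2 ?posrE// ltW.
have Fx : {for t, continuous (fun s => F (x s))}.
  by apply: continuous_comp; [exact: xc|exact: Ck_continuous FC (xU t t01)].
have Fy : {for t, continuous (fun s => F (y s))}.
  by apply: continuous_comp; [exact: yc|exact: Ck_continuous FC (yU t t01)].
have Nc : {for t, continuous (fun s => `|F (x s) - F (y s)|)}.
  by apply: cvg_norm; apply: cvgB; [exact: Fx|exact: Fy].
have Dc : {for t, continuous (fun s => - `|x s - y s|)}.
  by apply: cvgN; apply: cvg_norm; apply: cvgB; [exact: xc|exact: yc].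
pose c := `|x t - y t| / 2; pose B := `|F (x t) - F (y t)| + 1.
have c0 : 0 < c by rewrite divr_gt0// normr_gt0 subr_eq0.
have B0 : 0 < B by rewrite ltr_wpDl.
exists (c / B); first by rewrite divr_gt0.
have n1 : \forall s \near t, `|F (x s) - F (y s)| < B.
  by apply: (continuous_lt_ball Nc); rewrite ltrDl.
have n2 : \forall s \near t, - `|x s - y s| < - c.
  by apply: (continuous_lt_ball Dc); rewrite /c; move: c0; rewrite /c; lra.
apply: filterS2 n1 n2 => s sB sc d /andP[d0 dcB].
rewrite mulrC ler_pdivlMr//.
move: dcB; rewrite ltr_pdivlMr// => dcB.
apply: (@le_trans _ _ c); last by move: sc; lra.
by rewrite mulrC; apply: le_trans (ltW dcB); rewrite ler_wpM2l ?ltW.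
Unshelve. all: by end_near. Qed.

Lemma integral_curve_unique z (x y : R -> 'rV[R]_m) :
  integral_curve U F z x -> integral_curve U F z y ->
  forall t, 0 <= t <= 1 -> x t = y t.
Proof.
move=> [xc x0 xU xd] [yc y0 yU yd] t t01.
near (0 : R)^'+ => d.
have dV0 : 0 <= d^-1 by rewrite invr_ge0; near: d; exact: nbhs_right_ge.
have dL : forall t, 0 <= t <= 1 -> `|F (x t) - F (y t)| <= d^-1 * `|x t - y t|.
  by near: d; exact: lipschitz_two_curves.
have := @gronwall R m (fun t => x t - y t) (fun t => F (x t) - F (y t)) d^-1 0
  dV0 (lexx 0).
rewrite x0 y0 subrr normr0 addr0 => H.
apply/eqP; rewrite -subr_eq0 -normr_eq0 eq_le normr_ge0 andbT.
apply: le_trans (H _ _ _ t t01) _; last by rewrite mulr0.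
- by apply: continuous_subspaceT => s; apply: cvgB; [exact: xc|exact: yc].
- by move=> s s01; apply: is_deriveB; [exact: xd|exact: yd].
- move=> s /andP[/ltW s0 /ltW s1]; rewrite addr0; apply: dL.
  by rewrite s0.
Unshelve. all: by end_near. Qed.

Lemma time_oneE z (x : R -> 'rV[R]_m) : integral_curve U F z x ->
  time_one U F z = x 1.
Proof.
move=> xz.
have Exz : exists x, integral_curve U F z x by exists x.
have := integral_curve_unique (xgetPex (fun=> 0) Exz) xz.
by apply; rewrite ler01 lexx.
Qed.

(** Around the given solution [x] the field is replaced by its composition
    with the coordinatewise projection on a tube; this makes it globally
    Lipschitz, and solutions that start close to [x 0] never notice. *)
Lemma integral_curve_nearby z (x : R -> 'rV[R]_m) : integral_curve U F z x ->
  exists2 r : R, 0 < r & exists2 C : R, 0 <= C & forall z', `|z' - z| < r ->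
    exists2 y, integral_curve U F z' y &
      forall t, 0 <= t <= 1 -> `|y t - x t| <= C * `|z' - z|.
Proof.
move=> [xc x0 xU xd].
near (0 : R)^'+ => d.
have d0 : 0 < d by near: d; exact: nbhs_right_gt.
have T : forall t, 0 <= t <= 1 -> taylor_ball U F (x t) d.
  by near: d; exact: taylor_tube.
pose e := d / 2.
have e0 : 0 < e by rewrite divr_gt0.
have ed : e < d by rewrite /e; move: d0; lra.
pose proj (w : 'rV[R]_m) : 'rV[R]_m := \row_j clamp (- e) e (w 0 j).
have proj_norm w : `|proj w| <= `|w|.
  apply: mx_norm_le => // i j; rewrite mxE (le_trans (clamp_norm _ (ltW e0)))//.
  exact: le_mx_norm.
have proj_le w : `|proj w| <= e.
  apply: mx_norm_le => [|i j]; first exact: ltW.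
  by rewrite mxE ler_norml clamp_itv//; move: e0; lra.
have proj_lip v w : `|proj v - proj w| <= `|v - w|.
  apply: mx_norm_le => // i j; rewrite !mxE (le_trans (clamp_lipschitz _ _ _))//.
  by have := le_mx_norm (v - w) 0 j; rewrite !mxE.
have proj_id w : `|w| <= e -> proj w = w.
  move=> we; apply/rowP => j; rewrite mxE clamp_id//.
  by rewrite -ler_norml (le_trans (le_mx_norm _ 0 j)).
have projc : continuous proj.
  move=> w; apply/(@cvgrPdist_lt _ _ _ (nbhs w)) => k k0.
  apply/nbhs_ballP; exists k => //= v; rewrite -ball_normE /ball_/=.
  by apply: le_lt_trans; exact: proj_lip.
pose c := clamp (0 : R) 1.
have c01 t : 0 <= c t <= 1 by exact: clamp_itv.
pose xx t := x (c t).
have xxc : continuous xx.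
  by move=> t; apply: continuous_comp; [exact: continuous_clamp|exact: xc].
pose H t w := F (xx t + proj (w - xx t)).
have close t w : `|xx t + proj (w - xx t) - xx t| < d.
  by rewrite addrAC subrr add0r (le_lt_trans (proj_le _)).
have HU t w : U (xx t + proj (w - xx t)).
  by have [] := T (c t) (c01 t) _ _ (close t w) (close t w).
have Hc y : continuous y -> continuous (fun t => H t (y t)).
  move=> yc t; apply: (@continuous_comp _ _ _ (fun t => xx t + proj (y t - xx t)) F).
    apply: cvgD; first exact: xxc.
    apply: (@continuous_comp _ _ _ (fun t => y t - xx t) proj); last exact: projc.
    by apply: cvgB; [exact: yc|exact: xxc].
  exact: Ck_continuous FC (HU _ _).
have dV0 : 0 <= d^-1 by rewrite invr_ge0 ltW.
have HL t v w : `|H t v - H t w| <= d^-1 * `|v - w|.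
  have [_ L1 _] := T (c t) (c01 t) _ _ (close t v) (close t w).
  rewrite (le_trans L1)// ler_wpM2l// opprD addrACA subrr add0r.
  by rewrite (le_trans (proj_lip _ _))// opprB addrA subrK.
pose C := (d^-1 + 1) * expR (d^-1 + 1).
have C0 : 0 < C by rewrite mulr_gt0 ?expR_gt0// ltr_wpDl.
exists (e / C); first by rewrite divr_gt0.
exists C => [|z' zr]; first exact: ltW.
have [y [yc y0 yd]] := picard_existence z' dV0 Hc HL.
have yx t : 0 <= t <= 1 -> `|y t - x t| <= C * `|z' - z|.
  move=> t01.
  have := @gronwall R m (fun t => y t - x t) (fun t => H t (y t) - F (x t)) d^-1 0
    dV0 (lexx 0).
  rewrite x0 y0 addr0 => G; apply: G => //.
  - by apply: continuous_subspaceT => s; apply: cvgB; [exact: yc|exact: xc].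
  - by move=> s s01; apply: is_deriveB; [exact: yd|exact: xd].
  - move=> s /andP[/ltW s0 /ltW s1]; rewrite addr0.
    have cs : c s = s by apply: clamp_id; rewrite s0.
    have xs : xx s = x s by rewrite /xx cs.
    have xb : `|x s - xx s| < d by rewrite xs subrr normr0.
    have [_ L1 _] := T (c s) (c01 s) _ _ (close s (y s)) xb.
    rewrite (le_trans L1)// ler_wpM2l// xs addrAC subrr add0r.
    exact: proj_norm.
have ye t : 0 <= t <= 1 -> `|y t - x t| <= e.
  move=> t01; rewrite (le_trans (yx t t01))//.
  by rewrite mulrC -ler_pdivlMr// ltW.
exists y => //; split=> // [t t01|t t01].
- have xb : `|x t - x t| < d by rewrite subrr normr0.
  have yb : `|y t - x t| < d by rewrite (le_lt_trans (ye t t01)).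
  by have [] := T t t01 _ _ yb xb.
- have t01' : 0 <= t <= 1 by case/andP: t01 => /ltW -> /ltW ->.
  have := yd t t01; rewrite /H /xx /c clamp_id// proj_id ?ye//.
  by rewrite addrC subrK.
Unshelve. all: by end_near. Qed.

Lemma open_time_one_domain : open (time_one_domain U F).
Proof.
rewrite openE => z [x xz]; have [r r0 [C _ H]] := integral_curve_nearby xz.
apply/nbhs_ballP; exists r => //= z'; rewrite -ball_normE /ball_/= distrC => zr.
by have [y ? _] := H z' zr; exists y.
Qed.

Lemma continuous_time_one z : time_one_domain U F z ->
  {for z, continuous (time_one U F)}.
Proof.
move=> [x xz]; have [r r0 [C C0 H]] := integral_curve_nearby xz.
suff : time_one U F @ z --> time_one U F z by [].
apply/(@cvgrPdist_lt _ _ _ (nbhs z)) => e e0; rewrite (time_oneE xz).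
have K0 : 0 < C + 1 by rewrite ltr_wpDl.
apply/nbhs_ballP; exists (Num.min r (e / (C + 1))) => /=.
  by rewrite lt_min r0 divr_gt0.
move=> z'; rewrite -ball_normE /ball_/= distrC lt_min => /andP[zr ze].
have [y yz yx] := H z' zr; rewrite (time_oneE yz) distrC.
apply: (le_lt_trans (yx 1 _)); first by rewrite ler01 lexx.
move: ze; rewrite ltr_pdivlMr//; have := normr_ge0 (z' - z); nra.
Qed.

End Uniqueness.
End TimeOne.

Section TimeOneSmooth.
Variable R : realType.
Implicit Types s t : R.

Definition tangent_field m (F : 'rV[R]_m -> 'rV[R]_m) (z : 'rV[R]_(m + m)) :
    'rV[R]_(m + m) :=
  row_mx (F (lsubmx z)) ('D_(rsubmx z) F (lsubmx z)).

Lemma Ck_lsubmx_id k p q (U : set 'rV[R]_(p + q)) : open U -> Ck k U lsubmx.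
Proof.
move=> oU; apply: (@Ck_affine R _ _ k U _ lsubmx oU) => [|x v h].
  exact: continuous_lsubmx.
by rewrite linearP.
Qed.

Lemma Ck_rsubmx_id k p q (U : set 'rV[R]_(p + q)) : open U -> Ck k U rsubmx.
Proof.
move=> oU; apply: (@Ck_affine R _ _ k U _ rsubmx oU) => [|x v h].
  exact: continuous_rsubmx.
by rewrite linearP.
Qed.

Lemma Ck_tangent_field m k (U : set 'rV[R]_m) F :
  open U -> Ck k.+1 U F -> (0 < k)%N ->
  Ck k (lsubmx @^-1` U : set 'rV[R]_(m + m)) (tangent_field F).
Proof.
move=> oU FC k0.
have oTU : open (lsubmx @^-1` U : set 'rV[R]_(m + m)).
  by apply: open_comp => // z _; exact: continuous_lsubmx.
have compl (g : 'rV[R]_m -> 'rV[R]_m) : Ck k U g ->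
    Ck k (lsubmx @^-1` U : set 'rV[R]_(m + m)) (fun z => g (lsubmx z)).
  move=> gC; apply: (Ck_affine_comp (A := @lsubmx _ 1 m m) (DA := @lsubmx _ 1 m m) oU)
    => //; first exact: continuous_lsubmx.
  by move=> x v h; rewrite linearP.
apply: Ck_row_mx => //; first by apply: compl; exact: Ck_pred.
have F1 : Ck 1 U F by elim: k FC {k0 compl} => // k IH /Ck_pred; exact: IH.
apply: (@Ck_eq _ _ _ _ _ (fun z : 'rV[R]_(m + m) =>
   \sum_k (rsubmx z) 0 k *: 'D_(delta_mx 0 k) F (lsubmx z))) => //.
  move=> z Uz; rewrite -(derive_partials (rsubmx z) (@findim_rV R m) oU _ F1)//.
apply: Ck_sum => // j; apply: Ck_fscale => //.
  have /Ck_mx := @Ck_rsubmx_id k _ _ _ oTU; exact.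
exact: (compl ('D_(delta_mx 0 j) F) (Ck_derive (delta_mx 0 j) FC)).
Qed.

Section Variational.
Variables (m : nat) (U : set 'rV[R]_m) (F : 'rV[R]_m -> 'rV[R]_m).
Hypotheses (oU : open U) (FC : Ck 3 U F).

Let F2 : Ck 2 U F. Proof. exact: Ck_pred. Qed.
Let F1 : Ck 1 U F. Proof. by do 2 apply: Ck_pred. Qed.

Lemma taylor_ball_derive p d v : 0 < d <= 1 -> taylor_ball U F p d ->
  `|'D_v F p| <= 2 * d^-1 * `|v|.
Proof.
move=> /andP[d0 d1] T.
have [->|v0] := eqVneq v 0; first by rewrite derive0 !normr0 mulr0.
have nv : 0 < `|v| by rewrite normr_gt0.
have pp : `|p - p| < d by rewrite subrr normr0.
pose s := d / (2 * `|v|).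
have s0 : 0 < s by rewrite divr_gt0// mulr_gt0.
have sv : `|s *: v| = d / 2.
  by rewrite normrZ gtr0_norm// /s; field; rewrite gt_eqF.
have vp : `|s *: v + p - p| < d by rewrite addrK sv; move: d0; lra.
have [Up L1 Q1] := T p (s *: v + p) pp vp.
have sE : 'D_(s *: v) F p = s *: 'D_v F p by exact: deriveZv Up F1.
have := Q1; rewrite addrK sE => {}Q1.
have {}L1 : `|F (s *: v + p) - F p| <= d^-1 * `|s *: v|.
  by rewrite distrC (le_trans L1)// distrC addrK.
have H : `|s *: 'D_v F p| <= 2 * d^-1 * `|s *: v|.
  rewrite -[s *: 'D_v F p](subKr (F (s *: v + p) - F p)).
  rewrite (le_trans (ler_normB _ _))//.
  have sq : `|s *: v| ^+ 2 <= `|s *: v|.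
    by rewrite expr2 ler_piMl// sv; move: d0 d1; lra.
  have dV0 : 0 < d^-1 by rewrite invr_gt0.
  have := ler_wpM2l (ltW dV0) sq; move: L1 Q1; lra.
have ns : `|s| = s by rewrite gtr0_norm.
by move: H; rewrite (normrZ s) (normrZ s) ns [leRHS]mulrCA ler_pM2l.
Qed.

(** Solutions of the linearised equation exist for all time, the equation being
    linear; together with [x] they are the integral curves of the tangent
    field. *)
Lemma variational_solution z (x : R -> 'rV[R]_m) w : integral_curve U F z x ->
  exists y : R -> 'rV[R]_m, [/\ continuous y, y 0 = w &
    forall t, 0 < t < 1 -> is_derive t 1 y ('D_(y t) F (x t))].
Proof.
move=> [xc x0 xU xd].
near (0 : R)^'+ => d.
have d0 : 0 < d by near: d; exact: nbhs_right_gt.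
have d1 : d <= 1 by near: d; exact: nbhs_right_le.
have T : forall t, 0 <= t <= 1 -> taylor_ball U F (x t) d.
  by near: d; exact: taylor_tube.
pose c := clamp (0 : R) 1.
have c01 t : 0 <= c t <= 1 by exact: clamp_itv.
pose H t v := 'D_v F (x (c t)).
have Uc t : U (x (c t)) := xU _ (c01 t).
have HE t v : H t v = \sum_k v 0 k *: 'D_(delta_mx 0 k) F (x (c t)).
  exact: derive_partials (@findim_rV R m) oU (Uc t) F1.
have Hc y : continuous y -> continuous (fun t => H t (y t)).
  move=> yc t; apply: (eq_continuous_at (fun t => esym (HE t (y t)))).
  apply: (@cvg_sum_fun R _ _ _ (nbhs t)) => k; apply: cvgZ.
    apply: (@continuous_comp _ _ _ y (fun A : 'rV[R]_m => A 0 k)).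
      exact: yc.
    exact: coord_continuous.
  apply: (@continuous_comp _ _ _ (fun t => x (c t)) ('D_(delta_mx 0 k) F)).
    by apply: continuous_comp; [exact: continuous_clamp|exact: xc].
  exact: Ck_continuous (Ck_derive (delta_mx 0 k) F1) (Uc t).
have L0 : 0 <= 2 * d^-1 by rewrite mulr_ge0// invr_ge0 ltW.
have HL t v v' : `|H t v - H t v'| <= 2 * d^-1 * `|v - v'|.
  have -> : H t v - H t v' = H t (v - v').
    rewrite !HE -sumrB; apply: eq_bigr => k _.
    by rewrite !mxE scalerBl.
  by apply: taylor_ball_derive; [rewrite d0|exact: T].
have [y [yc y0 yd]] := picard_existence w L0 Hc HL.
exists y; split=> // t t01; have := yd t t01; rewrite /H /c clamp_id//.
by case/andP: t01 => /ltW -> /ltW ->.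
Unshelve. all: by end_near. Qed.

Lemma tangent_integral_curve z (x : R -> 'rV[R]_m) w y :
  integral_curve U F z x -> continuous y -> y 0 = w ->
  (forall t, 0 < t < 1 -> is_derive t 1 y ('D_(y t) F (x t))) ->
  integral_curve (lsubmx @^-1` U) (tangent_field F) (row_mx z w)
    (fun t => row_mx (x t) (y t)).
Proof.
move=> [xc x0 xU xd] yc y0 yd; split.
- move=> t.
  apply: (@continuous_comp _ _ _ (fun t => (x t, y t))
    (fun z : 'rV[R]_m * 'rV[R]_m => row_mx z.1 z.2)).
    by apply: continuous_pair; [exact: xc|exact: yc].
  exact: continuous_row_mx.
- by rewrite x0 y0.
- by move=> t t01 /=; rewrite row_mxKl; exact: xU.
- move=> t t01; rewrite /tangent_field row_mxKl row_mxKr.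
  apply/is_derive_mx => i j; rewrite mxE.
  have xdt := xd t t01; have ydt := yd t t01.
  have E t' : row_mx (x t') (y t') i j = match fintype.split j with
    | inl k => x t' i k | inr k => y t' i k end by rewrite mxE.
  rewrite (funext E); case: fintype.split => k.
    by have /is_derive_mx := xdt; exact.
  by have /is_derive_mx := ydt; exact.
Qed.

Lemma is_derive_time_one z w : time_one_domain U F z ->
  time_one_domain (lsubmx @^-1` U) (tangent_field F) (row_mx z w) /\
  is_derive z w (time_one U F)
    (rsubmx (time_one (lsubmx @^-1` U) (tangent_field F) (row_mx z w))).
Proof.
move=> [x xz]; have [y [yc y0 yd]] := variational_solution w xz.
have xyz := tangent_integral_curve xz yc y0 yd.
split; first by eexists; exact: xyz.
have oTU : open (lsubmx @^-1` U : set 'rV[R]_(m + m)).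
  by apply: open_comp => // v _; exact: continuous_lsubmx.
rewrite (time_oneE oTU (Ck_tangent_field oU FC _) xyz)// row_mxKr.
have [r r0 [C C0 H]] := integral_curve_nearby oU F2 xz.
have [xc x0 xU xd] := xz.
near (0 : R)^'+ => d.
have d0 : 0 < d by near: d; exact: nbhs_right_gt.
have d1 : d <= 1 by near: d; exact: nbhs_right_le.
have T : forall t, 0 <= t <= 1 -> taylor_ball U F (x t) d.
  by near: d; exact: taylor_tube.
have dV0 : 0 < d^-1 by rewrite invr_gt0.
pose K := (2 * d^-1 + 1) * expR (2 * d^-1 + 1) * (d^-1 * (C * `|w|) ^+ 2).
have K0 : 0 <= K.
  by rewrite !mulr_ge0 ?expR_ge0// ?invr_ge0 ?exprn_ge0// ?mulr_ge0// ?addr_ge0//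
     ?mulr_ge0// ltW.
(* the increment of the flow differs from its linearisation by O(h^2) *)
have main h : `|h| * `|w| < r -> `|h| * (C * `|w|) < d ->
    `|time_one U F (h *: w + z) - time_one U F z - h *: y 1| <= K * `|h| ^+ 2.
  move=> hr hd.
  have zz : `|h *: w + z - z| = `|h| * `|w| by rewrite addrK normrZ.
  have [|u uz ux] := H (h *: w + z); first by rewrite zz.
  rewrite (time_oneE oU F2 uz) (time_oneE oU F2 xz).
  have [uc u0 uU ud] := uz.
  have := @gronwall R m (fun t => u t - x t - h *: y t)
    (fun t => F (u t) - F (x t) - h *: 'D_(y t) F (x t))
    (2 * d^-1) (d^-1 * (`|h| * (C * `|w|)) ^+ 2) _ _ _ _ _ 1.
  rewrite u0 x0 y0 addrK subrr normr0 add0r => G.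
  apply: (le_trans (G _ _ _ _ _ _)).
  - by rewrite mulr_ge0// ltW.
  - by rewrite mulr_ge0 ?sqr_ge0// ltW.
  - apply: continuous_subspaceT => s; apply: cvgB.
      by apply: cvgB; [exact: uc|exact: xc].
    by apply: cvgZ; [exact: cvg_cst|exact: yc].
  - move=> s s01; apply: is_deriveB; last by apply: is_deriveZ; exact: yd.
    by apply: is_deriveB; [exact: ud|exact: xd].
  - move=> s /andP[/ltW s0 /ltW s1].
    have s01 : 0 <= s <= 1 by rewrite s0.
    have ub : `|u s - x s| <= `|h| * (C * `|w|).
      by rewrite mulrCA -zz; exact: ux.
    have ubd : `|u s - x s| < d by exact: le_lt_trans hd.
    have xb : `|x s - x s| < d by rewrite subrr normr0.
    have Ts := T s s01.
    have [Ux _ Q1] := Ts _ _ xb ubd.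
    have E : 'D_(u s - x s - h *: y s) F (x s) =
        'D_(u s - x s) F (x s) - h *: 'D_(y s) F (x s).
      have := derive_linear (- h) (y s) (u s - x s) (@findim_rV R m)
        (@findim_rV R m) oU Ux F1.
      by rewrite !scaleNr addrC => ->; rewrite addrC.
    have := @taylor_ball_derive (x s) d (u s - x s - h *: y s) _ Ts.
    rewrite d0 d1 E => /(_ isT) B1.
    have Q2 : `|F (u s) - F (x s) - 'D_(u s - x s) F (x s)| <=
        d^-1 * (`|h| * (C * `|w|)) ^+ 2.
      apply: (le_trans Q1); rewrite (ler_wpM2l (ltW dV0))// !expr2.
      by apply: ler_pM.
    have -> : F (u s) - F (x s) - h *: 'D_(y s) F (x s) =
      ('D_(u s - x s) F (x s) - h *: 'D_(y s) F (x s)) +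
      (F (u s) - F (x s) - 'D_(u s - x s) F (x s)).
      by rewrite [RHS]addrC addrA subrK.
    by rewrite (le_trans (ler_normD _ _))// lerD.
  - by rewrite ler01 lexx.
  - by rewrite le_eqVlt; apply/orP; left; apply/eqP; rewrite /K; ring.
apply: is_derive_cvg; apply/cvgrPdist_le => e e0.
near=> h.
have h0 : h != 0 by near: h; exact: nbhs_dnbhs_neq.
have hn : 0 < `|h| by rewrite normr_gt0.
have small c b : 0 <= c -> 0 < b -> `|h| < b / (c + 1) -> `|h| * c < b.
  move=> c0 b0; rewrite ltr_pdivlMr ?ltr_wpDl// mulrDr mulr1 => hc.
  by apply: lt_trans hc; rewrite ltrDl.
have M1 : `|h| * `|w| < r.
  apply: small => //; near: h; apply: dnbhs0_lt.
  by rewrite divr_gt0// ltr_wpDl.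
have M2 : `|h| * (C * `|w|) < d.
  apply: small => //; first by rewrite mulr_ge0.
  near: h; apply: dnbhs0_lt.
  by rewrite divr_gt0// ltr_wpDl// mulr_ge0.
have M3 : `|h| * K < e.
  by apply: small => //; near: h; apply: dnbhs0_lt; rewrite divr_gt0// ltr_wpDl.
have -> : y 1 - h^-1 *: (time_one U F (h *: w + z) - time_one U F z) =
   - (h^-1 *: (time_one U F (h *: w + z) - time_one U F z - h *: y 1)).
  by rewrite [in RHS]scalerBr [in RHS]scalerA mulVf// scale1r opprB.
rewrite normrN normrZ normfV ler_pdivrMl//.
rewrite (le_trans (main h M1 M2))// expr2 mulrCA ler_wpM2l// mulrC.
exact: ltW.
Unshelve. all: by end_near. Qed.

End Variational.

(** A direction derivative of the time-one map is a component of the time-one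
    map of the tangent field, so that smoothness follows by induction on the
    order of differentiation, for all fields at once. *)
Theorem smooth_time_one m (U : set 'rV[R]_m) (F : 'rV[R]_m -> 'rV[R]_m) :
  open U -> smooth U F -> smooth (time_one_domain U F) (time_one U F).
Proof.
move=> oU FC k; elim: k m U F oU FC => [|k IH] m U F oU FC.
  by split=> // z zD; exact: continuous_time_one oU (FC 2%N) z zD.
have oD := open_time_one_domain oU (FC 2%N).
have oTU : open (lsubmx @^-1` U : set 'rV[R]_(m + m)).
  by apply: open_comp => // v _; exact: continuous_lsubmx.
have TC : smooth (lsubmx @^-1` U : set 'rV[R]_(m + m)) (tangent_field F).
  by move=> j; apply: (@Ck_pred _ _ _ j); apply: Ck_tangent_field.
apply: (Ck_succ (df := fun w z =>
  rsubmx (time_one (lsubmx @^-1` U) (tangent_field F) (row_mx z w)))) => //.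
- by move=> z zD; exact: continuous_time_one oU (FC 2%N) z zD.
- by move=> z w zD; have [] := is_derive_time_one oU (FC 3%N) w zD.
- move=> w.
  have oTD := open_time_one_domain oTU (TC 2%N).
  have := IH _ _ _ oTU TC.
  move=> /(Ck_affine_comp (A := fun z : 'rV[R]_m => row_mx z w)
     (DA := fun z : 'rV[R]_m => row_mx z (0 : 'rV[R]_m)) oTD) H.
  have ac : continuous (fun z : 'rV[R]_m => row_mx z w).
    move=> z; apply: (@continuous_comp _ _ _ (fun z => (z, w))
      (fun z : 'rV[R]_m * 'rV[R]_m => row_mx z.1 z.2)).
      apply: (@continuous_pair _ _ _ id (fun=> w)); first exact: cvg_id.
      exact: continuous_at_cst.
    exact: continuous_row_mx.
  have Ha (x v : 'rV[R]_m) (h : R) :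
      row_mx (h *: v + x) w = h *: row_mx v (0 : 'rV[R]_m) + row_mx x w.
    by rewrite scale_row_mx add_row_mx scaler0 add0r.
  apply: (@Ck_sub _ _ _ _ ((fun z => row_mx z w) @^-1`
    time_one_domain (lsubmx @^-1` U) (tangent_field F))).
    by move=> z zD; have [] := is_derive_time_one oU (FC 3%N) w zD.
  apply: Ck_rsubmx; first by apply: open_comp.
  exact: H ac Ha.
Qed.

End TimeOneSmooth.

(** * Local flows *)

Section Flow.
Variable R : realType.
Implicit Types s t : R.

Lemma is_derive_snd (V W : normedModType R) (f : V * R -> W) z t d :
  is_derive ((z, t) : (V * R)%type) ((0, 1) : (V * R)%type) f d ->
  is_derive t 1 (fun t => f (z, t)) d.
Proof.
apply: (@is_derive_affine_comp _ _ _ _ (fun t => (z, t) : (V * R)%type)).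
by move=> h; congr pair; rewrite /= scaler0 add0r.
Qed.

Lemma is_derive_comp_scale (V : normedModType R) (f : R -> V) (c t : R) d :
  is_derive (c * t) 1 f d -> is_derive t 1 (fun t => f (c * t)) (c *: d).
Proof.
move=> fd; apply: (@is_derive_affine_comp _ _ _ _ (fun t => c * t) _ _ _ (c *: 1)).
  by move=> h; rewrite /= /GRing.scale/= mulr1 mulrDr mulr1 mulrC.
exact: is_derive_scale.
Qed.

Section FlowOf.
Variables (m : nat) (U : set 'rV[R]_m) (F : 'rV[R]_m -> 'rV[R]_m).
Hypotheses (oU : open U) (FC : smooth U F).

(** With the travel time as an additional, constant, coordinate, the flow at
    any time is a time-one map. *)
Let V : set 'rV[R]_(1 + m) := rsubmx @^-1` U.
Let G (y : 'rV[R]_(1 + m)) : 'rV[R]_(1 + m) :=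
  row_mx 0 ((lsubmx y) 0 0 *: F (rsubmx y)).
Let start (p : 'rV[R]_m * R) : 'rV[R]_(1 + m) := row_mx (p.2)%:M p.1.

Definition flow_domain : set ('rV[R]_m * R) := start @^-1` time_one_domain V G.
Definition flow (p : 'rV[R]_m * R) : 'rV[R]_m := rsubmx (time_one V G (start p)).

Let oV : open V.
Proof. by apply: open_comp => // y _; exact: continuous_rsubmx. Qed.

Let GC : smooth V G.
Proof.
move=> k; apply: Ck_row_mx => //; first exact: Ck_cst.
apply: Ck_fscale => //.
  by have /(Ck_mx _ _ oV) := @Ck_lsubmx_id R k _ _ _ oV; exact.
apply: (Ck_affine_comp (A := @rsubmx _ 1 1 m) (DA := @rsubmx _ 1 1 m) oU)
  => //; first exact: continuous_rsubmx.
by move=> x v h; rewrite linearP.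
Qed.

Let start_continuous : continuous start.
Proof.
move=> p; apply: continuous_mx => i j.
apply: (@eq_continuous_at _ _ (fun p : 'rV[R]_m * R =>
  match fintype.split j with inl k => (p.2 *+ (i == k)) | inr k => p.1 i k end)).
  by move=> q; rewrite mxE; case: fintype.split => k //; rewrite mxE.
case: fintype.split => k.
  rewrite !ord1 eqxx.
  by apply: (@eq_continuous_at _ _ snd) => [q|]; [rewrite mulr1n|exact: cvg_snd].
apply: (@continuous_comp _ _ _ fst (fun A : 'rV[R]_m => A i k)).
  exact: cvg_fst.
exact: coord_continuous.
Qed.

Let start_affine (x v : 'rV[R]_m * R) (h : R) :
  start (h *: v + x) = h *: start v + start x.
Proof.
rewrite /start scale_row_mx add_row_mx; congr row_mx.
by rewrite scale_scalar_mx -raddfD.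
Qed.

Lemma open_flow_domain : open flow_domain.
Proof.
apply: open_comp => [p _|]; first exact: start_continuous.
exact: open_time_one_domain oV (GC 2%N).
Qed.

Lemma smooth_flow : smooth flow_domain flow.
Proof.
move=> k; apply: Ck_rsubmx; first exact: open_flow_domain.
apply: (Ck_affine_comp (A := start) (DA := start)) => //.
  exact: open_time_one_domain oV (GC 2%N).
exact: (smooth_time_one oV GC).
Qed.

Lemma curve_flow z tau (x : R -> 'rV[R]_m) : continuous x -> x 0 = z ->
  (forall t, 0 <= t <= 1 -> U (x t)) ->
  (forall t, 0 < t < 1 -> is_derive t 1 x (tau *: F (x t))) ->
  flow_domain (z, tau) /\ flow (z, tau) = x 1.
Proof.
move=> xc x0 xU xd.
have X : integral_curve V G (start (z, tau)) (fun t => row_mx tau%:M (x t)).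
  split.
  - move=> t; apply: (@continuous_comp _ _ _ (fun t => (tau%:M : 'rV[R]_1, x t))
      (fun z : 'rV[R]_1 * 'rV[R]_m => row_mx z.1 z.2)).
      by apply: continuous_pair; [exact: continuous_at_cst|exact: xc].
    exact: continuous_row_mx.
  - by rewrite x0.
  - by move=> t t01; rewrite /V /= row_mxKr; exact: xU.
  - move=> t t01; rewrite /G row_mxKl row_mxKr mxE mulr1n.
    have xdt := xd t t01.
    apply/is_derive_mx => i j; rewrite mxE.
    have E t' : row_mx tau%:M (x t') i j = match fintype.split j with
      | inl k => (tau%:M : 'rV[R]_1) i k | inr k => x t' i k end by rewrite mxE.
    rewrite (funext E); case: fintype.split => k.
      by apply: (is_derive_eq (is_derive_cst _ _ _)); rewrite mxE.
    by have /is_derive_mx := xdt; exact.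
split; first by eexists; exact: X.
by rewrite /flow (time_oneE oV (GC 2%N) X) row_mxKr.
Qed.

Lemma flow_curve z tau : flow_domain (z, tau) -> exists x : R -> 'rV[R]_m,
  [/\ continuous x, x 0 = z, forall t, 0 <= t <= 1 -> U (x t) &
  forall t, 0 < t < 1 -> is_derive t 1 x (tau *: F (x t))].
Proof.
move=> [X [Xc X0 XU Xd]]; exists (fun t => rsubmx (X t)); split.
- move=> t; apply: (@continuous_comp _ _ _ X rsubmx); first exact: Xc.
  exact: continuous_rsubmx.
- by rewrite X0 row_mxKr.
- by move=> t /XU.
- have Xl t : 0 <= t <= 1 -> lsubmx (X t) = tau%:M.
    move=> /andP[t0 t1].
    have lXc : continuous (fun t => lsubmx (X t)).
      move=> s; apply: (@continuous_comp _ _ _ X lsubmx); first exact: Xc.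
      exact: continuous_lsubmx.
    have H := @mean_value_inequality R 1 (fun t => lsubmx (X t)) (fun=> 0)
      (fun=> 0) (fun=> 0) 0 t t0 (continuous_subspaceT lXc)
      (continuous_subspaceT (@cst_continuous _ _ 0)).
    have : `|lsubmx (X t) - lsubmx (X 0)| <= 0.
      apply: le_trans (H _ _ _) _; last by rewrite subrr.
      - move=> s /andP[s0 st].
        apply/is_derive_mx => i j.
        have s01 : 0 < s < 1 by rewrite s0 (lt_le_trans st).
        have /is_derive_mx/(_ i (lshift _ j)) := Xd s s01.
        rewrite /G row_mxEl => H'; rewrite (_ : (fun y => _) =
          fun y => X y i (lshift m j)) //.
        by apply/funext => y; rewrite mxE.
      - by move=> s _; rewrite normr0.
    by rewrite normr_le0 subr_eq0 X0 row_mxKl => /eqP.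
  move=> t t01; have Xdt := Xd t t01.
  have lX : (lsubmx (X t)) 0 0 = tau.
    rewrite Xl ?mxE ?mulr1n//.
    by case/andP: t01 => /ltW -> /ltW ->.
  apply/is_derive_mx => i j.
  have /is_derive_mx/(_ i (rshift _ j)) := Xdt.
  rewrite /G row_mxEr lX => H'; rewrite (_ : (fun y => _) =
    fun y => X y i (rshift 1 j)) //.
  by apply/funext => y; rewrite mxE.
Qed.

Lemma flow_segment z tau (x : R -> 'rV[R]_m) c : 0 <= c <= 1 ->
  continuous x -> x 0 = z -> (forall t, 0 <= t <= 1 -> U (x t)) ->
  (forall t, 0 < t < 1 -> is_derive t 1 x (tau *: F (x t))) ->
  flow_domain (z, c * tau) /\ flow (z, c * tau) = x c.
Proof.
move=> /andP[c0 c1] xc x0 xU xd.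
have := @curve_flow z (c * tau) (fun t => x (c * t)).
rewrite mulr1; apply.
- move=> t; apply: continuous_comp; last exact: xc.
  by apply: cvgM; [exact: cvg_cst|exact: cvg_id].
- by rewrite mulr0.
- move=> t /andP[t0 t1]; apply: xU.
  by rewrite mulr_ge0//= mulr_ile1.
- move=> t /andP[t0 t1].
  have [c00|c00] := eqVneq c 0.
    rewrite c00 mul0r scale0r (_ : (fun _ => _) = cst (x 0)).
      exact: is_derive_cst.
    by apply/funext => s; rewrite mul0r.
  have cgt0 : 0 < c by rewrite lt_neqAle eq_sym c00.
  rewrite -scalerA; apply: is_derive_comp_scale; apply: xd.
  by rewrite mulr_gt0//= (le_lt_trans _ t1)// ler_piMl// ltW.
Qed.

Lemma flow_in z tau : flow_domain (z, tau) -> U (flow (z, tau)).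
Proof.
move=> /flow_curve[x [xc x0 xU xd]].
have [_ ->] := curve_flow xc x0 xU xd.
by apply: xU; rewrite ler01 lexx.
Qed.

Lemma flow0 z tau : flow_domain (z, tau) ->
  flow_domain (z, 0) /\ flow (z, 0) = z.
Proof.
move=> /flow_curve[x [xc x0 xU xd]].
have := @flow_segment z tau x 0; rewrite mul0r lexx ler01 x0.
by apply.
Qed.

Let flow_derive_nonzero z tau : flow_domain (z, tau) -> tau != 0 ->
  'D_((0, 1) : 'rV[R]_m * R) flow (z, tau) = F (flow (z, tau)).
Proof.
move=> Dz tau0.
have FD := is_derive_snd (Ck_is_derive ((0, 1) : 'rV[R]_m * R) (smooth_flow 1%N) Dz).
apply: (is_derive_unique FD).
have : \forall c \near (1 : R), flow_domain (z, c * tau).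
  have : {for 1, continuous (fun c : R => (z, c * tau))}.
    apply: continuous_pair; first exact: continuous_at_cst.
    by apply: cvgM; [exact: cvg_id|exact: cvg_cst].
  apply; rewrite mul1r; apply: open_nbhs_nbhs; split=> //.
  exact: open_flow_domain.
move=> /(@nbhs_ballP R R^o)[e /= e0 eD].
pose c := 1 + e / 2.
have c1 : 1 < c by rewrite /c ltrDl divr_gt0.
have cD : flow_domain (z, c * tau).
  apply: eD; rewrite -ball_normE /ball_/= /c opprD addrA subrr sub0r normrN.
  by rewrite ger0_norm; lra.
have [x [xc x0 xU xd]] := flow_curve cD.
have ct0 : c * tau != 0 by rewrite mulf_neq0// gt_eqF// (lt_trans _ c1).
pose k := (c * tau)^-1.
have ktau : k * tau = c^-1 by rewrite /k invfM mulfVK.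
have kt01 : 0 < k * tau < 1.
  by rewrite ktau invr_gt0 (lt_trans _ c1)//= invf_lt1// (lt_trans _ c1).
have nE : \forall t \near tau, x (k * t) = flow (z, t).
  have kc : {for tau, continuous (fun t => k * t)}.
    by apply: cvgM; [exact: cvg_cst|exact: cvg_id].
  have ki : k * tau \in `]0, 1[ by rewrite in_itv.
  have kn : \forall t \near tau, k * t \in `]0, 1[ := kc _ (near_in_itvoo ki).
  apply: filterS kn => t.
  rewrite in_itv/= => /andP[/ltW kt0 /ltW kt1].
  have [] := @flow_segment z (c * tau) x (k * t) _ xc x0 xU xd.
    by rewrite kt0.
  by rewrite mulrAC mulVf// mul1r.
apply: (near_eq_is_derive nE).
have kt01' : 0 <= k * tau <= 1 by case/andP: kt01 => /ltW -> /ltW ->.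
have [_ fE] := @flow_segment z (c * tau) x (k * tau) kt01' xc x0 xU xd.
have := is_derive_comp_scale (xd _ kt01).
by rewrite scalerA mulVf// scale1r -fE mulrAC mulVf// mul1r.
Qed.

Lemma flow_derive z tau : flow_domain (z, tau) ->
  'D_((0, 1) : 'rV[R]_m * R) flow (z, tau) = F (flow (z, tau)).
Proof.
move=> Dz; have [tau0|] := eqVneq tau 0; last exact: flow_derive_nonzero.
rewrite tau0 in Dz *.
have nD : \forall t \near (0 : R), flow_domain (z, t).
  have : {for 0, continuous (fun t : R => (z, t))}.
    by apply: continuous_pair; [exact: continuous_at_cst|exact: cvg_id].
  by apply; apply: open_nbhs_nbhs; split=> //; exact: open_flow_domain.
have linec : {for 0, continuous (fun t : R => (z, t))}.
  by apply: continuous_pair; [exact: continuous_at_cst|exact: cvg_id].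
have c1 : {for 0, continuous (fun t : R => 'D_((0, 1) : 'rV[R]_m * R) flow (z, t))}.
  apply: (@continuous_comp _ _ _ (fun t => (z, t)) ('D_((0, 1) : 'rV[R]_m * R) flow)).
    exact: linec.
  exact: Ck_continuous (Ck_derive _ (smooth_flow 1%N)) Dz.
have c2 : {for 0, continuous (fun t : R => F (flow (z, t)))}.
  apply: (@continuous_comp _ _ _ (fun t => flow (z, t)) F).
    apply: (@continuous_comp _ _ _ (fun t => (z, t)) flow).
      exact: linec.
    exact: Ck_continuous (smooth_flow 0%N) Dz.
  exact: Ck_continuous (FC 0%N) (flow_in Dz).
have d1 : 'D_((0, 1) : 'rV[R]_m * R) flow (z, t) @[t --> (0 : R)^'] -->
    'D_((0, 1) : 'rV[R]_m * R) flow (z, 0).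
  by move/continuous_withinNx : c1.
have d2 : F (flow (z, t)) @[t --> (0 : R)^'] --> F (flow (z, 0)).
  by move/continuous_withinNx : c2.
apply: (cvg_unique _ d1) => //.
apply: cvg_trans d2; apply: near_eq_cvg; near=> t.
have t0 : t != 0 by near: t; exact: nbhs_dnbhs_neq.
rewrite flow_derive_nonzero//; near: t; exact: cvg_within.
Unshelve. all: by end_near. Qed.

(** The flow domain is open, so by compactness of [[0, T]] it contains a box
    of uniform size around the trajectory. *)
Theorem local_flow z0 T (x : R -> 'rV[R]_m) : 0 <= T ->
  continuous x -> x 0 = z0 -> (forall t, 0 <= t <= T -> U (x t)) ->
  (forall t, 0 < t < T -> is_derive t 1 x (F (x t))) ->
  exists2 e : R, 0 < e &
    (forall z t, `|z - z0| < e -> - e < t < T + e -> flow_domain (z, t)) /\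
    (forall t, 0 <= t <= T -> flow (z0, t) = x t).
Proof.
move=> T0 xc x0 xU xd.
have xflow t : 0 <= t <= T -> flow_domain (z0, t) /\ flow (z0, t) = x t.
  move=> /andP[t0 tT].
  have := @curve_flow z0 t (fun s => x (t * s)); rewrite mulr1; apply.
  - move=> s; apply: continuous_comp; last exact: xc.
    by apply: cvgM; [exact: cvg_cst|exact: cvg_id].
  - by rewrite mulr0.
  - move=> s /andP[s0 s1]; apply: xU.
    by rewrite mulr_ge0//= (le_trans _ tT)// ler_piMr.
  - move=> s /andP[s0 s1].
    have [->|t00] := eqVneq t 0.
      rewrite scale0r (_ : (fun _ => _) = cst (x 0)).
        exact: is_derive_cst.
      by apply/funext => r; rewrite mul0r.
    have tgt0 : 0 < t by rewrite lt_neqAle eq_sym t00.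
    apply: is_derive_comp_scale; apply: xd.
    by rewrite mulr_gt0//= (lt_le_trans _ tT)// gtr_pMr.
have tube : \forall d \near (0 : R)^'+, forall t, 0 <= t <= T -> forall z s,
    `|z - z0| < d -> `|s - t| < d -> flow_domain (z, s).
  apply: near_segment => t /xflow[Dt _].
  have [r /= r0 rD] := (nbhs_ballP _ _).1
    (open_nbhs_nbhs (conj open_flow_domain Dt)).
  have r2 : 0 < r / 2 by rewrite divr_gt0.
  exists (r / 2) => //.
  near=> t' => d /andP[d0 dr] z s zd sd; apply: rD; split => /=.
    by rewrite -ball_normE /ball_/= distrC (lt_trans zd)//; move: dr r0; lra.
  have tt' : `|t' - t| < r / 2.
    near: t'; apply/(@nbhs_ballP R R^o); exists (r / 2) => //=.
    by move=> t'; rewrite -ball_normE /ball_/= distrC.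
  rewrite -ball_normE /ball_/= distrC -(subrKA t') (le_lt_trans (ler_normD _ _))//.
  by move: sd dr tt'; lra.
near (0 : R)^'+ => e.
exists e; first by near: e; exact: nbhs_right_gt.
split=> [z t ze /andP[te tT]|t /xflow[]//].
have e0 : 0 < e by near: e; exact: nbhs_right_gt.
have H : forall t, 0 <= t <= T -> forall z s, `|z - z0| < e -> `|s - t| < e ->
    flow_domain (z, s) by near: e; exact: tube.
apply: (H (clamp 0 T t)) => //; first exact: clamp_itv.
rewrite /clamp; have [Tt|tT'] := leP T t.
  by rewrite max_r// ger0_norm; lra.
by have [?|?] := leP 0 t; [rewrite subrr normr0|rewrite subr0 ltr0_norm; lra].
Unshelve. all: by end_near. Qed.

End FlowOf.

(** Rescaling time by [b], which may be negative, turns both curves into integral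
    curves of [b *: F] on [[0, 1]], where uniqueness is known. *)
Lemma ode_unique_segment m (U : set 'rV[R]_m) (F : 'rV[R]_m -> 'rV[R]_m)
    (a b : R) (x y : R -> 'rV[R]_m) : open U -> Ck 2 U F ->
  (forall t, 0 <= t <= 1 -> U (x (a + t * b))) ->
  (forall t, 0 <= t <= 1 -> U (y (a + t * b))) ->
  (forall t, 0 <= t <= 1 -> is_derive (a + t * b) 1 x (F (x (a + t * b)))) ->
  (forall t, 0 <= t <= 1 -> is_derive (a + t * b) 1 y (F (y (a + t * b)))) ->
  x a = y a -> x (a + b) = y (a + b).
Proof.
move=> oU FC xU yU xd yd xy.
have FbC : Ck 2 U (fun z => b *: F z) by exact: Ck_scale.
have curve (u : R -> 'rV[R]_m) : (forall t, 0 <= t <= 1 -> U (u (a + t * b))) ->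
  (forall t, 0 <= t <= 1 -> is_derive (a + t * b) 1 u (F (u (a + t * b)))) ->
  integral_curve U (fun z => b *: F z) (u a)
    ((fun t => u (a + t * b)) \o clamp 0 1).
  move=> uU ud.
  have ud' t : 0 <= t <= 1 ->
      is_derive t 1 (fun t => u (a + t * b)) (b *: F (u (a + t * b))).
    move=> t01; apply: (@is_derive_affine_comp _ _ _ _ (fun t => a + t * b)
      _ _ _ (b *: 1)).
      by move=> h; rewrite /= /GRing.scale/= !mulr1 mulrDl addrCA.
    by apply: is_derive_scale; exact: ud.
  split.
  - apply: (@continuous_clamp_comp _ _ 0 1 (fun t => u (a + t * b))) => // t t01.
    by have [ud't _] := ud' t t01; exact/differentiable_continuous/derivable1_diffP.
  - by rewrite /= clamp_id ?mul0r ?addr0// lexx ler01.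
  - by move=> t t01; apply: uU; exact: clamp_itv.
  - move=> t t01; have t01' : 0 <= t <= 1 by case/andP: t01 => /ltW -> /ltW ->.
    apply: (@is_derive_clamp_comp _ _ 0 1 (fun t => u (a + t * b))) => //=.
    by rewrite clamp_id//; exact: ud'.
have i1 : 0 <= (1 : R) <= 1 by rewrite ler01 lexx.
have cx := curve x xU xd; have cy := curve y yU yd; rewrite xy in cx.
have := integral_curve_unique oU FbC cx cy i1.
by rewrite /= clamp_id// mul1r.
Qed.

End Flow.

(** * Charts and tangent vectors *)

Section MatrixCalculus.
Variables (R : realType) (V : normedModType R).

Lemma is_derive_mulmx p q r (A : V -> 'M[R]_(p, q)) (B : V -> 'M[R]_(q, r))
    x v dA dB : is_derive x v A dA -> is_derive x v B dB ->
  is_derive x v (fun y => A y *m B y) (A x *m dB + dA *m B x).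
Proof.
move=> /is_derive_mx Ad /is_derive_mx Bd; apply/is_derive_mx => i j.
rewrite !mxE -big_split/= (_ : (fun y => _) =
  \sum_(k < q) (fun y => A y i k * B y k j)); last first.
  by apply/funext => y; rewrite mxE fct_sumE.
apply: is_derive_sum => k.
apply: (is_derive_eq (is_deriveM (Ad i k) (Bd k j))).
by rewrite /GRing.scale/= [B _ _ _ * _]mulrC.
Qed.

Lemma is_derive_trmx p q (A : V -> 'M[R]_(p, q)) x v dA :
  is_derive x v A dA -> is_derive x v (fun y => (A y)^T) dA^T.
Proof.
move=> /is_derive_mx Ad; apply/is_derive_mx => i j; rewrite mxE.
rewrite (_ : (fun y => _) = fun y => A y j i) //.
by apply/funext => y; rewrite mxE.
Qed.

Definition bil n (A : 'M[R]_n) (u v : 'rV[R]_n) : R := (u *m A *m v^T) 0 0.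

Lemma bilE n (A : 'M[R]_n) u v :
  bil A u v = \sum_i \sum_j u 0 i * A i j * v 0 j.
Proof.
rewrite /bil mxE exchange_big/=; apply: eq_bigr => j _.
by rewrite !mxE mulr_suml.
Qed.

Lemma bilDl n (A : 'M[R]_n) u v w : bil A (u + v) w = bil A u w + bil A v w.
Proof. by rewrite /bil !mulmxDl mxE. Qed.

Lemma bilDr n (A : 'M[R]_n) u v w : bil A u (v + w) = bil A u v + bil A u w.
Proof. by rewrite /bil linearD/= mulmxDr mxE. Qed.

Lemma bilZl n (A : 'M[R]_n) c u v : bil A (c *: u) v = c * bil A u v.
Proof. by rewrite /bil -!scalemxAl mxE. Qed.

Lemma bilZr n (A : 'M[R]_n) c u v : bil A u (c *: v) = c * bil A u v.
Proof. by rewrite /bil linearZ/= -scalemxAr mxE. Qed.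

Lemma bilNl n (A : 'M[R]_n) u v : bil A (- u) v = - bil A u v.
Proof. by rewrite -scaleN1r bilZl mulN1r. Qed.

Lemma bilNr n (A : 'M[R]_n) u v : bil A u (- v) = - bil A u v.
Proof. by rewrite -scaleN1r bilZr mulN1r. Qed.

Lemma bilC n (A : 'M[R]_n) u v : A^T = A -> bil A u v = bil A v u.
Proof.
move=> As; rewrite /bil -{2}As -[u in RHS]trmxK.
have -> : v *m A^T *m u^T^T^T = (u *m A *m v^T)^T.
  by rewrite trmxK !trmx_mul trmxK mulmxA.
by rewrite [RHS]mxE.
Qed.

Lemma bil_sums n (A : 'M[R]_n) (c d : 'I_n -> R) (e f : 'I_n -> 'rV[R]_n) :
  bil A (\sum_a c a *: e a) (\sum_b d b *: f b) =
  \sum_a \sum_b c a * d b * bil A (e a) (f b).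
Proof.
rewrite /bil !mulmx_suml summxE; apply: eq_bigr => a _.
rewrite linear_sum mulmx_sumr summxE; apply: eq_bigr => b _.
by rewrite linearZ/= -!scalemxAl -scalemxAr !mxE mulrA.
Qed.

Lemma bil_nondegenerate n (A : 'M[R]_n) : A \in unitmx ->
  forall u, (forall v, bil A u v = 0) -> u = 0.
Proof.
move=> Au u uv; have : u *m A = 0.
  apply/rowP => j; rewrite [RHS]mxE -(uv (delta_mx 0 j)) /bil.
  rewrite trmx_delta [RHS]mxE (bigD1 j)//= [delta_mx _ _ _ _]mxE !eqxx mulr1 big1 ?addr0//.
  by move=> k kj; rewrite [delta_mx _ _ _ _]mxE (negbTE kj) mulr0.
by move=> uA; rewrite -[u](mulmxK Au) uA mul0mx.
Qed.

Lemma unitmx_kernel n (A : 'M[R]_n) :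
  (forall u : 'rV[R]_n, u *m A = 0 -> u = 0) -> A \in unitmx.
Proof.
move=> Ainj; rewrite -row_free_unit -kermx_eq0; apply/eqP/row_matrixP => i.
by rewrite row0; apply: Ainj; rewrite -row_mul mulmx_ker row0.
Qed.

Lemma unitmx_nondegenerate n (A : 'M[R]_n) :
  (forall u, (forall v, bil A u v = 0) -> u = 0) -> A \in unitmx.
Proof.
move=> And; apply: unitmx_kernel => u uA; apply: And => v.
by rewrite /bil uA mul0mx mxE.
Qed.

Lemma is_derive_bil n (A : V -> 'M[R]_n) (a b : V -> 'rV[R]_n) x v dA da db :
  is_derive x v A dA -> is_derive x v a da -> is_derive x v b db ->
  is_derive x v (fun y => bil (A y) (a y) (b y))
    (bil dA (a x) (b x) + bil (A x) da (b x) + bil (A x) (a x) db).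
Proof.
move=> Ad ad bd.
have := is_derive_mulmx (is_derive_mulmx ad Ad) (is_derive_trmx bd).
move=> /is_derive_mx/(_ 0 0) H; apply: (is_derive_eq H).
by rewrite /bil mulmxDl !mxE addrC.
Qed.

Lemma Ck_bil k U n (A : V -> 'M[R]_n) (a b : V -> 'rV[R]_n) : open U ->
  Ck k U A -> Ck k U a -> Ck k U b -> Ck k U (fun y => bil (A y) (a y) (b y)).
Proof.
move=> oU AC aC bC.
have := Ck_mulmx oU (Ck_mulmx oU aC AC) (Ck_trmx oU bC).
by move=> /(Ck_mx _ _ oU)/(_ 0 0).
Qed.

End MatrixCalculus.

Section DirectionalField.
Variables (R : realType) (V : normedModType R) (m n : nat).

(** The direction enters linearly, so it contributes a first derivative of [f]
    and the base point a second one. *)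
Lemma is_derive_directional (U : set 'rV[R]_m) (f : 'rV[R]_m -> 'rV[R]_n)
    (a b : V -> 'rV[R]_m) x v da db : open U -> U (b x) -> Ck 2 U f ->
  is_derive x v a da -> is_derive x v b db -> {for x, continuous b} ->
  is_derive x v (fun y => 'D_(a y) f (b y))
    ('D_da f (b x) + 'D_db ('D_(a x) f) (b x)).
Proof.
move=> oU Ux fC ad bd bc.
have f1 : Ck 1 U f := Ck_pred fC.
have DE w y : U y -> 'D_w f y = \sum_k w 0 k *: 'D_(delta_mx 0 k) f y.
  by move=> Uy; exact: derive_partials (findim_rV R n) oU Uy f1.
have E2 : 'D_db ('D_(a x) f) (b x) =
    \sum_k a x 0 k *: 'D_db ('D_(delta_mx 0 k) f) (b x).
  rewrite (near_eq_derive (g := \sum_k (fun y => a x 0 k *: 'D_(delta_mx 0 k) f y))).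
    rewrite derive_sum => [|k].
      apply: eq_bigr => k _; rewrite deriveZ//.
      by have [] := Ck_is_derive db (Ck_derive (delta_mx 0 k) fC) Ux.
    apply: derivableZ.
    by have [] := Ck_is_derive db (Ck_derive (delta_mx 0 k) fC) Ux.
  apply: filterS (open_nbhs_nbhs (conj oU Ux)) => y Uy.
  by rewrite DE// fct_sumE.
rewrite E2 (DE da)// -big_split/=.
have nE : \forall y \near x,
    (\sum_k (fun y => a y 0 k *: 'D_(delta_mx 0 k) f (b y))) y = 'D_(a y) f (b y).
  have : \forall y \near x, U (b y).
    by apply: bc; exact: open_nbhs_nbhs.
  by apply: filterS => y Uy; rewrite DE// fct_sumE.
apply: (near_eq_is_derive nE); apply: is_derive_sum => k.
have := is_derive_fscale ((is_derive_mx _ _ _ _).1 ad 0 k)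
  (chain_rule (findim_rV R m) (findim_rV R n) oU Ux (Ck_derive (delta_mx 0 k) fC) bd).
by rewrite addrC.
Qed.

End DirectionalField.

Section Charts.
Variables (R : realType) (n : nat) (M : topologicalType) (X : manifold R n M).
Implicit Types (i j k : chart_idx X) (p : M) (u v w : 'rV[R]_n).

Lemma chart_img_map i p : chart_dom i p -> chart_img i (chart_map i p).
Proof. by move=> ip; exists p. Qed.

Lemma chart_inv_dom i x : chart_img i x -> chart_dom i (chart_inv i x).
Proof. by move=> [p ip <-]; rewrite chart_mapK. Qed.

Lemma chart_invK i x : chart_img i x -> chart_map i (chart_inv i x) = x.
Proof. by move=> [p ip <-]; rewrite chart_mapK. Qed.

Definition overlap i j : set 'rV[R]_n :=
  chart_map i @` (chart_dom i `&` chart_dom j).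

Definition transition i j : 'rV[R]_n -> 'rV[R]_n := chart_map j \o chart_inv i.

Lemma overlap_map i j p : chart_dom i p -> chart_dom j p ->
  overlap i j (chart_map i p).
Proof. by move=> ip jp; exists p. Qed.

Lemma overlapE i j x :
  overlap i j x <-> chart_img i x /\ chart_dom j (chart_inv i x).
Proof.
split=> [[p [ip jp] <-]|[[p ip <-]]]; last by rewrite chart_mapK//; exists p.
by rewrite chart_mapK//; split=> //; exists p.
Qed.

Lemma open_overlap i j : open (overlap i j).
Proof.
rewrite openE => x /overlapE[ix jx].
have n1 : \forall y \near x, chart_img i y.
  by apply: open_nbhs_nbhs; split=> //; exact: chart_img_open.
have n2 : \forall y \near x, chart_dom j (chart_inv i y).
  apply: (chart_inv_continuous ix); apply: open_nbhs_nbhs; split=> //.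
  exact: chart_dom_open.
by apply: filterS2 n1 n2 => y iy jy; apply/overlapE.
Qed.

Lemma smooth_transition i j : smooth (overlap i j) (transition i j).
Proof. exact: chart_transition_smooth. Qed.

Lemma transition_map i j p : chart_dom i p ->
  transition i j (chart_map i p) = chart_map j p.
Proof. by move=> ip; rewrite /transition /= chart_mapK. Qed.

Lemma tangent_change_linear i j p (c : R) u v : chart_dom i p -> chart_dom j p ->
  tangent_change i j p (c *: u + v) =
  c *: tangent_change i j p u + tangent_change i j p v.
Proof.
move=> ip jp; exact: derive_linear (findim_rV R n) (findim_rV R n)
  (@open_overlap i j) (overlap_map ip jp) (@smooth_transition i j 1%N).
Qed.

Lemma tangent_changeD i j p u v : chart_dom i p -> chart_dom j p ->
  tangent_change i j p (u + v) = tangent_change i j p u + tangent_change i j p v.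
Proof.
by move=> ip jp; have := tangent_change_linear 1 u v ip jp; rewrite !scale1r.
Qed.

Lemma tangent_change0 i j p : tangent_change i j p 0 = 0.
Proof. by rewrite /tangent_change derive0. Qed.

Lemma tangent_changeZ i j p (c : R) u : chart_dom i p -> chart_dom j p ->
  tangent_change i j p (c *: u) = c *: tangent_change i j p u.
Proof.
move=> ip jp; have := tangent_change_linear c u 0 ip jp.
by rewrite addr0 tangent_change0 addr0.
Qed.

Lemma tangent_change_sum i j p (I : Type) (r : seq I) (f : I -> 'rV[R]_n) :
  chart_dom i p -> chart_dom j p ->
  tangent_change i j p (\sum_(a <- r) f a) =
  \sum_(a <- r) tangent_change i j p (f a).
Proof.
move=> ip jp; elim: r => [|a r IH]; first by rewrite !big_nil tangent_change0.
by rewrite !big_cons tangent_changeD// IH.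
Qed.

Lemma tangent_change_id i p v : chart_dom i p -> tangent_change i i p v = v.
Proof.
move=> ip; rewrite /tangent_change (near_eq_derive (g := id)) ?derive_id//.
have : \forall y \near chart_map i p, chart_img i y.
  apply: open_nbhs_nbhs; split; last exact: chart_img_map.
  exact: chart_img_open.
by apply: filterS => y iy; exact: chart_invK.
Qed.

Lemma tangent_change_comp i j k p v :
  chart_dom i p -> chart_dom j p -> chart_dom k p ->
  tangent_change j k p (tangent_change i j p v) = tangent_change i k p v.
Proof.
move=> ip jp kp.
have ij := overlap_map ip jp; have jk := overlap_map jp kp.
have dij := Ck_is_derive v (@smooth_transition i j 1%N) ij.
have jk' : overlap j k (transition i j (chart_map i p)).
  by rewrite transition_map.
have [_] := chain_rule (findim_rV R n) (findim_rV R n) (@open_overlap j k)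
  jk' (@smooth_transition j k 1%N) dij.
rewrite transition_map// /tangent_change -/(transition i k) -/(transition i j).
rewrite -/(transition j k) => <-; apply: near_eq_derive.
apply: filterS (open_nbhs_nbhs (conj (@open_overlap i j) ij)) => y.
by move=> /overlapE[_ jy]; rewrite /transition/= chart_mapK.
Qed.

Lemma tangent_changeK i j p v : chart_dom i p -> chart_dom j p ->
  tangent_change j i p (tangent_change i j p v) = v.
Proof. by move=> ip jp; rewrite tangent_change_comp// tangent_change_id. Qed.

End Charts.

(** * Metric coefficients and the Christoffel symbols *)

Section Metric.
Variables (R : realType) (n : nat) (M : topologicalType).
Variables (X : manifold R n M) (g : lorentz_metric X).
Implicit Types (i j k : chart_idx X) (p : M) (u v w : 'rV[R]_n).

Definition gmx i (x : 'rV[R]_n) : 'M[R]_n := tensor_coef (gram g) i x.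

Lemma smooth_gmx i : smooth (chart_img i) (gmx i).
Proof. exact: gram_smooth. Qed.

Lemma bil_gmx i p u v : chart_dom i p ->
  bil (gmx i (chart_map i p)) u v =
  inner g p (tangent_change i (chart_at X p) p u)
            (tangent_change i (chart_at X p) p v).
Proof.
move=> ip; have cp := chart_at_dom X p.
rewrite bilE /inner /tensor_form -/(bil (gram g p) _ _).
have tcE w : tangent_change i (chart_at X p) p w =
    \sum_a w 0 a *: tangent_change i (chart_at X p) p (delta_mx 0 a).
  rewrite {1}(row_sum_delta w) tangent_change_sum//.
  by apply: eq_bigr => a _; rewrite tangent_changeZ.
rewrite (tcE u) (tcE v) bil_sums.
apply: eq_bigr => a _; apply: eq_bigr => b _.
rewrite /gmx /tensor_coef mxE chart_mapK// /tensor_form /basis_vec.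
by rewrite mulrAC.
Qed.

Lemma bil_gmx_change i j p u v : chart_dom i p -> chart_dom j p ->
  bil (gmx i (chart_map i p)) u v =
  bil (gmx j (chart_map j p)) (tangent_change i j p u) (tangent_change i j p v).
Proof.
move=> ip jp; have cp := chart_at_dom X p.
rewrite (bil_gmx u v ip) (bil_gmx _ _ jp).
by rewrite (tangent_change_comp u ip jp cp) (tangent_change_comp v ip jp cp).
Qed.

Lemma gram_unit p : gram g p \in unitmx.
Proof.
have [P Pu PG] := gram_lorentzian g p.
have mu : minkowski_mx R n \in unitmx.
  rewrite unitmxE /minkowski_mx det_diag unitfE.
  apply/prodf_neq0 => a _; rewrite mxE; case: ifP => _; last exact: oner_neq0.
  by rewrite oppr_eq0 oner_neq0.
by move: mu; rewrite -PG !unitmx_mul => /andP[/andP[]].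
Qed.

Lemma gmx_unit i x : chart_img i x -> gmx i x \in unitmx.
Proof.
move=> [p ip <-]; apply: unitmx_nondegenerate => u uv.
have cp := chart_at_dom X p.
have : tangent_change i (chart_at X p) p u = 0.
  apply: (bil_nondegenerate (gram_unit p)) => v.
  have := uv (tangent_change (chart_at X p) i p v).
  by rewrite bil_gmx// tangent_changeK.
by move=> u0; rewrite -[u](tangent_changeK _ ip cp) u0 tangent_change0.
Qed.

Lemma gmx_sym i x : chart_img i x -> (gmx i x)^T = gmx i x.
Proof.
move=> _; apply/matrixP => a b; rewrite [LHS]mxE.
have E c d : gmx i x c d = bil (gram g (chart_inv i x))
  (tangent_change i (chart_at X (chart_inv i x)) (chart_inv i x) (basis_vec R c))
  (tangent_change i (chart_at X (chart_inv i x)) (chart_inv i x) (basis_vec R d)).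
  by rewrite /gmx /tensor_coef mxE.
by rewrite !E; apply/bilC/gram_sym.
Qed.

(** The bilinear map given by the Christoffel symbols.  It is locked so that
    unification never unfolds it down to the limits defining derivatives. *)
Definition chr :=
  locked (fun i (x : 'rV[R]_n) (u v : 'rV[R]_n) => \row_k
    \sum_(c < n) \sum_(d < n) christoffel g i k c d x * u 0 c * v 0 d).

Lemma chr_entry i x u v (k : 'I_n) : chr i x u v 0 k =
  \sum_c \sum_d christoffel g i k c d x * u 0 c * v 0 d.
Proof. by rewrite /chr -lock mxE. Qed.

Definition dg i (x : 'rV[R]_n) u v w : R := 'D_u (fun y => bil (gmx i y) v w) x.

Lemma dgE i x u v w : chart_img i x ->
  dg i x u v w = \sum_a \sum_b \sum_c
    u 0 a * v 0 b * w 0 c * partial a (metric_coef g i b c) x.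
Proof.
move=> ix; have oi := @chart_img_open _ _ _ X i.
have gbc b c : Ck 1 (chart_img i) (fun y => gmx i y b c).
  by have /(Ck_mx _ _ oi) := @smooth_gmx i 1%N; exact.
have Dbc b c : is_derive x u (fun y => v 0 b * gmx i y b c * w 0 c)
    (v 0 b * w 0 c * 'D_u (fun y => gmx i y b c) x).
  have H := is_deriveZ (v 0 b * w 0 c) (Ck_is_derive u (gbc b c) ix).
  rewrite (_ : (fun y => _) = (v 0 b * w 0 c) *: (fun y => gmx i y b c)) //.
  by apply/funext => y; rewrite mulrAC.
have := is_derive_sum (fun b => is_derive_sum (Dbc b)).
rewrite (_ : (\sum_b _) = fun y => bil (gmx i y) v w); last first.
  apply/funext => y; rewrite bilE fct_sumE.
  by apply: eq_bigr => b _; rewrite fct_sumE.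
rewrite /dg => -[_ ->].
have DE b c : 'D_u (fun y => gmx i y b c) x =
    \sum_a u 0 a *: 'D_(delta_mx 0 a) (fun y => gmx i y b c) x.
  exact: derive_partials (@findim_R R) oi ix (gbc b c).
rewrite [RHS]exchange_big/=; apply: eq_bigr => b _.
rewrite [RHS]exchange_big/=; apply: eq_bigr => c _.
rewrite DE mulr_sumr; apply: eq_bigr => a _.
rewrite /partial /metric_coef /gmx /basis_vec /GRing.scale/=.
by set D := 'D_ _ _ _; ring.
Qed.

(** Pairing with the metric cancels the inverse matrix in the Christoffel symbols;
    this is the form in which they are related to other charts. *)
Lemma chr_koszul i x u v w : chart_img i x ->
  bil (gmx i x) (chr i x u v) w =
  2^-1 * (dg i x u v w + dg i x v u w - dg i x w u v).
Proof.
move=> ix; have gs := gmx_sym ix; have gu := gmx_unit ix.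
pose kap (c : 'I_n) : R := \sum_a \sum_b u 0 a * v 0 b *
  (partial a (metric_coef g i b c) x + partial b (metric_coef g i a c) x
     - partial c (metric_coef g i a b) x).
have chrE : chr i x u v = 2^-1 *: ((\row_c kap c) *m invmx (gmx i x)).
  have giT : (invmx (gmx i x))^T = invmx (gmx i x) by rewrite trmx_inv gs.
  apply/rowP => k; rewrite chr_entry !mxE mulr_sumr.
  under [RHS]eq_bigr => c _ do rewrite mxE /kap mulr_suml mulr_sumr.
  rewrite [RHS]exchange_big/=; apply: eq_bigr => a _.
  under [RHS]eq_bigr => c _ do rewrite mulr_suml mulr_sumr.
  rewrite [RHS]exchange_big/=; apply: eq_bigr => b _.
  rewrite /christoffel mulr_sumr !mulr_suml; apply: eq_bigr => c _.
  have -> : inv_metric_coef g i k c x = invmx (gmx i x) c k.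
    by rewrite -[in RHS]giT mxE.
  by ring.
rewrite chrE bilZl; congr (_ * _); rewrite /bil mulmxKV// mxE.
rewrite !dgE//.
have -> : \sum_a \sum_b \sum_c v 0 a * u 0 b * w 0 c *
    partial a (metric_coef g i b c) x = \sum_a \sum_b \sum_c
    u 0 a * v 0 b * w 0 c * partial b (metric_coef g i a c) x.
  rewrite exchange_big/=; apply: eq_bigr => a _; apply: eq_bigr => b _.
  by apply: eq_bigr => c _; rewrite [v 0 b * _]mulrC.
have -> : \sum_a \sum_b \sum_c w 0 a * u 0 b * v 0 c *
    partial a (metric_coef g i b c) x = \sum_a \sum_b \sum_c
    u 0 a * v 0 b * w 0 c * partial c (metric_coef g i a b) x.
  rewrite exchange_big/=; apply: eq_bigr => a _.
  rewrite exchange_big/=; apply: eq_bigr => b _.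
  by apply: eq_bigr => c _; ring.
rewrite -big_split/= -sumrB.
under eq_bigr => c _ do rewrite !mxE mulr_suml.
rewrite exchange_big/=; apply: eq_bigr => a _.
rewrite -big_split/= -sumrB.
under eq_bigr => c _ do rewrite mulr_suml.
rewrite exchange_big/=; apply: eq_bigr => b _.
rewrite -big_split/= -sumrB; apply: eq_bigr => c _.
by ring.
Qed.

Lemma metric_coef_sym i (a b : 'I_n) x :
  metric_coef g i a b x = metric_coef g i b a x.
Proof.
rewrite /metric_coef /tensor_coef !mxE.
exact/bilC/gram_sym.
Qed.

Lemma christoffel_sym i (d a b : 'I_n) x :
  christoffel g i d a b x = christoffel g i d b a x.
Proof.
rewrite /christoffel; congr (_ * _); apply: eq_bigr => c _; congr (_ * _).
rewrite [_ + partial b _ _]addrC; congr (_ - _).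
by rewrite (funext (metric_coef_sym i a b)).
Qed.

Lemma chr_sym i x u v : chr i x u v = chr i x v u.
Proof.
apply/rowP => k; rewrite !chr_entry exchange_big/=; apply: eq_bigr => a _.
by apply: eq_bigr => b _; rewrite christoffel_sym mulrAC.
Qed.

End Metric.

(** * Covariant differentiation in charts *)

Section Connection.
Variables (R : realType) (n : nat) (M : topologicalType).
Variables (X : manifold R n M) (g : lorentz_metric X).
Implicit Types (i j : chart_idx X) (p : M) (u v w x : 'rV[R]_n).

Definition chrmx i (k : 'I_n) x : 'M[R]_n :=
  \matrix_(c, d) christoffel g i k c d x.

Lemma chrE i x u v k : chr g i x u v 0 k = bil (chrmx i k x) u v.
Proof.
rewrite bilE chr_entry; apply: eq_bigr => c _; apply: eq_bigr => d _.
by rewrite mxE [u 0 c * _]mulrC.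
Qed.

Lemma chrDl i x u v w : chr g i x (u + v) w = chr g i x u w + chr g i x v w.
Proof. by apply/rowP => k; rewrite [RHS]mxE !chrE bilDl. Qed.

Lemma chrDr i x u v w : chr g i x w (u + v) = chr g i x w u + chr g i x w v.
Proof. by rewrite ![chr g i x w _]chr_sym chrDl. Qed.

Lemma chrZl i x c u v : chr g i x (c *: u) v = c *: chr g i x u v.
Proof. by apply/rowP => k; rewrite [RHS]mxE !chrE bilZl. Qed.

Lemma smooth_christoffel i k c d : smooth (chart_img i) (christoffel g i k c d).
Proof.
have oi := @chart_img_open _ _ _ X i => r.
have gC r' a b : Ck r' (chart_img i) (metric_coef g i a b).
  by have /(Ck_mx _ _ oi) := @smooth_gmx _ _ _ _ g i r'; exact.
have pC a b e : Ck r (chart_img i) (partial e (metric_coef g i a b)).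
  exact: Ck_derive (gC r.+1 a b).
have iC a b : Ck r (chart_img i) (inv_metric_coef g i a b).
  have := Ck_invmx oi (@gmx_unit _ _ _ _ g i) (@smooth_gmx _ _ _ _ g i r).
  by move=> /(Ck_mx _ _ oi); exact.
have /(Ck_scale 2^-1) : Ck r (chart_img i) (fun x => \sum_(e < n) inv_metric_coef g i k e x *
    (partial c (metric_coef g i d e) x + partial d (metric_coef g i c e) x
     - partial e (metric_coef g i c d) x)).
  apply: (Ck_sum _ _ oi) => e; apply: (Ck_mul oi); first exact: iC.
  apply: (Ck_sub_fun oi); last exact: pC.
  by apply: (Ck_add oi); exact: pC.
exact.
Qed.

Lemma smooth_chrmx i k : smooth (chart_img i) (chrmx i k).
Proof.
have oi := @chart_img_open _ _ _ X i => r; apply/(Ck_mx _ _ oi) => c d.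
rewrite (_ : (fun x => _) = christoffel g i k c d).
  exact: smooth_christoffel.
by apply/funext => x; rewrite mxE.
Qed.

Definition dchr := locked (fun i x h u v =>
  \row_k bil ('D_h (chrmx i k) x) u v : 'rV[R]_n).

Lemma dchrE i x h u v k : dchr i x h u v 0 k = bil ('D_h (chrmx i k) x) u v.
Proof. by rewrite /dchr -lock mxE. Qed.

Lemma is_derive_chr (V : normedModType R) i (y a b : V -> 'rV[R]_n) (q h : V) dy da db :
  chart_img i (y q) -> is_derive q h y dy -> is_derive q h a da ->
  is_derive q h b db ->
  is_derive q h (fun q => chr g i (y q) (a q) (b q))
    (dchr i (y q) dy (a q) (b q) + chr g i (y q) da (b q) + chr g i (y q) (a q) db).
Proof.
move=> iy yd ad bd; apply/is_derive_mx => z k; rewrite (ord1 z) {z}.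
have addE (c d : 'rV[R]_n) : (c + d) 0 k = c 0 k + d 0 k by rewrite mxE.
rewrite !addE !chrE dchrE.
rewrite (_ : (fun q => _) = fun q => bil (chrmx i k (y q)) (a q) (b q)); last first.
  by apply/funext => q'; rewrite chrE.
refine (is_derive_bil _ ad bd).
exact: (chain_rule (findim_rV R n) (findim_mx R n n) (@chart_img_open _ _ _ X i) iy
  (@smooth_chrmx i k 1%N) yd).
Qed.

Lemma Ck_chr (V : normedModType R) r (U : set V) i (y a b : V -> 'rV[R]_n) :
  findim V -> open U -> (forall q, U q -> chart_img i (y q)) ->
  Ck r U y -> Ck r U a -> Ck r U b ->
  Ck r U (fun q => chr g i (y q) (a q) (b q)).
Proof.
move=> fV oU yi yC aC bC; apply/(Ck_mx _ _ oU) => z k; rewrite (ord1 z) {z}.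
rewrite (_ : (fun q => _) = fun q => bil ((chrmx i k \o y) q) (a q) (b q)); last first.
  by apply/funext => q'; rewrite chrE.
apply: Ck_bil => //.
exact: (Ck_comp (findim_rV R n) (findim_mx R n n) (@chart_img_open _ _ _ X i) oU yi
  (@smooth_chrmx i k r) yC).
Qed.

Definition curv := locked (fun i x u v w =>
  \row_k \sum_(c < n) \sum_(a < n) \sum_(b < n)
    riemann g i k c a b x * w 0 c * u 0 a * v 0 b : 'rV[R]_n).

Lemma curv_entry i x u v w k : curv i x u v w 0 k =
  \sum_(c < n) \sum_(a < n) \sum_(b < n)
    riemann g i k c a b x * w 0 c * u 0 a * v 0 b.
Proof. by rewrite /curv -lock mxE. Qed.

Lemma bil_dchrmx i k x u v w : chart_img i x ->
  bil ('D_u (chrmx i k) x) v w =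
  \sum_b \sum_c \sum_a v 0 b * (u 0 a * partial a (christoffel g i k b c) x) * w 0 c.
Proof.
move=> ix; have oi := @chart_img_open _ _ _ X i.
rewrite bilE; apply: eq_bigr => b _; apply: eq_bigr => c _.
have -> : 'D_u (chrmx i k) x b c = 'D_u (christoffel g i k b c) x.
  have /is_derive_mx/(_ b c) := Ck_is_derive u (@smooth_chrmx i k 1%N) ix.
  rewrite (_ : (fun y => _) = christoffel g i k b c); first by case.
  by apply/funext => y; rewrite mxE.
have -> := derive_partials u (@findim_R R) oi ix (@smooth_christoffel i k b c 1%N).
by rewrite mulr_sumr mulr_suml.
Qed.

Lemma chr_chr i k x u v w :
  chr g i x u (chr g i x v w) 0 k =
  \sum_c \sum_a \sum_b \sum_d christoffel g i k a d x * christoffel g i d b c x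
    * w 0 c * u 0 a * v 0 b.
Proof.
rewrite chr_entry [RHS]exchange_big/=; apply: eq_bigr => a _.
rewrite [RHS](eq_bigr (fun c => \sum_d \sum_b
  christoffel g i k a d x * christoffel g i d b c x
    * w 0 c * u 0 a * v 0 b)); last by move=> c _; rewrite exchange_big.
rewrite [RHS]exchange_big/=; apply: eq_bigr => d _.
rewrite chr_entry mulr_sumr [RHS]exchange_big/=; apply: eq_bigr => b _.
rewrite mulr_sumr; apply: eq_bigr => c _; ring.
Qed.

(** Contracting the index formula gives the identity between multilinear maps
    that iterated covariant derivatives produce. *)
Lemma curvE i x u v w : chart_img i x ->
  curv i x u v w = dchr i x u v w - dchr i x v u w
    + chr g i x u (chr g i x v w) - chr g i x v (chr g i x u w).
Proof.
move=> ix; apply/rowP => k.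
have addE (a b : 'rV[R]_n) : (a + b) 0 k = a 0 k + b 0 k by rewrite mxE.
have oppE (a : 'rV[R]_n) : (- a) 0 k = - a 0 k by rewrite mxE.
rewrite !addE !oppE.
rewrite [LHS]curv_entry.
have /= -> := etrans (dchrE i x u v w k) (bil_dchrmx k u v w ix).
have /= -> := etrans (dchrE i x v u w k) (bil_dchrmx k v u w ix).
have /= -> := chr_chr i k x u v w.
have /= -> := chr_chr i k x v u w.
rewrite [X in X - _ + _](_ : _ = \sum_c \sum_a \sum_b
    partial a (christoffel g i k b c) x * w 0 c * u 0 a * v 0 b); last first.
  rewrite exchange_big/=; apply: eq_bigr => c _; rewrite exchange_big/=.
  by apply: eq_bigr => a _; apply: eq_bigr => b _; ring.
rewrite [X in _ - X + _](_ : _ = \sum_c \sum_a \sum_b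
    partial b (christoffel g i k a c) x * w 0 c * u 0 a * v 0 b); last first.
  rewrite exchange_big/=; apply: eq_bigr => c _.
  by apply: eq_bigr => a _; apply: eq_bigr => b _; ring.
rewrite [X in _ + _ - X](_ : _ = \sum_c \sum_a \sum_b \sum_d
    christoffel g i k b d x * christoffel g i d a c x
    * w 0 c * u 0 a * v 0 b); last first.
  apply: eq_bigr => c _; rewrite exchange_big/=; apply: eq_bigr => a _.
  apply: eq_bigr => b _; apply: eq_bigr => d _; ring.
rewrite -!sumrB -big_split/= -sumrB; apply: eq_bigr => c _.
rewrite -!sumrB -big_split/= -sumrB; apply: eq_bigr => a _.
rewrite -!sumrB -big_split/= -sumrB; apply: eq_bigr => b _.
rewrite -addrA -sumrB /riemann.
have -> : \sum_d (christoffel g i k a d x * christoffel g i d b c x * w 0 c * u 0 a * v 0 b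
   - christoffel g i k b d x * christoffel g i d a c x * w 0 c * u 0 a * v 0 b) =
   (\sum_d (christoffel g i k a d x * christoffel g i d b c x
   - christoffel g i k b d x * christoffel g i d a c x)) * w 0 c * u 0 a * v 0 b.
  by rewrite !mulr_suml; apply: eq_bigr => d _; ring.
by rewrite !mulrDl !mulNr.
Qed.

Lemma dg_bil i x u v w : chart_img i x ->
  dg g i x u v w = bil ('D_u (gmx g i) x) v w.
Proof.
move=> ix.
have vc : is_derive x u (fun=> v) 0 by exact: is_derive_cst.
have wc : is_derive x u (fun=> w) 0 by exact: is_derive_cst.
have [_ E] := is_derive_bil (Ck_is_derive u (@smooth_gmx _ _ _ _ g i 1%N) ix) vc wc.
by rewrite /dg E /bil trmx0 mulmx0 !mul0mx !mxE !addr0.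
Qed.

(** Adding Koszul's formula for [(u, v, w)] and [(u, w, v)] leaves a single
    derivative of the metric. *)
Lemma dg_chr i x u v w : chart_img i x ->
  dg g i x u v w =
  bil (gmx g i x) (chr g i x u v) w + bil (gmx g i x) v (chr g i x u w).
Proof.
move=> ix; have gs := gmx_sym g ix.
have dgC a b c : dg g i x a b c = dg g i x a c b.
  have E : (fun y => bil (gmx g i y) b c) = (fun y => bil (gmx g i y) c b).
    apply/funext => y; apply: bilC; apply/matrixP => d e; rewrite mxE.
    exact: (metric_coef_sym g i e d y).
  by rewrite /dg E.
rewrite [bil _ v _]bilC// !chr_koszul// (dgC v u) (dgC v w) (dgC u w v).
by lra.
Qed.

End Connection.

Section ChangeOfChart.
Variables (R : realType) (n : nat) (M : topologicalType).
Variables (X : manifold R n M) (g : lorentz_metric X).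
Variables (i j : chart_idx X) (p : M).
Hypotheses (ip : chart_dom i p) (jp : chart_dom j p).
Implicit Types (u v w : 'rV[R]_n).
Let x := chart_map i p.
Let y := chart_map j p.
Let psi := transition i j.
Let T := tangent_change i j p.
Let H u v := 'D_u ('D_v psi) x.

Let ix : chart_img i x. Proof. exact: chart_img_map. Qed.
Let jy : chart_img j y. Proof. exact: chart_img_map. Qed.
Let ox : overlap i j x. Proof. exact: overlap_map. Qed.
Let psix : psi x = y. Proof. exact: transition_map. Qed.
Let oo : open (overlap i j). Proof. exact: open_overlap. Qed.

Let H_sym u v : H u v = H v u.
Proof.
exact: (derive_commute v u (findim_rV R n) oo ox (@smooth_transition _ _ _ X i j 2%N)).
Qed.

Lemma dg_pullback u v w :
  dg g i x u v w = dg g j y (T u) (T v) (T w)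
    + bil (gmx g j y) (H u v) (T w) + bil (gmx g j y) (T v) (H u w).
Proof.
have Gd : is_derive x u (gmx g j \o psi) ('D_(T u) (gmx g j) y).
  have pd := Ck_is_derive u (@smooth_transition _ _ _ X i j 1%N) ox.
  have jpx : chart_img j (psi x) by rewrite psix.
  have := chain_rule (findim_rV R n) (findim_mx R n n) (@chart_img_open _ _ _ X j)
    jpx (@smooth_gmx _ _ _ _ g j 1%N) pd.
  by rewrite psix.
have vd a : is_derive x u (fun z => 'D_a psi z) (H u a).
  exact: (Ck_is_derive u (Ck_derive a (@smooth_transition _ _ _ X i j 2%N)) ox).
have [_] := is_derive_bil Gd (vd v) (vd w).
rewrite -/(T v) -/(T w) (_ : (gmx g j \o psi) x = gmx g j y); last first.
  by rewrite /= psix.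
rewrite (dg_bil g (T u) (T v) (T w) jy) => <-; rewrite /dg.
apply: near_eq_derive; apply: filterS (open_nbhs_nbhs (conj oo ox)) => z.
move=> [q [iq jq] <-]; rewrite (bil_gmx_change g v w iq jq) /=.
by have -> : psi (chart_map i q) = chart_map j q by exact: transition_map.
Qed.

(** The transformation law of the Christoffel symbols.  The inhomogeneous terms
    in the three derivatives of the metric combine to a single Hessian of the
    transition map because that Hessian is symmetric. *)
Lemma chr_change u v : T (chr g i x u v) = H u v + chr g j y (T u) (T v).
Proof.
apply/eqP; rewrite -subr_eq0; apply/eqP.
apply: (bil_nondegenerate (gmx_unit g jy)) => w'.
pose w := tangent_change j i p w'.
have -> : w' = T w by rewrite /T /w tangent_changeK.
rewrite bilDl bilNl bilDl chr_koszul//.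
have /esym -> := bil_gmx_change g (chr g i x u v) w ip jp; rewrite chr_koszul//.
rewrite (dg_pullback u v w) (dg_pullback v u w) (dg_pullback w u v).
rewrite (H_sym v u) (H_sym w u) (H_sym w v).
have gs a b := bilC a b (gmx_sym g jy).
have -> := gs (T v) (H u w); have -> := gs (T u) (H v w).
have half (a b c d e f : R) : 2^-1 * (a + d + e + (b + d + f) - (c + e + f)) -
    (d + 2^-1 * (a + b - c)) = 0 by lra.
exact: half.
Qed.

End ChangeOfChart.

(** * Families of curves *)

Section Family.
Variables (R : realType) (n : nat) (M : topologicalType).
Variables (X : manifold R n M) (g : lorentz_metric X).
Variables (V : normedModType R) (A : set V) (sigma : V -> M).
Hypotheses (fV : findim V) (oA : open A) (smA : smooth_map X A sigma).
Implicit Types (i j : chart_idx X) (q w : V).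

Definition rep i q : 'rV[R]_n := chart_map i (sigma q).

Definition rep_dom i : set V := A `&` [set q | chart_dom i (sigma q)].

Lemma open_rep_dom i : open (rep_dom i).
Proof.
rewrite openE => q [Aq iq]; have [U [F [oU Uq _ UF]]] := smA Aq iq.
have n1 : \forall z \near q, A z by exact: open_nbhs_nbhs.
have n2 : \forall z \near q, U z by exact: open_nbhs_nbhs.
by apply: filterS2 n1 n2 => z Az Uz; split=> //; case: (UF z Az Uz).
Qed.

Lemma smooth_rep i : smooth (rep_dom i) (rep i).
Proof.
move=> k; apply: Ck_local => q [Aq iq].
have [U [F [oU Uq FC UF]]] := smA Aq iq.
have oAU : open (A `&` U) by exact: openI.
exists (A `&` U); first by split.
apply: (Ck_eq oAU) (Ck_sub _ (FC k)); last by move=> z [].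
by move=> z [Az Uz]; case: (UF z Az Uz).
Qed.

Lemma rep_img i q : rep_dom i q -> chart_img i (rep i q).
Proof. by move=> [_ iq]; exact: chart_img_map. Qed.

(** A vector field along [sigma] is represented by its components in all charts
    at once, so that it can be differentiated in whichever chart is at hand. *)
Definition tensorial (a : chart_idx X -> V -> 'rV[R]_n) : Prop :=
  forall i j q, rep_dom i q -> rep_dom j q ->
  a j q = tangent_change i j (sigma q) (a i q).

Definition smooth_along (a : chart_idx X -> V -> 'rV[R]_n) : Prop :=
  tensorial a /\ forall i, smooth (rep_dom i) (a i).

Definition vel w i q : 'rV[R]_n := 'D_w (rep i) q.

Definition cov w (a : chart_idx X -> V -> 'rV[R]_n) i q : 'rV[R]_n :=
  'D_w (a i) q + chr g i (rep i q) (vel w i q) (a i q).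

Lemma is_derive_rep w i q : rep_dom i q -> is_derive q w (rep i) (vel w i q).
Proof. exact: Ck_is_derive (@smooth_rep i 1%N). Qed.

Lemma near_rep_dom i q : rep_dom i q -> \forall z \near q, rep_dom i z.
Proof. by move=> iq; apply: open_nbhs_nbhs; split=> //; exact: open_rep_dom. Qed.

Lemma rep_transition i j q : rep_dom i q -> rep j q = transition i j (rep i q).
Proof. by move=> [_ iq]; rewrite /rep transition_map. Qed.

Lemma vel_along w : smooth_along (vel w).
Proof.
split=> [i j q iq jq|i k]; last exact: Ck_derive (@smooth_rep i k.+1).
have ox : overlap i j (rep i q) by apply: overlap_map; [case: iq|case: jq].
have [_ E] := chain_rule (findim_rV R n) (findim_rV R n) (@open_overlap _ _ _ X i j)
  ox (@smooth_transition _ _ _ X i j 1%N) (is_derive_rep w iq).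
apply: etrans E; apply: near_eq_derive; apply: filterS (near_rep_dom iq) => z.
exact: rep_transition.
Qed.

Lemma is_derive_along w a i q : smooth_along a -> rep_dom i q ->
  is_derive q w (a i) ('D_w (a i) q).
Proof. by move=> [_ aC]; exact: Ck_is_derive (aC i 1%N). Qed.

Lemma smooth_cov w a : (forall i, smooth (rep_dom i) (a i)) ->
  forall i, smooth (rep_dom i) (cov w a i).
Proof.
move=> aC i k; have od := @open_rep_dom i.
apply: (Ck_add od); first exact: Ck_derive (aC i k.+1).
apply: (Ck_chr g fV od (@rep_img i) (@smooth_rep i k)); last exact: aC.
exact: Ck_derive (@smooth_rep i k.+1).
Qed.

(** The second derivative of the transition map produced by differentiating a
    change of components is the one in the transformation law [chr_change]. *)
Lemma cov_along w a : smooth_along a -> smooth_along (cov w a).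
Proof.
move=> aS; split=> [i j q iq jq|]; last by apply: smooth_cov; case: aS.
have [aT aC] := aS; have [[Aq di] [_ dj]] := (iq, jq).
have ox : overlap i j (rep i q) by apply: overlap_map; [case: iq|case: jq].
have H1 := is_derive_directional (@open_overlap _ _ _ X i j) ox
  (@smooth_transition _ _ _ X i j 2%N) (is_derive_along w aS iq)
  (is_derive_rep w iq) (Ck_continuous (@smooth_rep i 0%N) iq).
have E1 : 'D_w (a j) q = 'D_('D_w (a i) q) (transition i j) (rep i q) +
    'D_(vel w i q) ('D_(a i q) (transition i j)) (rep i q).
  have [_ <-] := H1; apply: near_eq_derive.
  apply: filterS2 (near_rep_dom iq) (near_rep_dom jq) => z iz jz.
  by have := aT i j z iz jz.
have E2 := chr_change g di dj (vel w i q) (a i q).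
have E3 := tangent_changeD ('D_w (a i) q) (chr g i (rep i q) (vel w i q) (a i q)) di dj.
have E4 : vel w j q = tangent_change i j (sigma q) (vel w i q).
  by have [vT _] := vel_along w; exact: vT.
have E5 := aT i j q iq jq.
rewrite /cov E3 E2 E1 E4 E5 -/(transition i j) -/(rep i q) -/(rep j q).
by rewrite addrA.
Qed.

Lemma cov_vel_sym u w i q : rep_dom i q ->
  cov u (vel w) i q = cov w (vel u) i q.
Proof.
move=> iq; rewrite /cov (chr_sym g i (rep i q) (vel u i q) (vel w i q)).
apply: (congr1 (fun z => z + _)).
exact: (derive_commute w u (findim_rV R n) (@open_rep_dom i) iq (@smooth_rep i 2%N)).
Qed.

Lemma cov_local w a b i q : rep_dom i q ->
  (forall z, rep_dom i z -> a i z = b i z) -> cov w a i q = cov w b i q.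
Proof.
move=> iq ab; have D : 'D_w (a i) q = 'D_w (b i) q.
  by apply: near_eq_derive; apply: filterS (near_rep_dom iq) => z; exact: ab.
by rewrite /cov D ab.
Qed.

Lemma cov_eq0 w a i q : rep_dom i q ->
  (forall z, rep_dom i z -> a i z = 0) -> cov w a i q = 0.
Proof.
move=> iq a0; have D0 : 'D_w (a i) q = 0.
  rewrite -(derive_cst (0 : 'rV[R]_n) q w); apply: near_eq_derive.
  by apply: filterS (near_rep_dom iq) => z iz; rewrite a0.
by rewrite /cov D0 a0// chr_sym -[X in chr _ _ _ X](scale0r 0) chrZl scale0r addr0.
Qed.

(** The Ricci identity along the family: iterated ordinary derivatives commute,
    those of [a] as well as those of [sigma]; [curvE] collects the rest. *)
Lemma cov_commute u w a i q : smooth_along a -> rep_dom i q ->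
  cov u (cov w a) i q - cov w (cov u a) i q =
  curv g i (rep i q) (vel u i q) (vel w i q) (a i q).
Proof.
move=> aS iq; have [aT aC] := aS; have od := @open_rep_dom i.
have ix := rep_img iq.
have D h k : 'D_h (cov k a i) q = 'D_h ('D_k (a i)) q +
    (dchr g i (rep i q) (vel h i q) (vel k i q) (a i q)
     + chr g i (rep i q) ('D_h (vel k i) q) (a i q)
     + chr g i (rep i q) (vel k i q) ('D_h (a i) q)).
  have d1 := Ck_is_derive h (Ck_derive k (aC i 2%N)) iq.
  have d2 := is_derive_along h (vel_along k) iq.
  have d3 := is_derive_chr g ix (is_derive_rep h iq) d2 (is_derive_along h aS iq).
  by have [_] := is_deriveD d1 d3.
rewrite curvE//.
have -> : cov u (cov w a) i q = 'D_u (cov w a i) q +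
    (chr g i (rep i q) (vel u i q) ('D_w (a i) q) +
     chr g i (rep i q) (vel u i q) (chr g i (rep i q) (vel w i q) (a i q))).
  by rewrite -chrDr.
have -> : cov w (cov u a) i q = 'D_w (cov u a i) q +
    (chr g i (rep i q) (vel w i q) ('D_u (a i) q) +
     chr g i (rep i q) (vel w i q) (chr g i (rep i q) (vel u i q) (a i q))).
  by rewrite -chrDr.
rewrite (D u w) (D w u).
have -> : 'D_w ('D_u (a i)) q = 'D_u ('D_w (a i)) q.
  exact: (derive_commute u w (findim_rV R n) od iq (aC i 2%N)).
have -> : 'D_w (vel u i) q = 'D_u (vel w i) q.
  exact: (derive_commute u w (findim_rV R n) od iq (@smooth_rep i 2%N)).
have alg (Z : zmodType) (a1 b1 b2 c1 d1 d2 e1 e2 : Z) :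
  a1 + (b1 + c1 + d1) + (d2 + e1) - (a1 + (b2 + c1 + d2) + (d1 + e2)) =
  b1 - b2 + e1 - e2.
  rewrite !opprD !addrA.
  rewrite [LHS](AC 12 ((1*7)*(3*9)*(4*11)*(5*10)*(2*8*6*12)))/=.
  by rewrite !subrr !add0r.
exact: alg.
Qed.

(** By [dg_chr] the Christoffel terms of the two covariant derivatives add up to
    the derivative of the Gram matrix. *)
Lemma is_derive_metric w a b i q : smooth_along a -> smooth_along b -> rep_dom i q ->
  is_derive q w (fun z => bil (gmx g i (rep i z)) (a i z) (b i z))
    (bil (gmx g i (rep i q)) (cov w a i q) (b i q)
     + bil (gmx g i (rep i q)) (a i q) (cov w b i q)).
Proof.
move=> aS bS iq; have ix := rep_img iq.
have Gd := chain_rule (findim_rV R n) (findim_mx R n n) (@chart_img_open _ _ _ X i)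
  ix (@smooth_gmx _ _ _ _ g i 1%N) (is_derive_rep w iq).
have := is_derive_bil Gd (is_derive_along w aS iq) (is_derive_along w bS iq).
have E := dg_chr g (vel w i q) (a i q) (b i q) ix.
have := dg_bil g (vel w i q) (a i q) (b i q) ix; rewrite {}E => <-.
move=> H; apply: (is_derive_eq H); rewrite /cov bilDl bilDr /=.
have alg (Z : zmodType) (x1 x2 x3 x4 : Z) : x1 + x2 + x3 + x4 = x3 + x1 + (x4 + x2).
  by rewrite (AC 4 (3*1*(4*2))).
exact: alg.
Qed.

Definition pairing (a b : chart_idx X -> V -> 'rV[R]_n) q : R :=
  inner g (sigma q) (a (chart_at X (sigma q)) q) (b (chart_at X (sigma q)) q).

Lemma pairingE a b i q : smooth_along a -> smooth_along b -> rep_dom i q ->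
  pairing a b q = bil (gmx g i (rep i q)) (a i q) (b i q).
Proof.
move=> [aT _] [bT _] iq; have [Aq di] := iq.
have cq : rep_dom (chart_at X (sigma q)) q by split=> //; exact: chart_at_dom.
have E := bil_gmx g (a i q) (b i q) di.
by rewrite /rep E /pairing -(aT i _ q iq cq) -(bT i _ q iq cq).
Qed.

Lemma is_derive_pairing w a b q : A q -> smooth_along a -> smooth_along b ->
  is_derive q w (pairing a b) (pairing (cov w a) b q + pairing a (cov w b) q).
Proof.
move=> Aq aS bS; pose i := chart_at X (sigma q).
have iq : rep_dom i q by split=> //; exact: chart_at_dom.
rewrite (pairingE (cov_along w aS) bS iq) (pairingE aS (cov_along w bS) iq).
apply: near_eq_is_derive (is_derive_metric w aS bS iq).
by apply: filterS (near_rep_dom iq) => z iz; rewrite (pairingE aS bS iz).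
Qed.

Lemma pairingC a b q : pairing a b q = pairing b a q.
Proof. exact/bilC/gram_sym. Qed.

End Family.

(** * Curves of a family *)

(** At an end of [`[a, b]] the filter in [derive_within] is one-sided but still
    proper, so the limit is that of any differentiable extension. *)
Lemma derive_withinE (R : realType) (W : normedModType R) (a b t : R) (f F : R -> W) d :
  a < b -> `[a, b]%classic t -> is_derive t 1 F d ->
  (\forall s \near t, `[a, b]%classic s -> f s = F s) ->
  derive_within `[a, b] f t = d.
Proof.
move=> ab; rewrite /= in_itv/= => /andP[at_ tb] Fd fF.
have ft : f t = F t.
  by apply: (nbhs_singleton fF); rewrite /= in_itv/= at_.
set D := within [set h | `[a, b]%classic (t + h)] (0 : R)^'.
have PD : ProperFilter D.
  apply: Build_ProperFilter_ex.
move=> P [e /= e0 eP].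
  have [tb'|tb'] := ltP t b.
    exists (Num.min (e / 2) (b - t)); apply: eP.
    - rewrite /= sub0r normrN ger0_norm ?le_min; last by apply/andP; split; lra.
      by rewrite gt_min; apply/orP; left; lra.
    - by apply: lt0r_neq0; rewrite lt_min; apply/andP; split; lra.
    - rewrite /= in_itv/=; apply/andP; split.
        have : 0 <= Num.min (e / 2) (b - t) by rewrite le_min; apply/andP; split; lra.
        by move=> ?; lra.
      have : Num.min (e / 2) (b - t) <= b - t by rewrite ge_min lexx orbT.
      by move=> ?; lra.
  have tbE : t = b by apply/eqP; rewrite eq_le tb tb'.
  exists (- Num.min (e / 2) (t - a)); apply: eP.
  - rewrite /= sub0r normrN normrN ger0_norm ?le_min; last by apply/andP; split; lra.
    by rewrite gt_min; apply/orP; left; lra.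
  - rewrite oppr_eq0.
    by apply: lt0r_neq0; rewrite lt_min; apply/andP; split; lra.
  - rewrite /= in_itv/=.
    have : 0 <= Num.min (e / 2) (t - a) by rewrite le_min; apply/andP; split; lra.
    have : Num.min (e / 2) (t - a) <= t - a by rewrite ge_min lexx orbT.
    by move=> ? ?; apply/andP; split; lra.
have cF : h^-1 *: (F (t + h) - F t) @[h --> D] --> d.
  have := cvg_is_derive Fd.
  move=> H; apply: (cvg_trans _ H); move=> P /= [e e0 eP]; exists e => // h he h0 _.
  by have := eP h he h0; rewrite /= /GRing.scale/= mulr1 [h + _]addrC.
rewrite /derive_within; apply: cvg_lim => //; apply: cvg_trans cF.
apply: near_eq_cvg.
have sh : \forall h \near (0 : R), `[a, b]%classic (t + h) -> f (t + h) = F (t + h).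
  have [e /= e0 eP] := fF; exists e => // h he.
  have {}he : `|0 - h| < e := he.
  apply: eP; change (`|t - (t + h)| < e).
  by rewrite opprD addrA subrr.
rewrite /D; near=> h.
have th : `[a, b]%classic (t + h) by near: h; exact: withinT.
rewrite ft; suff -> : f (t + h) = F (t + h) by [].
by move: th; near: h; apply: cvg_within; exact: nbhs_dnbhs.
Unshelve. all: by end_near. Qed.

Section Restriction.
Variables (R : realType) (n : nat) (M : topologicalType).
Variables (X : manifold R n M) (g : lorentz_metric X).
Variables (V : normedModType R) (A : set V) (sigma : V -> M).
Hypotheses (fV : findim V) (oA : open A) (smA : smooth_map X A sigma).
Variables (tau : V) (iota : R -> V) (a b : R) (gam : R -> M).
Hypotheses (iota_aff : forall h s t, iota (h *: s + t) = h *: (s *: tau) + iota t).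
Hypotheses (iota_cont : continuous iota) (ab : a < b).
(** The set [O] makes the lemmas available for a curve that is known to belong to
    a family only near the parameter considered. *)
Variable O : set R.
Hypothesis oO : open O.
Hypothesis gamE : forall t,
  `[a, b]%classic t -> O t -> A (iota t) /\ gam t = sigma (iota t).
Implicit Types (i j : chart_idx X) (t : R).

Let iota1 t h : iota (h *: 1 + t) = h *: tau + iota t.
Proof. by rewrite iota_aff scale1r. Qed.

Let repI i t : `[a, b]%classic t -> O t -> chart_dom i (gam t) ->
  rep_dom A sigma i (iota t).
Proof. by move=> tI Ot; have [At gt] := gamE tI Ot; rewrite /rep_dom gt. Qed.

Let chart_repI t : `[a, b]%classic t -> O t ->
  rep_dom A sigma (chart_at X (gam t)) (iota t).
Proof. by move=> tI Ot; apply: repI => //; exact: chart_at_dom. Qed.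

Let nearO t : O t -> \forall s \near t, O s.
Proof. by move=> Ot; exact: open_nbhs_nbhs. Qed.

Lemma velocity_family t : `[a, b]%classic t -> O t ->
  velocity X a b gam t = vel sigma tau (chart_at X (gam t)) (iota t).
Proof.
move=> tI Ot; have it := chart_repI tI Ot.
have := is_derive_rep oA smA tau it.
move=> /(is_derive_affine_comp (iota1 t)) H.
apply: (derive_withinE ab tI H); apply: filterS (nearO Ot) => s Os sI.
by rewrite /= /rep; have [_ ->] := gamE sI Os.
Qed.

Lemma field_coord_family (f : chart_idx X -> V -> 'rV[R]_n) (Vf : R -> 'rV[R]_n) i t :
  smooth_along A sigma f -> `[a, b]%classic t -> O t -> chart_dom i (gam t) ->
  Vf t = f (chart_at X (gam t)) (iota t) ->
  field_coord gam Vf i t = f i (iota t).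
Proof.
move=> [fT _] tI Ot it E; rewrite /field_coord E.
have := fT _ _ _ (chart_repI tI Ot) (repI tI Ot it).
by have [_ <-] := gamE tI Ot.
Qed.

Lemma covariant_derivative_family (f : chart_idx X -> V -> 'rV[R]_n)
    (Vf : R -> 'rV[R]_n) t :
  smooth_along A sigma f -> `[a, b]%classic t -> O t ->
  (forall s, `[a, b]%classic s -> O s -> Vf s = f (chart_at X (gam s)) (iota s)) ->
  covariant_derivative g a b gam Vf t =
  cov g sigma tau f (chart_at X (gam t)) (iota t).
Proof.
move=> fS tI Ot E; have it := chart_repI tI Ot; set i := chart_at X (gam t) in it *.
have od := @open_rep_dom _ _ _ _ _ _ _ oA smA i.
rewrite /covariant_derivative -/i (velocity_family tI Ot) -/i (E t tI Ot) -/i.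
rewrite /cov; congr (_ + _); last first.
  apply/rowP => k; rewrite chr_entry mxE; have [_ ->] := gamE tI Ot.
  by [].
have := is_derive_along tau fS it.
move=> /(is_derive_affine_comp (iota1 t)) H.
apply: (derive_withinE ab tI H).
have : \forall s \near t, rep_dom A sigma i (iota s).
  by apply: iota_cont; apply: open_nbhs_nbhs.
apply: filterS2 (nearO Ot) => s Os is_ sI; rewrite /=.
have di : chart_dom i (gam s) by have [_ ->] := gamE sI Os; case: is_.
exact: field_coord_family fS sI Os di (E s sI Os).
Qed.

Hypothesis abO : forall t, `[a, b]%classic t -> O t.

Let smooth_iota i k (W : normedModType R) (f : V -> W) :
  Ck k (rep_dom A sigma i) f -> Ck k (iota @^-1` rep_dom A sigma i) (f \o iota).
Proof.
move=> fC; apply: (@Ck_affine_comp _ _ _ _ iota (fun s => s *: tau)) => //.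
  exact: open_rep_dom.
Qed.

Lemma smooth_field_family (f : chart_idx X -> V -> 'rV[R]_n) (Vf : R -> 'rV[R]_n) :
  smooth_along A sigma f ->
  (forall s, `[a, b]%classic s -> O s -> Vf s = f (chart_at X (gam s)) (iota s)) ->
  smooth_field X a b gam Vf.
Proof.
move=> fS E i t [tI it]; have [_ fC] := fS.
exists (iota @^-1` rep_dom A sigma i), (f i \o iota); split.
- apply: open_comp; first by move=> s _; exact: iota_cont.
  exact: open_rep_dom.
- exact: repI tI (abO tI) it.
- by move=> k; apply: smooth_iota; exact: fC.
- by move=> s [sI is_] _; exact: field_coord_family fS sI (abO sI) is_ (E s sI (abO sI)).
Qed.

Lemma geodesic_family :
  (forall i q, rep_dom A sigma i q -> cov g sigma tau (vel sigma tau) i q = 0) ->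
  geodesic g a b gam.
Proof.
move=> geo; split=> [i t tI it|t tI].
  exists (iota @^-1` rep_dom A sigma i), (rep sigma i \o iota); split.
  - apply: open_comp; first by move=> s _; exact: iota_cont.
    exact: open_rep_dom.
  - exact: repI tI (abO tI) it.
  - by move=> k; apply: smooth_iota; exact: smooth_rep.
  - by move=> s sI [_ is_]; rewrite /= /rep; have [_ ->] := gamE sI (abO sI).
rewrite (covariant_derivative_family (vel_along oA smA tau) tI (abO tI) velocity_family).
exact: geo (chart_repI tI (abO tI)).
Qed.

(** Differentiating the geodesic equation across the family and commuting the
    derivatives with [cov_commute] and [cov_vel_sym] gives the Jacobi equation. *)
Lemma jacobi_family w (J : R -> 'rV[R]_n) :
  (forall i q, rep_dom A sigma i q -> cov g sigma tau (vel sigma tau) i q = 0) ->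
  (forall s, `[a, b]%classic s -> O s -> J s = vel sigma w (chart_at X (gam s)) (iota s)) ->
  jacobi_field g a b gam J.
Proof.
move=> geo JE; have wS := vel_along oA smA w.
have tS := vel_along oA smA tau.
split=> [|t tI]; first exact: smooth_field_family wS JE.
have it := chart_repI tI (abO tI).
have JE1 s (sI : `[a, b]%classic s) (Os : O s) :=
  covariant_derivative_family wS sI Os JE.
have cS := cov_along g fV oA smA tau wS.
rewrite (covariant_derivative_family cS tI (abO tI) JE1) (JE t tI (abO tI))
  (velocity_family tI (abO tI)).
set i := chart_at X (gam t) in it *.
have -> : curvature g (gam t) (vel sigma w i (iota t)) (vel sigma tau i (iota t))
    (vel sigma tau i (iota t)) =
  curv g i (rep sigma i (iota t)) (vel sigma w i (iota t))
    (vel sigma tau i (iota t)) (vel sigma tau i (iota t)).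
  apply/rowP => k; rewrite curv_entry mxE.
  by have [_ E] := gamE tI (abO tI); rewrite /rep -E.
rewrite -(cov_commute g oA smA w tau tS it).
have G0 := cov_eq0 g oA smA w it (geo i); rewrite {}G0.
have G1 := cov_local g oA smA tau it (fun q iq => cov_vel_sym g oA smA tau w iq).
rewrite {}G1.
by rewrite sub0r subrr.
Qed.

End Restriction.

Section GeodesicFamily.
Variables (R : realType) (n : nat) (M : topologicalType).
Variables (X : manifold R n M) (g : lorentz_metric X).
Variables (V : normedModType R) (A : set V) (sigma : V -> M) (tau : V).
Hypotheses (fV : findim V) (oA : open A) (smA : smooth_map X A sigma).
Hypothesis geo :
  forall i q, rep_dom A sigma i q -> cov g sigma tau (vel sigma tau) i q = 0.
Implicit Types (i : chart_idx X) (q w : V).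

Definition energy q : R := pairing g sigma (vel sigma tau) (vel sigma tau) q.

Lemma pairing0 a b q : a (chart_at X (sigma q)) q = 0 ->
  pairing g sigma a b q = 0.
Proof.
by move=> a0; rewrite /pairing a0 /inner /tensor_form !mul0mx mxE.
Qed.

Let repc q : A q -> rep_dom A sigma (chart_at X (sigma q)) q.
Proof. by move=> Aq; split=> //; exact: chart_at_dom. Qed.

Lemma is_derive_energy w q : A q -> is_derive q w energy
  (2 * pairing g sigma (cov g sigma w (vel sigma tau)) (vel sigma tau) q).
Proof.
move=> Aq; have tS := vel_along oA smA tau.
have H := is_derive_pairing g fV oA smA w Aq tS tS.
apply: (is_derive_eq H).
by rewrite [X in _ + X]pairingC mulr2n mulrDl mul1r.
Qed.

Lemma energy_conserved q : A q -> is_derive q tau energy 0.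
Proof.
move=> Aq; apply: (is_derive_eq (is_derive_energy tau Aq)).
by rewrite pairing0 ?mulr0//; exact: geo (repc Aq).
Qed.

(** The first variation formula in differential form: since the connection is
    torsion free, moving across the family changes the energy at the rate at
    which [g (D_w sigma, D_tau sigma)] changes along each geodesic. *)
Lemma first_variation w q : A q ->
  is_derive q tau (pairing g sigma (vel sigma w) (vel sigma tau))
    (2^-1 * 'D_w energy q).
Proof.
move=> Aq; have tS := vel_along oA smA tau; have wS := vel_along oA smA w.
have H := is_derive_pairing g fV oA smA tau Aq wS tS.
apply: (is_derive_eq H).
have [_ ->] := is_derive_energy w Aq; rewrite mulrA mulVf ?pnatr_eq0// mul1r.
rewrite [X in _ + X]pairingC [X in _ + X]pairing0 ?addr0; last exact: geo (repc Aq).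
have E := cov_vel_sym g oA smA tau w (repc Aq).
exact: (congr1 (fun z => inner g (sigma q) z (vel sigma tau _ q)) E).
Qed.

End GeodesicFamily.

(** * The geodesic flow *)

Section SmoothMaps.
Variables (R : realType) (n : nat) (M : topologicalType) (X : manifold R n M).

Lemma open_setI_preimage (S T : topologicalType) (B : set S) (f : S -> T) (U : set T) :
  open B -> (forall x, B x -> {for x, continuous f}) -> open U ->
  open (B `&` f @^-1` U).
Proof.
move=> oB fc oU; rewrite openE => x [Bx Ux].
have n1 : \forall y \near x, B y by exact: open_nbhs_nbhs.
have n2 : \forall y \near x, U (f y) by apply: fc => //; exact: open_nbhs_nbhs.
by apply: filterS2 n1 n2 => y.
Qed.

Lemma smooth_map_chart (V : normedModType R) (U : set V) (i : chart_idx X)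
    (f : V -> 'rV[R]_n) :
  open U -> smooth U f -> (forall q, U q -> chart_img i (f q)) ->
  smooth_map X U (chart_inv i \o f).
Proof.
move=> oU fC fi j x Ux jx; have oo := @open_overlap _ _ _ X i j.
have oU' : open (U `&` f @^-1` overlap i j).
  apply: open_setI_preimage => // y Uy; exact: Ck_continuous (fC 0%N) Uy.
exists (U `&` f @^-1` overlap i j), (transition i j \o f); split=> //.
- by split=> //; apply/overlapE; split=> //; exact: fi.
- move=> k; apply: (Ck_comp (findim_rV R n) (findim_rV R n) oo oU').
  + by move=> y [].
  + exact: smooth_transition.
  + by apply: Ck_sub (fC k) => y [].
- by move=> y Uy [_ /overlapE[_ jy]].
Qed.

Lemma smooth_map_comp (V W : normedModType R) (A : set W) (B S : set V)
    (sigma : W -> M) (phi : V -> W) : findim W -> open B -> smooth B phi ->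
  smooth_map X A sigma -> S `<=` B -> (forall x, S x -> A (phi x)) ->
  smooth_map X S (sigma \o phi).
Proof.
move=> fW oB phiC smA SB SA i x Sx ix.
have [U [F [oU Ux FC UF]]] := smA i (phi x) (SA x Sx) ix.
have oB' : open (B `&` phi @^-1` U).
  apply: open_setI_preimage => // y By; exact: Ck_continuous (phiC 0%N) By.
exists (B `&` phi @^-1` U), (F \o phi); split=> //.
- by split=> //; exact: SB.
- move=> k; apply: (Ck_comp fW (findim_rV R n) oU oB').
  + by move=> y [].
  + exact: FC.
  + by apply: Ck_sub (phiC k) => y [].
- by move=> y Sy [_ Uy]; exact: UF (SA y Sy) Uy.
Qed.

End SmoothMaps.

Section GeodesicFamilies.
Variables (R : realType) (n : nat) (M : topologicalType).
Variables (X : manifold R n M) (g : lorentz_metric X).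
Variables (V : normedModType R) (tau : V).
Implicit Types (A B : set V) (i j : chart_idx X).

Definition geo_family A (sigma : V -> M) : Prop :=
  [/\ open A, smooth_map X A sigma & forall i q, rep_dom A sigma i q ->
    cov g sigma tau (vel sigma tau) i q = 0].

Lemma rep_local A B (sigma sigma' : V -> M) i q : open B ->
  (forall z, B z -> sigma z = sigma' z) -> B q ->
  (forall w, vel sigma w i q = vel sigma' w i q) /\
  cov g sigma tau (vel sigma tau) i q = cov g sigma' tau (vel sigma' tau) i q.
Proof.
move=> oB E Bq; have repE z : B z -> rep sigma i z = rep sigma' i z.
  by move=> Bz; rewrite /rep E.
have velE w z : B z -> vel sigma w i z = vel sigma' w i z.
  move=> Bz; apply: near_eq_derive; apply: filterS (open_nbhs_nbhs (conj oB Bz)).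
  exact: repE.
split=> [w|]; first exact: velE.
have D : 'D_tau (vel sigma tau i) q = 'D_tau (vel sigma' tau i) q.
  apply: near_eq_derive; apply: filterS (open_nbhs_nbhs (conj oB Bq)).
  exact: velE.
exact: (f_equal3 (fun d x v => d + chr g i x v v) D (repE q Bq) (velE tau q Bq)).
Qed.

Hypothesis fV : findim V.

Lemma geo_family_local A (sigma : V -> M) : open A ->
  (forall q, A q -> exists B sigma', [/\ B q, geo_family B sigma' &
     forall z, B z -> sigma z = sigma' z]) -> geo_family A sigma.
Proof.
move=> oA loc; split=> // [i q Aq iq|i q [Aq iq]].
  have [B [s' [Bq [oB smB _] E]]] := loc q Aq.
  rewrite (E q Bq) in iq; have [U [F [oU Uq FC UF]]] := smB i q Bq iq.
  have oUB : open (U `&` B) by exact: openI.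
  exists (U `&` B), F; split=> //.
    by move=> k; apply: Ck_sub (FC k) => y [].
  by move=> y Ay [Uy By]; rewrite E//; exact: UF.
have [B [s' [Bq [oB smB geo] E]]] := loc q Aq.
have [_ ->] := rep_local A i oB E Bq.
by apply: geo; split=> //; move: iq; rewrite /= E.
Qed.

(** Covariant derivatives change tensorially, so the geodesic equation may be
    checked in any one chart around each point. *)
Lemma geo_family_chart A (sigma : V -> M) i : open A -> smooth_map X A sigma ->
  (forall q, A q -> rep_dom A sigma i q /\
    cov g sigma tau (vel sigma tau) i q = 0) -> geo_family A sigma.
Proof.
move=> oA smA geo; split=> // j q jq; have [iq covi] := geo q (proj1 jq).
have [cT _] := cov_along g fV oA smA tau (vel_along oA smA tau).
by have := cT i j q iq jq; rewrite covi tangent_change0.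
Qed.

Lemma geo_family_sub A B (sigma : V -> M) : open B -> B `<=` A ->
  geo_family A sigma -> geo_family B sigma.
Proof.
move=> oB BA gA; apply: geo_family_local => // q Bq.
exists A, sigma; split=> //; exact: BA.
Qed.

Definition state (sigma : V -> M) i (q : V) : 'rV[R]_(n + n) :=
  row_mx (rep sigma i q) (vel sigma tau i q).

Definition spray i (z : 'rV[R]_(n + n)) : 'rV[R]_(n + n) :=
  row_mx (rsubmx z) (- chr g i (lsubmx z) (rsubmx z) (rsubmx z)).

Definition spray_dom i : set 'rV[R]_(n + n) := lsubmx @^-1` chart_img i.

Lemma open_spray_dom i : open (spray_dom i).
Proof.
apply: open_comp; last exact: chart_img_open.
by move=> z _; exact: continuous_lsubmx.
Qed.

Lemma smooth_spray i : smooth (spray_dom i) (spray i).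
Proof.
move=> k; have oS := @open_spray_dom i.
have idC : Ck k (spray_dom i) (id : 'rV[R]_(n + n) -> _).
  by apply: (@Ck_affine _ _ _ k _ _ id) => // z; exact: cvg_id.
apply: (Ck_row_mx oS); first exact: Ck_rsubmx.
apply: Ck_opp => //; apply: Ck_chr => //; [exact: findim_rV| | |];
  by [exact: Ck_lsubmx|exact: Ck_rsubmx].
Qed.

Lemma smooth_state A (sigma : V -> M) i : geo_family A sigma ->
  smooth (rep_dom A sigma i) (state sigma i).
Proof.
move=> [oA smA _] k; have od := @open_rep_dom _ _ _ _ _ _ _ oA smA i.
apply: (Ck_row_mx od); first exact: smooth_rep.
exact: Ck_derive (smooth_rep oA smA i k.+1).
Qed.

Lemma is_derive_row_mx (W : normedModType R) p (a b : W -> 'rV[R]_p) x v da db :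
  is_derive x v a da -> is_derive x v b db ->
  is_derive x v (fun y => row_mx (a y) (b y)) (row_mx da db).
Proof.
move=> /is_derive_mx ad /is_derive_mx bd; apply/is_derive_mx => z k.
rewrite mxE; case: split_ordP => j kj.
  rewrite (_ : (fun y => _) = fun y => a y z j); first exact: ad.
  by apply/funext => y; rewrite kj row_mxEl.
rewrite (_ : (fun y => _) = fun y => b y z j); first exact: bd.
by apply/funext => y; rewrite kj row_mxEr.
Qed.

Lemma state_spray A (sigma : V -> M) i q : geo_family A sigma ->
  rep_dom A sigma i q ->
  is_derive q tau (state sigma i) (spray i (state sigma i q)).
Proof.
move=> [oA smA geo] iq.
rewrite /spray row_mxKl row_mxKr.
refine (is_derive_row_mx (is_derive_rep oA smA tau iq) _).
have H := is_derive_along tau (vel_along oA smA tau) iq.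
apply: (is_derive_eq H); have := geo i q iq; rewrite /cov => /eqP.
by rewrite addr_eq0 => /eqP.
Qed.

End GeodesicFamilies.

Section ChartFlow.
Variables (R : realType) (n : nat) (M : topologicalType).
Variables (X : manifold R n M) (g : lorentz_metric X).
Local Notation E := ('rV[R]_(n + n) * R)%type.
Local Notation dt := ((0, 1) : E).
Implicit Types (i : chart_idx X) (q : E).

Definition geo_dom i : set E := flow_domain (spray_dom i) (spray g i).
Definition geo_flow i : E -> 'rV[R]_(n + n) := flow (spray_dom i) (spray g i).
Definition geo_map i : E -> M := chart_inv i \o (fun q => lsubmx (geo_flow i q)).

Lemma findim_phase : findim (E : normedModType R).
Proof. by apply: findim_prod; [exact: findim_rV|exact: findim_R]. Qed.

Lemma open_geo_dom i : open (geo_dom i).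
Proof. exact: open_flow_domain (@open_spray_dom _ _ _ X i) (@smooth_spray _ _ _ _ g i). Qed.

Lemma smooth_geo_flow i : smooth (geo_dom i) (geo_flow i).
Proof. exact: smooth_flow (@open_spray_dom _ _ _ X i) (@smooth_spray _ _ _ _ g i). Qed.

Lemma geo_flow_in i q : geo_dom i q -> spray_dom i (geo_flow i q).
Proof.
by case: q => z t; apply: flow_in (@open_spray_dom _ _ _ X i) (@smooth_spray _ _ _ _ g i) _ _.
Qed.

Lemma is_derive_geo_flow i q : geo_dom i q ->
  is_derive q dt (geo_flow i) (spray g i (geo_flow i q)).
Proof.
case: q => z t Dq; apply: (is_derive_eq (Ck_is_derive dt (@smooth_geo_flow i 1%N) Dq)).
exact: (flow_derive (@open_spray_dom _ _ _ X i) (@smooth_spray _ _ _ _ g i) Dq).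
Qed.

Lemma geo_map_rep i q : geo_dom i q ->
  rep_dom (geo_dom i) (geo_map i) i q /\ rep (geo_map i) i q = lsubmx (geo_flow i q).
Proof.
move=> Dq; have Ui := geo_flow_in Dq.
by rewrite /rep /geo_map /= chart_invK//; split=> //; split=> //; exact: chart_inv_dom.
Qed.

Lemma is_derive_lsubmx (V : normedModType R) p m (f : V -> 'rV[R]_(p + m)) x v d :
  is_derive x v f d -> is_derive x v (fun y => lsubmx (f y)) (lsubmx d).
Proof.
move=> /is_derive_mx fd; apply/is_derive_mx => z k; rewrite mxE.
by rewrite (_ : (fun y => _) = fun y => f y z (lshift m k))//; apply/funext => y; rewrite mxE.
Qed.

Lemma is_derive_rsubmx (V : normedModType R) p m (f : V -> 'rV[R]_(p + m)) x v d :
  is_derive x v f d -> is_derive x v (fun y => rsubmx (f y)) (rsubmx d).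
Proof.
move=> /is_derive_mx fd; apply/is_derive_mx => z k; rewrite mxE.
by rewrite (_ : (fun y => _) = fun y => f y z (rshift p k))//; apply/funext => y; rewrite mxE.
Qed.

Lemma geo_map_vel i q : geo_dom i q ->
  vel (geo_map i) dt i q = rsubmx (geo_flow i q).
Proof.
move=> Dq; have [_] := is_derive_lsubmx (is_derive_geo_flow Dq).
rewrite /spray row_mxKl => <-; apply: near_eq_derive.
apply: filterS (open_nbhs_nbhs (conj (@open_geo_dom i) Dq)) => z Dz.
by have [_ ->] := geo_map_rep Dz.
Qed.

Lemma geo_map_state i q : geo_dom i q -> state dt (geo_map i) i q = geo_flow i q.
Proof.
move=> Dq; have [_ E] := geo_map_rep Dq.
by rewrite /state E geo_map_vel// hsubmxK.
Qed.

Lemma geo_map_family i : geo_family g dt (geo_dom i) (geo_map i).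
Proof.
have oD := @open_geo_dom i.
have smD : smooth_map X (geo_dom i) (geo_map i).
  apply: smooth_map_chart => // [k|q]; last exact: geo_flow_in.
  exact: Ck_lsubmx (@smooth_geo_flow i k).
apply: (@geo_family_chart _ _ _ _ _ _ _ findim_phase _ _ i) => // q Dq.
have [iq E] := geo_map_rep Dq; split=> //.
have -> : cov g (geo_map i) dt (vel (geo_map i) dt) i q =
    'D_dt (vel (geo_map i) dt i) q + chr g i (lsubmx (geo_flow i q))
      (rsubmx (geo_flow i q)) (rsubmx (geo_flow i q)).
  by rewrite -E -(geo_map_vel Dq).
have -> : 'D_dt (vel (geo_map i) dt i) q = rsubmx (spray g i (geo_flow i q)).
  have [_ <-] := is_derive_rsubmx (is_derive_geo_flow Dq).
  apply: near_eq_derive; apply: filterS (open_nbhs_nbhs (conj oD Dq)) => z.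
  exact: geo_map_vel.
by rewrite /spray row_mxKr addNr.
Qed.

End ChartFlow.

Lemma near_eq_continuous (S T : topologicalType) (f h : S -> T) x :
  (\forall y \near x, f y = h y) -> {for x, continuous f} -> {for x, continuous h}.
Proof.
move=> fh fc; rewrite /prop_for /continuous_at -(nbhs_singleton fh).
by apply: cvg_trans fc; apply: near_eq_cvg; apply: filterS fh => y ->.
Qed.

Section GivenGeodesic.
Variables (R : realType) (n : nat) (M : topologicalType).
Variables (X : manifold R n M) (g : lorentz_metric X).
Variables (l : R) (gam : R -> M).
Hypotheses (l0 : 0 < l) (geo : geodesic g 0 l gam).
Implicit Types (i : chart_idx X) (t s : R).

Let gvel i t : 'rV[R]_n := field_coord gam (velocity X 0 l gam) i t.

(** Smoothness on a closed interval provides extensions [F] around every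
    parameter; through [F] the one-sided derivatives at the ends become ordinary
    derivatives and the geodesic equation an ordinary differential equation. *)
Lemma geodesic_extension i t : `[0, l]%classic t -> chart_dom i (gam t) ->
  exists (U : set R) (F : R -> 'rV[R]_n), [/\ open U, U t, smooth U F &
    forall s, U s -> `[0, l]%classic s ->
      [/\ chart_dom i (gam s), chart_map i (gam s) = F s, gvel i s = 'D_1 F s &
          'D_1 ('D_1 F) s = - chr g i (F s) ('D_1 F s) ('D_1 F s)]].
Proof.
move=> tI it; have [smg geoE] := geo.
have [U [F [oU Ut FC UF]]] := smg i t tI it.
pose B := U `&` F @^-1` chart_img i.
have oB : open B.
  apply: open_setI_preimage => //; last exact: chart_img_open.
  by move=> s; exact: Ck_continuous (FC 0%N).
have FB : smooth B F by move=> k; apply: Ck_sub (FC k) => s [].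
have Bi s : B s -> chart_img i (F s) by case.
have smB := smooth_map_chart oB FB Bi.
have repE s : B s -> rep (chart_inv i \o F) i s = F s.
  by move=> Bs; rewrite /rep /= chart_invK//; exact: Bi.
have repB s : B s -> rep_dom B (chart_inv i \o F) i s.
  by move=> Bs; split=> //=; apply: chart_inv_dom; exact: Bi.
have velE s : B s -> vel (chart_inv i \o F) 1 i s = 'D_1 F s.
  move=> Bs; apply: near_eq_derive; apply: filterS (open_nbhs_nbhs (conj oB Bs)).
  exact: repE.
have aff (h s r : R) : h *: s + r = h *: (s *: (1 : R)) + r.
  by rewrite [s *: 1]mulr1.
have idc : continuous (id : R -> R) by move=> s; exact: cvg_id.
have gE s : `[0, l]%classic s -> B s -> B s /\ gam s = (chart_inv i \o F) s.
  move=> sI Bs; split=> //; have [] := UF s sI (proj1 Bs).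
  by rewrite /= => is_ <-; rewrite chart_mapK.
exists B, F; split=> //.
  by split=> //=; have [_ <-] := UF t tI Ut; exact: chart_img_map.
move=> s Bs sI; have [is_ Fs] := UF s sI (proj1 Bs).
have vS := vel_along oB smB (1 : R).
have velF r (rI : `[0, l]%classic r) (Br : B r) :=
  velocity_family oB smB aff l0 oB gE rI Br.
split=> //.
  rewrite /gvel (field_coord_family gE vS sI Bs is_ (velF s sI Bs)).
  exact: velE.
have c0 := covariant_derivative_family g oB smB aff idc l0 oB gE vS sI Bs velF.
rewrite (geoE s sI) in c0.
have [cT _] := cov_along g (@findim_R R) oB smB 1 vS.
have cs : rep_dom B (chart_inv i \o F) (chart_at X (gam s)) s.
  have [_ E] := gE s sI Bs; split=> //.
  change (chart_dom (chart_at X (gam s)) ((chart_inv i \o F) s)).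
  by rewrite -E; exact: chart_at_dom.
have := cT _ i s cs (repB s Bs); rewrite -c0 tangent_change0 => /eqP.
have -> : cov g (chart_inv i \o F) 1 (vel (chart_inv i \o F) 1) i s =
    'D_1 (vel (chart_inv i \o F) 1 i) s + chr g i (F s) ('D_1 F s) ('D_1 F s).
  by rewrite -(velE s Bs) -[X in chr _ _ X](repE s Bs).
rewrite addr_eq0 => /eqP <-.
apply/esym/near_eq_derive; apply: filterS (open_nbhs_nbhs (conj oB Bs)).
exact: velE.
Qed.

Definition geodesic_state i t : 'rV[R]_(n + n) :=
  row_mx (chart_map i (gam t)) (gvel i t).

(** The state is frozen outside [[T1, T2]] to make it continuous on the line. *)
Lemma geodesic_state_curve i T1 T2 : 0 <= T1 -> T1 <= T2 -> T2 <= l ->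
  (forall t, T1 <= t <= T2 -> chart_dom i (gam t)) ->
  let x := fun s => geodesic_state i (T1 + clamp 0 (T2 - T1) s) in
  [/\ continuous x, forall s, 0 <= s <= T2 - T1 -> spray_dom i (x s) &
      forall s, 0 < s < T2 - T1 -> is_derive s 1 x (spray g i (x s))].
Proof.
move=> T10 T12 T2l iT; have T0 : 0 <= T2 - T1 by lra.
have rI s : 0 <= clamp 0 (T2 - T1) s <= T2 - T1 by exact: clamp_itv.
have rl s : `[0, l]%classic (T1 + clamp 0 (T2 - T1) s).
  by rewrite /= in_itv/=; have /andP[? ?] := rI s; apply/andP; split; lra.
have ri s : chart_dom i (gam (T1 + clamp 0 (T2 - T1) s)).
  by apply: iT; have /andP[? ?] := rI s; apply/andP; split; lra.
have cc : continuous (fun s : R => T1 + clamp 0 (T2 - T1) s).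
  move=> s; apply: cvgD; first exact: cvg_cst.
  exact: continuous_clamp.
split=> [s|s _|s s0].
- have [U [F [oU Us FC UF]]] := geodesic_extension (rl s) (ri s).
  have nU : \forall r \near s, U (T1 + clamp 0 (T2 - T1) r).
    by apply: cc; exact: open_nbhs_nbhs.
  apply: (@near_eq_continuous _ _ (fun r => row_mx (F (T1 + clamp 0 (T2 - T1) r))
      ('D_1 F (T1 + clamp 0 (T2 - T1) r)))).
    apply: filterS nU => r Ur; have [_ Fr Vr _] := UF _ Ur (rl r).
    by rewrite /geodesic_state Fr Vr.
  apply: (@continuous_comp _ _ _ (fun s : R => T1 + clamp 0 (T2 - T1) s)
    (fun r => row_mx (F r) ('D_1 F r))); first exact: cc.
  apply: (@Ck_continuous _ _ _ 0%N U); last exact: Us.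
  apply: (Ck_row_mx oU); first exact: FC.
  exact: Ck_derive (FC 1%N).
- by rewrite /spray_dom /= row_mxKl; exact: chart_img_map.
- have cE : clamp 0 (T2 - T1) s = s by apply: clamp_id; apply/andP; split; lra.
  have [U [F [oU Us FC UF]]] := geodesic_extension (rl s) (ri s).
  have nU : \forall r \near s, U (T1 + clamp 0 (T2 - T1) r).
    by apply: cc; exact: open_nbhs_nbhs.
  have [_ Fs Vs Ds] := UF _ Us (rl s).
  rewrite /spray /geodesic_state row_mxKl row_mxKr Fs Vs -Ds cE.
  have H : is_derive (T1 + s) 1 (fun r => row_mx (F r) ('D_1 F r))
      (row_mx ('D_1 F (T1 + s)) ('D_1 ('D_1 F) (T1 + s))).
    rewrite cE in Us; apply: is_derive_row_mx.
      exact: Ck_is_derive (FC 1%N) Us.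
    exact: (Ck_is_derive (1 : R) (Ck_derive (1 : R) (FC 2%N)) Us).
  have H2 : is_derive s 1 ((fun r => row_mx (F r) ('D_1 F r)) \o +%R T1)
      (row_mx ('D_1 F (T1 + s)) ('D_1 ('D_1 F) (T1 + s))).
    apply: is_derive_affine_comp H => h; by rewrite addrCA.
  apply: near_eq_is_derive H2.
  apply: filterS2 nU (near_clamp_id s0) => r Ur rE.
  have [_ Fr Vr _] := UF _ Ur (rl r); rewrite /= rE in Fr Vr *.
  by rewrite Fr Vr.
Qed.

End GivenGeodesic.

(** * The geodesics near a given geodesic *)

Section Reparametrize.
Variables (R : realType) (n : nat) (M : topologicalType).
Variables (X : manifold R n M) (g : lorentz_metric X).
Variables (V W : normedModType R) (tau : V) (tau' : W).
Hypothesis fV : findim V.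
Variables (A : set V) (sigma : V -> M) (B : set W) (phi : W -> V).
Hypotheses (fam : geo_family g tau A sigma) (oB : open B) (phiC : smooth B phi).
Hypothesis phi_aff : forall h q, phi (h *: tau' + q) = h *: tau + phi q.
Hypothesis phiA : forall q, B q -> A (phi q).
Implicit Types i : chart_idx X.

Let rep_phi i q : rep_dom B (sigma \o phi) i q -> rep_dom A sigma i (phi q).
Proof. by move=> [Bq iq]; split=> //; exact: phiA. Qed.

Let oA : open A. Proof. by case: fam. Qed.
Let smA : smooth_map X A sigma. Proof. by case: fam. Qed.
Let smB : smooth_map X B (sigma \o phi).
Proof. exact: (smooth_map_comp fV oB phiC smA). Qed.

Let vel_phi i q : rep_dom B (sigma \o phi) i q ->
  vel (sigma \o phi) tau' i q = vel sigma tau i (phi q).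
Proof.
move=> iq; have H := is_derive_rep oA smA tau (rep_phi iq).
by have [_] := is_derive_affine_comp (fun h => phi_aff h q) H.
Qed.

Lemma state_reparametrize i q : rep_dom B (sigma \o phi) i q ->
  state tau' (sigma \o phi) i q = state tau sigma i (phi q).
Proof. by move=> iq; rewrite /state vel_phi. Qed.

Lemma geo_family_reparametrize : geo_family g tau' B (sigma \o phi).
Proof.
have [_ _ geo] := fam; split=> // i q iq.
rewrite -(geo i (phi q) (rep_phi iq)).
have vp := vel_phi iq.
have D : 'D_tau' (vel (sigma \o phi) tau' i) q = 'D_tau (vel sigma tau i) (phi q).
  have H := is_derive_along tau (vel_along oA smA tau) (rep_phi iq).
  have [_ <-] := is_derive_affine_comp (fun h => phi_aff h q) H.
  apply: near_eq_derive; apply: filterS (near_rep_dom oB smB iq) => z iz.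
  exact: vel_phi.
exact: (f_equal2 (fun d v => d + chr g i (rep sigma i (phi q)) v v) D vp).
Qed.

End Reparametrize.

Lemma interval_induction (R : realType) (l : R) (P : R -> Prop) : 0 <= l -> P 0 ->
  (forall T, 0 <= T <= l -> exists2 d : R, 0 < d & forall T1 T2,
     0 <= T1 -> T1 <= T2 -> T2 <= l -> `|T1 - T| < d -> `|T2 - T| < d ->
     P T1 -> P T2) -> P l.
Proof.
move=> l0 P0 loc; pose S := [set T | 0 <= T <= l /\ P T].
have S0 : S 0 by split=> //; rewrite lexx.
have hS : has_sup S.
  by split; [exists 0|exists l => T [/andP[]]].
have s0 : 0 <= sup S by apply: (ub_le_sup hS.2).
have sl : sup S <= l by apply: ge_sup; [exists 0|move=> T [/andP[]]].
have [d d0 dP] := loc (sup S) (introT andP (conj s0 sl)).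
have [T1 [/andP[T10 T1l] PT1] sT1] := sup_adherent d0 hS.
have T1s : T1 <= sup S by apply: (ub_le_sup hS.2); split=> //; apply/andP.
pose T2 := Num.min l (sup S + d / 2).
have T2l : T2 <= l by rewrite /T2 ge_min lexx.
have T2s : sup S <= T2 by rewrite /T2 le_min sl/=; lra.
have T2d : T2 <= sup S + d / 2 by rewrite /T2 ge_min lexx orbT.
have PT2 : P T2.
  apply: (dP T1) PT1 => //; first by lra.
    by rewrite ler0_norm; lra.
  by rewrite ger0_norm; lra.
have T2S : T2 <= sup S.
  apply: (ub_le_sup hS.2); split=> //; apply/andP; split=> //; lra.
have [T2E|T2E] : T2 = l \/ T2 = sup S + d / 2.
  by rewrite /T2 /Num.min; case: ifP; [left|right].
- by rewrite -T2E.
- by lra.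
Qed.

Section FlowBox.
Variables (R : realType) (V : normedModType R).
Implicit Types (z : V) (T e : R).

Definition flow_box (z0 : V) (T e : R) : set (V * R)%type :=
  [set q | `|z0 - q.1| < e /\ - e < q.2 < T + e].

Lemma open_norm_ball z0 e : open (fun z => `|z0 - z| < e).
Proof.
have := ball_open z0 e; rewrite -ball_normE => H.
have [e0|e0] := ltP 0 e; first exact: H.
rewrite (_ : (fun z => _) = set0); first exact: open0.
apply/seteqP; split=> // z ze; have := le_lt_trans (normr_ge0 (z0 - z)) ze.
by rewrite ltNge e0.
Qed.

Lemma open_flow_box z0 T e : open (flow_box z0 T e).
Proof.
have oB := @open_norm_ball z0 e.
have -> : flow_box z0 T e = (setT `&` fst @^-1` (fun z => `|z0 - z| < e))
    `&` snd @^-1` `](- e), (T + e)[%classic.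
  apply/seteqP; split=> q; rewrite /flow_box /= in_itv/=; first by case.
  by move=> [[_ ?] ?].
apply: open_setI_preimage; last exact: interval_open.
- apply: open_setI_preimage => //; first exact: openT.
  by move=> q _; exact: cvg_fst.
- by move=> q _; exact: cvg_snd.
Qed.

Definition late_box (z0 : V) (T1 T2 e : R) : set (V * R)%type :=
  [set q | `|z0 - q.1| < e /\ T1 - e < q.2 < T2 + e].

Lemma open_late_box z0 T1 T2 e : open (late_box z0 T1 T2 e).
Proof.
have H := @open_flow_box z0 (T2 - T1) e.
have -> : late_box z0 T1 T2 e = setT `&` (fun q => (q.1, q.2 - T1)) @^-1`
    flow_box z0 (T2 - T1) e.
  apply/seteqP; split=> -[z t]; rewrite /late_box /flow_box /=.
    by move=> [ze /andP[? ?]]; split=> //; split=> //; apply/andP; split; lra.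
  by move=> [_ [ze /andP[? ?]]]; split=> //; apply/andP; split; lra.
apply: open_setI_preimage => //; first exact: openT.
move=> q _; apply: continuous_pair; first exact: cvg_fst.
by apply: cvgB; [exact: cvg_snd|exact: cvg_cst].
Qed.

Variables (n : nat) (M : topologicalType) (X : manifold R n M).
Variables (g : lorentz_metric X) (tau : (V * R)%type).

Lemma glue_families z0 T1 T2 e (s1 s' : (V * R)%type -> M) :
  0 < e -> 0 <= T1 -> T1 <= T2 ->
  geo_family g tau (flow_box z0 T1 e) s1 ->
  geo_family g tau (late_box z0 T1 T2 e) s' ->
  (forall z t, `|z0 - z| < e -> `|t - T1| < e -> s1 (z, t) = s' (z, t)) ->
  exists s2, [/\ geo_family g tau (flow_box z0 T2 e) s2,
    forall q, flow_box z0 T1 e q -> s2 q = s1 q &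
    forall q, late_box z0 T1 T2 e q -> s2 q = s' q].
Proof.
move=> e0 T10 T12 fam1 fam2 agree.
pose s2 (q : (V * R)%type) := if q.2 <= T1 then s1 q else s' q.
have E1 q : flow_box z0 T1 e q -> s2 q = s1 q.
  case: q => z t [/= ze /andP[t1 t2]]; rewrite /s2 /=; have [//|Tt] := leP t T1.
  by rewrite agree// ger0_norm; lra.
have E2 q : late_box z0 T1 T2 e q -> s2 q = s' q.
  case: q => z t [/= ze /andP[t1 t2]]; rewrite /s2 /=; have [Tt|//] := leP t T1.
  by apply: agree => //; rewrite ltr_norml; apply/andP; split; lra.
exists s2; split=> //; apply: geo_family_local; first exact: open_flow_box.
move=> [z t] [/= ze /andP[t1 t2]]; have [tT|tT] := ltP t (T1 + e).
  by exists (flow_box z0 T1 e), s1; split=> //; split=> //=; rewrite t1.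
exists (late_box z0 T1 T2 e), s'; split=> //; split=> //=.
by apply/andP; split; lra.
Qed.

End FlowBox.

Section NearbyGeodesics.
Variables (R : realType) (n : nat) (M : topologicalType).
Variables (X : manifold R n M) (g : lorentz_metric X).
Variables (l : R) (gam : R -> M).
Hypotheses (l0 : 0 < l) (geo : geodesic g 0 l gam).
Local Notation E := ('rV[R]_(n + n) * R)%type.
Local Notation dt := ((0, 1) : E).
Implicit Types (i j : chart_idx X) (t s : R) (z : 'rV[R]_(n + n)).

Local Notation gstate := (geodesic_state l gam).

Let c0 := chart_at X (gam 0).
Let z0 := gstate c0 0.

Local Notation box := (flow_box z0).

(** The assertion proved by induction over [T] in [[0, l]].  States are compared
    in all charts so that each step may choose the chart it works in. *)
Definition flows_until T : Prop := exists (e : R) (sigma : E -> M),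
  [/\ 0 < e, geo_family g dt (box T e) sigma,
    forall z, `|z0 - z| < e -> chart_dom c0 (sigma (z, 0)) /\
      state dt sigma c0 (z, 0) = z &
    forall t, 0 <= t <= T -> sigma (z0, t) = gam t /\
      forall i, chart_dom i (gam t) -> state dt sigma i (z0, t) = gstate i t].

Lemma gstate_change i j t : chart_dom i (gam t) -> chart_dom j (gam t) ->
  gstate j t = row_mx (chart_map j (gam t))
    (tangent_change i j (gam t) (rsubmx (gstate i t))).
Proof.
move=> it jt; rewrite /geodesic_state row_mxKr; congr row_mx.
by rewrite /field_coord tangent_change_comp//; exact: chart_at_dom.
Qed.

Lemma state_all_charts A (sigma : E -> M) i t : geo_family g dt A sigma ->
  A (z0, t) -> sigma (z0, t) = gam t -> chart_dom i (gam t) ->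
  state dt sigma i (z0, t) = gstate i t ->
  forall j, chart_dom j (gam t) -> state dt sigma j (z0, t) = gstate j t.
Proof.
move=> [oA smA _] At st it E j jt.
have iq : rep_dom A sigma i (z0, t) by split=> //=; rewrite st.
have jq : rep_dom A sigma j (z0, t) by split=> //=; rewrite st.
have [vT _] := vel_along oA smA dt.
rewrite (gstate_change it jt) -E /state row_mxKr /rep st; congr row_mx.
by rewrite (vT i j _ iq jq) st.
Qed.

Lemma flows_until0 : flows_until 0.
Proof.
have cd : chart_dom c0 (gam 0) by exact: chart_at_dom.
have z0d : spray_dom c0 z0.
  by rewrite /spray_dom /= /z0 /geodesic_state row_mxKl; exact: chart_img_map.
have oS := @open_spray_dom _ _ _ X c0; have SC := @smooth_spray _ _ _ _ g c0.
have zc : continuous (fun _ : R => z0) by move=> t; exact: cvg_cst.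
have zd (t : R) : 0 < t < 0 -> is_derive t 1 (fun=> z0) (spray g c0 z0).
  by move=> /andP[t0 /(lt_trans t0)]; rewrite ltxx.
have [e e0 [eP1 eP2]] := local_flow oS SC (lexx 0) zc erefl (fun t _ => z0d) zd.
have boxD : box 0 e `<=` geo_dom g c0.
  by move=> [z t] [/= zz tt]; apply: eP1 => //; rewrite distrC.
have zD z : `|z0 - z| < e -> geo_dom g c0 (z, 0).
  by move=> zz; apply: boxD; split=> //=; rewrite add0r e0 oppr_lt0 e0.
exists e, (geo_map g c0); split; first exact: e0.
- apply: geo_family_sub boxD (geo_map_family g c0); exact: open_flow_box.
- move=> z zz; have [[_ ?] _] := geo_map_rep (zD z zz); split=> //.
  rewrite geo_map_state; last exact: zD.
  by have [_] := flow0 oS SC (zD z zz).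
- move=> t /andP[t0 t0']; have -> : t = 0 by apply/eqP; rewrite eq_le t0 t0'.
  have Dz : geo_dom g c0 (z0, 0) by apply: zD; rewrite subrr normr0.
  have [_ F0] := flow0 oS SC Dz.
  have s0 : geo_map g c0 (z0, 0) = gam 0.
    rewrite /geo_map /= /geo_flow F0 /z0 /geodesic_state row_mxKl.
    by rewrite chart_mapK.
  have SE : state dt (geo_map g c0) c0 (z0, 0) = gstate c0 0.
    exact: etrans (geo_map_state Dz) F0.
  split; first exact: s0.
  exact: (state_all_charts (geo_map_family g c0) Dz s0 cd SE).
Qed.


(** As long as the geodesics of the family stay in the chart, their states solve
    the same first-order equation as the flow of the spray. *)
Lemma family_is_flow A (sigma : E -> M) i z T b : geo_family g dt A sigma ->
  (forall r, 0 <= r <= 1 -> rep_dom A sigma i (z, T + r * b) /\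
     geo_dom g i (state dt sigma i (z, T), r * b)) ->
  state dt sigma i (z, T + b) = geo_flow g i (state dt sigma i (z, T), b).
Proof.
move=> fam H; set S := state dt sigma i (z, T).
have [oA smA _] := fam.
have oS := @open_spray_dom _ _ _ X i; have SC := @smooth_spray _ _ _ _ g i.
have key := @ode_unique_segment R _ _ _ T b (fun s => state dt sigma i (z, s))
  (fun s => geo_flow g i (S, s - T)) oS (SC 2%N).
have bE r : T + r * b - T = r * b by rewrite addrC addKr.
have H0 : state dt sigma i (z, T) = geo_flow g i (S, T - T).
  have [_ D0] : rep_dom A sigma i (z, T + 0 * b) /\ geo_dom g i (S, 0 * b).
    by apply: H; rewrite lexx ler01.
  by rewrite subrr; have [_ E] := flow0 oS SC D0; rewrite /geo_flow E.
have -> : state dt sigma i (z, T + b) = geo_flow g i (S, T + b - T).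
  apply: key H0.
  - by move=> r /H[ir _]; rewrite /spray_dom /= row_mxKl; exact: rep_img ir.
  - by move=> r /H[_ Dr]; rewrite bE; exact: geo_flow_in.
  - by move=> r /H[ir _]; apply: is_derive_snd; exact: state_spray fam ir.
  - move=> r /H[_ Dr].
    have aff h : ((S, (h *: 1 + (T + r * b)) - T) : E) =
        h *: dt + ((S, (T + r * b) - T) : E).
      have -> : h *: dt + ((S, (T + r * b) - T) : E) =
        (h *: 0 + S, h *: 1 + ((T + r * b) - T)) by [].
      by rewrite scaler0 add0r -!addrA.
    have D := is_derive_geo_flow Dr; rewrite -(bE r) in D.
    exact: (is_derive_affine_comp (A := fun s => (S, s - T) : E) aff D).
by rewrite addrC addKr.
Qed.

Lemma state_local (B : set E) (sigma sigma' : E -> M) i q : open B ->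
  (forall p, B p -> sigma p = sigma' p) -> B q ->
  state dt sigma i q = state dt sigma' i q.
Proof.
move=> oB H Bq; have [vE _] := rep_local g dt B i oB H Bq.
exact: (f_equal2 (fun p v => row_mx (chart_map i p) v) (H q Bq) (vE dt)).
Qed.

(** Near the parameter [T1] a family reaching [T1] is continued by the flow of
    the spray in a chart containing the given geodesic between [T1] and [T2]. *)
Lemma flows_step i T1 T2 : 0 <= T1 -> T1 <= T2 -> T2 <= l ->
  (forall t, T1 <= t <= T2 -> chart_dom i (gam t)) ->
  flows_until T1 -> flows_until T2.
Proof.
move=> T10 T12 T2l iT [e1 [s1 [e10 fam1 ini1 cur1]]].
have [oA smA _] := fam1.
have oS := @open_spray_dom _ _ _ X i; have SC := @smooth_spray _ _ _ _ g i.
have i1 : chart_dom i (gam T1) by apply: iT; rewrite lexx.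
have [g1 /(_ i i1) st1] : s1 (z0, T1) = gam T1 /\
    forall i, chart_dom i (gam T1) -> state dt s1 i (z0, T1) = gstate i T1.
  by apply: cur1; rewrite T10 lexx.
have T21 : 0 <= T2 - T1 by lra.
have [xc xU xd] := geodesic_state_curve l0 geo T10 T12 T2l iT.
have x0 : gstate i (T1 + clamp 0 (T2 - T1) 0) = gstate i T1.
  by rewrite clamp_id; [rewrite addr0|rewrite lexx].
have [e2 e20 [fD fX]] := local_flow oS SC T21 xc x0 xU xd.
pose S z := state dt s1 i (z, T1).
have A1 : rep_dom (box T1 e1) s1 i (z0, T1).
  split; last by rewrite /= g1.
  by rewrite /flow_box /= subrr normr0; split; [exact: e10|apply/andP; split; lra].
have Sc : {for z0, continuous S}.
  apply: (@continuous_comp _ _ _ (fun z => (z, T1) : E) (state dt s1 i)).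
    by apply: continuous_pair; [exact: cvg_id|exact: continuous_at_cst].
  exact: Ck_continuous (smooth_state i fam1 0%N) A1.
have nS : \forall z \near z0, `|gstate i T1 - S z| < e2.
  by have := Sc; rewrite /prop_for /continuous_at {2}/S st1 => /cvgrPdist_lt/(_ _ e20).
have [[P Q] /= [nP nQ] PQ] : \forall q \near ((z0, T1) : E), rep_dom (box T1 e1) s1 i q.
  exact: near_rep_dom.
near (0 : R)^'+ => e.
have e0 : 0 < e by near: e; exact: nbhs_right_gt.
have ee1 : e < e1 by near: e; exact: nbhs_right_lt.
have ee2 : e < e2 by near: e; exact: nbhs_right_lt.
have eP : forall w, `|w - z0| < e -> P w by near: e; exact: near_norm_lt.
have eQ : forall w, `|w - T1| < e -> Q w by near: e; exact: near_norm_lt.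
have eS : forall w, `|w - z0| < e -> `|gstate i T1 - S w| < e2.
  by near: e; exact: near_norm_lt.
have rD z t : `|z0 - z| < e -> `|t - T1| < e -> rep_dom (box T1 e1) s1 i (z, t).
  move=> ze te; apply: (PQ (z, t)); split=> /=; last exact: eQ.
  by apply: eP; rewrite distrC.
have gD z t : `|z0 - z| < e -> T1 - e < t < T2 + e -> geo_dom g i (S z, t - T1).
  move=> ze /andP[t1 t2]; apply: fD; last by apply/andP; split; lra.
  by rewrite distrC; apply: eS; rewrite distrC.
have agree z t : `|z0 - z| < e -> `|t - T1| < e ->
    s1 (z, t) = geo_map g i (S z, t - T1).
  move=> ze te.
  have tE : T1 + (t - T1) = t by rewrite addrC subrK.
  have F := @family_is_flow (box T1 e1) s1 i z T1 (t - T1) fam1.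
  rewrite tE in F; have [_ it] := rD z t ze te.
  rewrite /geo_map /= -[geo_flow _ _ _]F; last first.
    move=> r /andP[r0 r1]; have rte : `|r * (t - T1)| < e.
      rewrite normrM (ger0_norm r0); apply: le_lt_trans te.
      by rewrite -[leRHS]mul1r; apply: ler_wpM2r.
    split; first by apply: rD; [exact: ze|rewrite addrC addKr; exact: rte].
    have rE : T1 + r * (t - T1) - T1 = r * (t - T1) by rewrite addrC addKr.
    have := gD z (T1 + r * (t - T1)) ze; rewrite rE; apply.
    by move: rte; rewrite ltr_norml => /andP[? ?]; apply/andP; split; lra.
  by rewrite /state row_mxKl /rep chart_mapK.
pose phi (q : E) : E := (S q.1, q.2 - T1).
pose B2 : set E := late_box z0 T1 T2 e.
have oB2 : open B2 by exact: open_late_box.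
have phiC : smooth B2 phi.
  move=> k; apply: (Ck_pair oB2).
    have oR := @open_rep_dom _ _ _ _ _ _ _ oA smA i.
    have aff (q v : E) h : (((h *: v + q).1, T1) : E) = h *: ((v.1, 0) : E) + (q.1, T1).
      have -> : h *: ((v.1, 0) : E) + (q.1, T1) = (h *: v.1 + q.1, h *: 0 + T1) by [].
      by rewrite scaler0 add0r.
    have cA : continuous (fun q : E => (q.1, T1) : E).
      by move=> q; apply: continuous_pair; [exact: cvg_fst|exact: continuous_at_cst].
    apply: Ck_sub (Ck_affine_comp oR cA aff (smooth_state i fam1 k)).
    by move=> [z t] [ze _]; apply: rD; [exact: ze|rewrite subrr normr0; exact: e0].
  apply: (@Ck_affine _ _ _ k _ _ snd); first exact: oB2.
    by move=> q; apply: cvgB; [exact: cvg_snd|exact: cvg_cst].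
  by move=> q v h; rewrite /= addrA.
have phiA q : B2 q -> geo_dom g i (phi q).
  by case: q => z t [ze tt]; exact: gD.
have phi_aff (h : R) (q : E) : phi (h *: dt + q) = h *: dt + phi q.
  case: q => z t; rewrite /phi.
  have -> : h *: dt + (z, t) = (h *: 0 + z, h *: 1 + t) :> E by [].
  have -> : h *: dt + (S z, t - T1) = (h *: 0 + S z, h *: 1 + (t - T1)) :> E by [].
  by rewrite /= !scaler0 !add0r addrA.
have fam2 : geo_family g dt B2 (geo_map g i \o phi).
  exact: (geo_family_reparametrize (findim_phase R n)
    (geo_map_family g i) oB2 phiC phi_aff phiA).
have box1 : box T1 e `<=` box T1 e1.
  move=> [z t] [/= ze /andP[t1 t2]]; split=> /=; first by lra.
  by apply/andP; split; lra.
have fam1' : geo_family g dt (box T1 e) s1.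
  by apply: geo_family_sub box1 fam1; exact: open_flow_box.
have B1 z t : `|z0 - z| < e -> 0 <= t <= T1 -> box T1 e (z, t).
  move=> ze /andP[? ?]; split; first exact: ze.
  by rewrite /=; apply/andP; split; lra.
have [s2 [fam E1 E2]] := glue_families e0 T10 T12 fam1' fam2 agree.
exists e, s2; split; [exact: e0|exact: fam| |].
- move=> z ze; have Bz : box T1 e (z, 0) by apply: B1; [exact: ze|rewrite lexx; exact: T10].
  have [d1 d2] := ini1 z (lt_trans ze ee1).
  split; first by rewrite (E1 _ Bz); exact: d1.
  exact: (etrans (state_local c0 (@open_flow_box _ _ z0 T1 e) E1 Bz) d2).
- move=> t /andP[t0 t2]; have z0e : `|z0 - z0| < e by rewrite subrr normr0.
  have [tT|tT] := leP t T1.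
    have Bz : box T1 e (z0, t) by apply: B1; [exact: z0e|rewrite t0; exact: tT].
    have [d1 d2] : s1 (z0, t) = gam t /\
      forall i, chart_dom i (gam t) -> state dt s1 i (z0, t) = gstate i t.
      by apply: cur1; rewrite t0.
    split; first exact: (etrans (E1 _ Bz) d1).
    move=> j jt; have SL := state_local j (@open_flow_box _ _ z0 T1 e) E1 Bz.
    exact: (etrans SL (d2 j jt)).
  have Bz : B2 (z0, t).
    by split; [exact: z0e|rewrite /=; apply/andP; split; lra].
  have it : chart_dom i (gam t) by apply: iT; apply/andP; split; lra.
  have tT2 : 0 <= t - T1 <= T2 - T1 by apply/andP; split; lra.
  have F : geo_flow g i (phi (z0, t)) = gstate i t.
    have tE : T1 + (t - T1) = t by rewrite addrC subrK.
    have F0 := fX (t - T1) tT2; rewrite (clamp_id tT2) tE in F0.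
    have phiE : phi (z0, t) = (gstate i T1, t - T1).
      exact: (congr1 (fun u => (u, t - T1)) st1).
    exact: (etrans (congr1 (geo_flow g i) phiE) F0).
  have sg : s2 (z0, t) = gam t.
    have E : geo_map g i (phi (z0, t)) = chart_inv i (lsubmx (gstate i t)).
      exact: (congr1 (fun u => chart_inv i (lsubmx u)) F).
    rewrite (E2 _ Bz); apply: (etrans E); rewrite /geodesic_state row_mxKl.
    exact: chart_mapK.
  have Bz2 : box T2 e (z0, t).
    by split; [exact: z0e|rewrite /=; apply/andP; split; lra].
  split; first exact: sg.
  apply: (state_all_charts fam Bz2 sg it).
  have iq : rep_dom B2 (geo_map g i \o phi) i (z0, t).
    split; first exact: Bz.
    by have := E2 _ Bz; rewrite sg /= => <-; exact: it.
  apply: (etrans (state_local i oB2 E2 Bz)).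
  have R1 := state_reparametrize (geo_map_family g i) phi_aff phiA iq.
  exact: etrans R1 (etrans (geo_map_state (phiA _ Bz)) F).
Unshelve. all: by end_near. Qed.

Theorem geodesic_family_along : flows_until l.
Proof.
apply: (interval_induction (ltW l0) flows_until0) => T /andP[T0 Tl].
have TI : `[0, l]%classic T by rewrite /= in_itv/= T0.
have [U [F [oU UT _ UF]]] := geodesic_extension l0 geo TI (chart_at_dom X (gam T)).
have nU : \forall s \near T, U s by exact: open_nbhs_nbhs.
have [d /= d0 dP] := nU; exists d => // T1 T2 T10 T12 T2l T1d T2d.
apply: (@flows_step (chart_at X (gam T))) => // t /andP[t1 t2].
have tI : `[0, l]%classic t by rewrite /= in_itv/=; apply/andP; split; lra.
suff Ut : U t by have [] := UF t Ut tI.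
apply: dP; rewrite /= distrC; move: T1d T2d; rewrite !ltr_norml => /andP[? ?] /andP[? ?].
by apply/andP; split; lra.
Qed.

End NearbyGeodesics.

(** * Continuation of a fixed point *)

Section Continuation.
Variables (R : realType) (n : nat).
Implicit Types (s t : R) (z : 'rV[R]_(n + n)).

Lemma constant_slope (f : R -> R) (c s t : R) : s <= t ->
  (forall r, s <= r <= t -> is_derive r 1 f c) -> f t - f s = c * (t - s).
Proof.
move=> st fd.
have fc : {within `[s, t], continuous f}.
  apply: derivable_within_continuous => r; rewrite in_itv/= => rI.
  by have [] := fd r rI.
have fd' r : r \in `]s, t[ -> is_derive r 1 f c.
  by rewrite in_itv/= => /andP[sr rt]; apply: fd; rewrite !ltW.
by have [r _ ->] := MVT_segment st fd' fc.
Qed.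

Lemma constant_slope_mx (p q : nat) (f : R -> 'M[R]_(p, q)) (c : 'M[R]_(p, q)) e :
  (forall s, `|s| < e -> is_derive s 1 f c) ->
  forall s, `|s| < e -> f s = f 0 + s *: c.
Proof.
move=> fd s; rewrite ltr_norml => /andP[es se]; apply/matrixP => i j.
have fij r : - e < r < e -> is_derive r 1 (fun r => f r i j) (c i j).
  move=> rI; have /is_derive_mx : is_derive r 1 f c; last exact.
  by apply: fd; rewrite ltr_norml.
rewrite !mxE; have [s0|s0] := leP 0 s.
  have H : f s i j - f 0 i j = c i j * (s - 0).
    apply: (@constant_slope (fun r => f r i j)) s0 _ => r /andP[r0 rs].
    by apply: fij; apply/andP; split; lra.
  by rewrite -[LHS](subrK (f 0 i j)) H subr0 addrC mulrC.
have H : f 0 i j - f s i j = c i j * (0 - s).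
  apply: (@constant_slope (fun r => f r i j)) (ltW s0) _ => r /andP[r0 rs].
  by apply: fij; apply/andP; split; lra.
have -> : f 0 i j = c i j * (0 - s) + f s i j by rewrite -H subrK.
by rewrite sub0r mulrN [s * _]mulrC addrAC addNr add0r.
Qed.

Lemma derive_sum_direction (W : set 'rV[R]_(n + n)) (G : 'rV[R]_(n + n) -> 'rV[R]_n)
    z (I : Type) (r : seq I) (c : I -> R) (v : I -> 'rV[R]_(n + n)) :
  open W -> W z -> Ck 1 W G ->
  'D_(\sum_(k <- r) c k *: v k) G z = \sum_(k <- r) c k *: 'D_(v k) G z.
Proof.
move=> oW Wz GC; elim: r => [|k r IH]; first by rewrite !big_nil derive0.
rewrite !big_cons -IH.
exact: derive_linear (findim_rV R (n + n)) (findim_rV R n) oW Wz GC.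
Qed.

Definition velocity_derivative (G : 'rV[R]_(n + n) -> 'rV[R]_n) z : 'M[R]_n :=
  \matrix_(j, k) ('D_(row_mx 0 (delta_mx 0 j)) G z) 0 k.

Lemma velocity_derivativeE (W : set 'rV[R]_(n + n)) (G : 'rV[R]_(n + n) -> 'rV[R]_n)
    z w : open W -> W z -> Ck 1 W G ->
  w *m velocity_derivative G z = 'D_(row_mx 0 w) G z.
Proof.
move=> oW Wz GC.
have -> : row_mx 0 w = \sum_j w 0 j *: (row_mx 0 (delta_mx 0 j) : 'rV[R]_(n + n)).
  under eq_bigr do rewrite scale_row_mx scaler0.
  apply/rowP => k; rewrite summxE !mxE; case: split_ordP => j kj.
    rewrite mxE big1// => a _; rewrite kj row_mxEl mxE//.
  rewrite {1}(row_sum_delta w) summxE; apply: eq_bigr => a _.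
  by rewrite kj row_mxEr.
rewrite (derive_sum_direction _ _ _ oW Wz GC).
apply/rowP => k; rewrite mxE summxE; apply: eq_bigr => j _.
by rewrite !mxE.
Qed.

(** If the end point [G (x, v)] depends submersively on [v], the initial point
    and the end point can be moved together in any direction [a]: along the
    integral curves of the field [(a, v')] with [D_a G + D_v G (v') = a] both
    have derivative [a].  The existence of flows thus takes the place of an
    implicit function theorem. *)
Theorem continuation (W : set 'rV[R]_(n + n)) (G : 'rV[R]_(n + n) -> 'rV[R]_n)
    z0 (a : 'rV[R]_n) :
  open W -> W z0 -> smooth W G ->
  (forall w, 'D_(row_mx 0 w) G z0 = 0 -> w = 0) ->
  exists (e : R) (Z : R -> 'rV[R]_(n + n)),
    [/\ 0 < e, Z 0 = z0, smooth (fun s => `|s| < e) Z &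
      forall s, `|s| < e -> [/\ W (Z s), lsubmx (Z s) = lsubmx z0 + s *: a &
        G (Z s) = G z0 + s *: a]].
Proof.
move=> oW Wz0 GC inj; pose B := velocity_derivative G.
have BC : smooth W B.
  move=> k; apply/(Ck_mx _ _ oW) => i j.
  have := Ck_derive (row_mx 0 (delta_mx 0 i)) (GC k.+1).
  move=> /(Ck_mx _ _ oW)/(_ 0 j).
  by rewrite (_ : (fun x => B x i j) = (fun x => 'D_(row_mx 0 (delta_mx 0 i)) G x 0 j))//;
    apply/funext => x; rewrite mxE.
have B0 : B z0 \in unitmx.
  apply: unitmx_kernel => u uB; apply: inj.
  by rewrite -(velocity_derivativeE u oW Wz0 (GC 1%N)).
pose U : set 'rV[R]_(n + n) := W `&` (fun z => \det (B z)) @^-1` [set c | c != 0].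
have oU : open U.
  apply: open_setI_preimage => //.
  by move=> z; exact: Ck_continuous (Ck_det oW (BC 0%N)).
have Uz0 : U z0 by split=> //=; rewrite -unitfE -unitmxE.
have UB z : U z -> B z \in unitmx by move=> [_]; rewrite unitmxE unitfE.
have UW : U `<=` W by move=> z [].
pose F z := row_mx a ((a - 'D_(row_mx a 0) G z) *m invmx (B z)).
have FC : smooth U F.
  move=> k; apply: (Ck_row_mx oU); first exact: Ck_cst.
  apply: (Ck_mulmx oU).
    apply: (Ck_sub_fun oU); first exact: Ck_cst.
    exact: Ck_sub UW (Ck_derive _ (GC k.+1)).
  by apply: (Ck_invmx oU UB); exact: Ck_sub UW (BC k).
have zc : continuous (fun _ : R => z0) by move=> t; exact: cvg_cst.
have zd t : 0 < t < 0 -> is_derive t 1 (fun=> z0) (F z0).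
  by move=> /andP[t0 /(lt_trans t0)]; rewrite ltxx.
have [e e0 [eP _]] := local_flow oU FC (lexx 0) zc erefl (fun t _ => Uz0) zd.
have fD s : `|s| < e -> flow_domain U F (z0, s).
  move=> se; apply: eP; first by rewrite subrr normr0.
  by rewrite add0r -ltr_norml.
pose Z s := flow U F (z0, s).
have Z0 : Z 0 = z0.
  by have [|_] := @flow0 _ _ _ _ oU FC z0 0; first by apply: fD; rewrite normr0.
have UZ s : `|s| < e -> U (Z s) by move=> se; exact: (flow_in oU FC (fD s se)).
have Zd s : `|s| < e -> is_derive s 1 Z (F (Z s)).
  move=> se; apply: is_derive_snd.
  apply: (is_derive_eq (Ck_is_derive _ (smooth_flow oU FC 1%N) (fD s se))).
  exact: (flow_derive oU FC (fD s se)).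
have oe : open (fun s : R => `|s| < e).
  have -> : (fun s : R => is_true (`|s| < e)) = (fun s : R => is_true (`|0 - s| < e)).
    by apply/funext => s; rewrite sub0r normrN.
  exact: open_norm_ball.
exists e, Z; split=> //.
  move=> k; have oD := open_flow_domain oU FC.
  have pc : continuous (fun s : R => (z0, s) : ('rV[R]_(n + n) * R)%type).
    by move=> s; apply: continuous_pair; [exact: continuous_at_cst|exact: cvg_id].
  have aff s r h : ((z0, h *: r + s) : ('rV[R]_(n + n) * R)%type) =
      h *: ((0, r) : ('rV[R]_(n + n) * R)%type) + (z0, s).
    have -> : h *: ((0, r) : ('rV[R]_(n + n) * R)%type) + (z0, s) =
      (h *: 0 + z0, h *: r + s) by [].
    by rewrite scaler0 add0r.
  apply: Ck_sub (Ck_affine_comp oD pc aff (smooth_flow oU FC k)).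
  exact: fD.
move=> s se; split; first exact: UW (UZ s se).
  rewrite -Z0.
  apply: (@constant_slope_mx _ _ (fun s => lsubmx (Z s)) a e) se => r re.
  by have := is_derive_lsubmx (Zd r re); rewrite row_mxKl.
rewrite -[in RHS]Z0.
apply: (@constant_slope_mx _ _ (fun s => G (Z s)) a e) se => r re.
have Wr := UW _ (UZ r re).
apply: (is_derive_eq (chain_rule (findim_rV R (n + n)) (findim_rV R n) oW Wr
  (GC 1%N) (Zd r re))).
have -> : F (Z r) = row_mx a 0 + row_mx 0 (rsubmx (F (Z r))).
  by rewrite add_row_mx addr0 add0r /F row_mxKr.
rewrite (deriveDv _ _ (findim_rV R (n + n)) (findim_rV R n) oW Wr (GC 1%N)).
rewrite -(velocity_derivativeE _ oW Wr (GC 1%N)) /F row_mxKr.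
rewrite -/(B (Z r)) (mulmxKV (UB _ (UZ r re))).
exact: subrKC.
Qed.

End Continuation.

(** * Loops near a non-self-conjugate loop *)

Section Loop.
Variables (R : realType) (n : nat) (M : topologicalType).
Variables (X : manifold R n M) (g : lorentz_metric X).
Variables (l : R) (gam : R -> M).
Hypotheses (l0 : 0 < l) (geo : geodesic g 0 l gam) (loop : gam 0 = gam l).
Hypothesis nconj : ~ conjugate_ends g 0 l gam.
Local Notation E := ('rV[R]_(n + n) * R)%type.
Local Notation dt := ((0, 1) : E).
Implicit Types (i j : chart_idx X) (t s : R) (z u : 'rV[R]_(n + n)).
Let c0 := chart_at X (gam 0).
Let z0 := geodesic_state l gam c0 0.

Section WithFamily.
Variables (e : R) (sigma : E -> M).
Local Notation A := (flow_box z0 l e).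
Hypotheses (e0 : 0 < e) (fam : geo_family g dt A sigma).
Hypothesis ini : forall z, `|z0 - z| < e -> chart_dom c0 (sigma (z, 0)) /\
  state dt sigma c0 (z, 0) = z.
Hypothesis cur : forall t, 0 <= t <= l -> sigma (z0, t) = gam t.

Let oA : open A. Proof. by case: fam. Qed.
Let smA : smooth_map X A sigma. Proof. by case: fam. Qed.
Let famE i q : rep_dom A sigma i q -> cov g sigma dt (vel sigma dt) i q = 0.
Proof. by case: fam => _ _; exact. Qed.

Let At t : 0 <= t <= l -> A (z0, t).
Proof.
move=> /andP[t0 tl]; split; first by rewrite /= subrr normr0.
by have e0' := e0; rewrite /=; apply/andP; split; lra.
Qed.

Let inA t : 0 <= t <= l -> chart_dom c0 (gam t) -> rep_dom A sigma c0 (z0, t).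
Proof. by move=> tI ct; split; [exact: At|rewrite /= cur]. Qed.

Let I0 : 0 <= (0 : R) <= l. Proof. by rewrite lexx ltW. Qed.
Let Il : 0 <= l <= l. Proof. by rewrite lexx ltW. Qed.
Let i0 : rep_dom A sigma c0 (z0, 0). Proof. by apply: inA => //; exact: chart_at_dom. Qed.
Let il : rep_dom A sigma c0 (z0, l).
Proof. by apply: inA => //; rewrite -loop; exact: chart_at_dom. Qed.

Let slice u (h : R) z t : ((h *: u + z, t) : E) = h *: ((u, 0) : E) + (z, t).
Proof.
have -> : h *: ((u, 0) : E) + (z, t) = (h *: u + z, h *: 0 + t) by [].
by rewrite scaler0 add0r.
Qed.

Let nearA : \forall z \near z0, `|z0 - z| < e.
Proof.
apply: open_nbhs_nbhs; split; first exact: open_norm_ball.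
by rewrite subrr normr0.
Qed.

Let is_derive_lsub u : is_derive z0 u lsubmx (lsubmx u).
Proof. exact: (is_derive_lsubmx (is_derive_id z0 u)). Qed.

Let is_derive_rsub u : is_derive z0 u rsubmx (rsubmx u).
Proof. exact: (is_derive_rsubmx (is_derive_id z0 u)). Qed.

Lemma initial_variation u : vel sigma ((u, 0) : E) c0 (z0, 0) = lsubmx u.
Proof.
have H := is_derive_affine_comp (A := fun z => (z, 0) : E) (fun h => slice u h z0 0)
  (is_derive_rep oA smA ((u, 0) : E) i0).
apply: (is_derive_unique H); apply: near_eq_is_derive (is_derive_lsub u).
apply: filterS nearA => z /ini[_ E].
exact: (etrans (congr1 lsubmx (esym E)) (row_mxKl _ _)).
Qed.

Lemma initial_variation_velocity u :
  'D_((u, 0) : E) (vel sigma dt c0) (z0, 0) = rsubmx u.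
Proof.
have H := is_derive_affine_comp (A := fun z => (z, 0) : E) (fun h => slice u h z0 0)
  (is_derive_along ((u, 0) : E) (vel_along oA smA dt) i0).
apply: (is_derive_unique H); apply: near_eq_is_derive (is_derive_rsub u).
apply: filterS nearA => z /ini[_ E].
exact: (etrans (congr1 rsubmx (esym E)) (row_mxKr _ _)).
Qed.

Let endpoint z := rep sigma c0 (z, l).

(** Changing the initial velocity by [w] varies the given geodesic by the Jacobi
    field with initial value [0] and initial derivative [w]; if the end point
    does not move to first order, that field vanishes at both ends. *)
Lemma endpoint_injective (w : 'rV[R]_n) : 'D_(row_mx 0 w) endpoint z0 = 0 -> w = 0.
Proof.
set W := row_mx 0 w; move=> Gw; apply: contrapT => w0; apply: nconj.
have GW : vel sigma ((W, 0) : E) c0 (z0, l) = 0.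
  have H := is_derive_affine_comp (A := fun z => (z, l) : E) (fun h => slice W h z0 l)
    (is_derive_rep oA smA ((W, 0) : E) il).
  by rewrite -Gw; have [_] := H.
pose J t := vel sigma ((W, 0) : E) (chart_at X (gam t)) (z0, t).
have iaff (h s t : R) : ((z0, h *: s + t) : E) = h *: (s *: dt) + (z0, t).
  have -> : h *: (s *: dt) + (z0, t) = (h *: (s *: 0) + z0, h *: (s *: 1) + t) by [].
  by rewrite !scaler0 add0r [s *: 1]mulr1.
have icont : continuous (fun t : R => (z0, t) : E).
  move=> t; apply: (@continuous_pair _ _ _ (fun=> z0) id); last exact: cvg_id.
  exact: continuous_at_cst.
have gE t : `[0, l]%classic t -> [set: R] t -> A (z0, t) /\ gam t = sigma (z0, t).
  by rewrite /= in_itv/= => tI _; split; [exact: At|rewrite cur].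
have JJ : jacobi_field g 0 l gam J.
  exact: (jacobi_family (findim_phase R n) oA smA iaff icont l0 openT gE
    (fun _ _ => I) famE (fun s _ _ => erefl)).
exists J; split; [exact: JJ| | |].
- by rewrite /J initial_variation /W row_mxKl.
- by rewrite /J -loop.
- apply: contrapT => nJ; apply: w0.
  have J0 t : `[0, l]%classic t -> J t = 0.
    by move=> tI; apply: contrapT => Jt; apply: nJ; exists t => //; apply/eqP.
  have wS := vel_along oA smA ((W, 0) : E).
  have D : 'D_dt (vel sigma ((W, 0) : E) c0) (z0, 0) = w.
    have C := derive_commute ((W, 0) : E) dt (findim_rV R n)
      (@open_rep_dom _ _ _ _ _ _ _ oA smA c0) i0 (smooth_rep oA smA c0 2%N).
    by apply: (etrans C); apply: (etrans (initial_variation_velocity W)); rewrite row_mxKr.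
  (* [t = 0] is an end of the interval, hence the one-sided derivative *)
  have H := is_derive_snd (is_derive_along dt wS i0); rewrite D in H.
  have I00 : `[0, l]%classic (0 : R) by rewrite /= in_itv.
  have nR : \forall s \near (0 : R), rep_dom A sigma c0 (z0, s).
    exact: (icont 0 _ (near_rep_dom oA smA i0)).
  rewrite -(derive_withinE (f := fun=> 0) l0 I00 H).
    have C0 : is_derive (0 : R) 1 (fun=> (0 : 'rV[R]_n)) 0 by exact: is_derive_cst.
    by apply: (derive_withinE l0 I00 C0); near=> s.
  apply: filterS nR => s is_ sI.
  have [vT _] := wS; have sI' : 0 <= s <= l by move: sI; rewrite /= in_itv.
  have cs : rep_dom A sigma (chart_at X (gam s)) (z0, s).
    by split; [exact: At|rewrite /= cur//; exact: chart_at_dom].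
  have E := vT _ _ _ cs is_; rewrite -/(J s) J0// tangent_change0 in E.
  by rewrite E.
Unshelve. all: by end_near. Qed.


Lemma open_endpoint : open (fun z => rep_dom A sigma c0 (z, l)).
Proof.
have -> : (fun z => rep_dom A sigma c0 (z, l)) =
    setT `&` (fun z => (z, l) : E) @^-1` rep_dom A sigma c0.
  by apply/funext => z; rewrite /setI /= /mkset; apply/propext; split=> // -[].
apply: open_setI_preimage; [exact: openT| |exact: open_rep_dom].
move=> z _; apply: (@continuous_pair _ _ _ id (fun=> l)); first exact: cvg_id.
exact: continuous_at_cst.
Qed.

Lemma smooth_endpoint : smooth (fun z => rep_dom A sigma c0 (z, l)) endpoint.
Proof.
have pc : continuous (fun z => (z, l) : E).
  move=> z; apply: (@continuous_pair _ _ _ id (fun=> l)); first exact: cvg_id.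
  exact: continuous_at_cst.
have aff z u h : ((h *: u + z, l) : E) = h *: ((u, 0) : E) + (z, l) by exact: slice.
move=> k; have oR := @open_rep_dom _ _ _ _ _ _ _ oA smA c0.
exact: (Ck_affine_comp oR pc aff (smooth_rep oA smA c0 k)).
Qed.

(** The geodesics with initial states [Z s] given by [continuation] close up,
    since their initial and end points move along the same path. *)
Lemma loop_family_from (a : 'rV[R]_n) : exists (r : R) (tau : (R * R)%type -> M),
  [/\ 0 < r, geo_family g ((0, 1) : (R * R)%type) (flow_box (0 : R) l r) tau,
     forall t, 0 <= t <= l -> tau (0, t) = gam t &
     forall s, `|s| < r -> [/\ tau (s, 0) = tau (s, l), chart_dom c0 (tau (s, 0)) &
       chart_map c0 (tau (s, 0)) = chart_map c0 (gam 0) + s *: a]].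
Proof.
have [e1 [Z [e10 Z0 ZC ZP]]] :=
  continuation a open_endpoint il smooth_endpoint endpoint_injective.
have Z1 : `|0 : R| < e1 by rewrite normr0.
have Zc : {for 0, continuous Z} by exact: Ck_continuous (ZC 0%N) Z1.
have nZ : \forall s \near (0 : R), `|z0 - Z s| < e.
  by have := nearA; rewrite -Z0 => H; exact: (Zc _ H).
near (0 : R)^'+ => r.
have r0 : 0 < r by near: r; exact: nbhs_right_gt.
have re : r < e by near: r; exact: nbhs_right_lt.
have re1 : r < e1 by near: r; exact: nbhs_right_lt.
have rZ : forall s : R, `|s - 0| < r -> `|z0 - Z s| < e by near: r; exact: near_norm_lt.
pose phi (q : (R * R)%type) : E := (Z q.1, q.2).
have sE (s : R) : `|0 - s| < r -> `|s| < r by rewrite sub0r normrN.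
have oB : open (flow_box (0 : R) l r) by exact: open_flow_box.
have phiA q : flow_box (0 : R) l r q -> A (phi q).
  case: q => s t [/= /sE sr /andP[t1 t2]]; split.
    by apply: rZ; rewrite subr0.
  by rewrite /=; apply/andP; split; lra.
have phi_aff (h : R) (q : (R * R)%type) :
    phi (h *: ((0, 1) : (R * R)%type) + q) = h *: dt + phi q.
  case: q => s t; rewrite /phi.
  have -> : h *: ((0, 1) : (R * R)%type) + (s, t) = (h *: 0 + s, h *: 1 + t) by [].
  have -> : h *: dt + (Z (s, t).1, (s, t).2) = (h *: 0 + Z s, h *: 1 + t) by [].
  by rewrite /= !scaler0 !add0r.
have phiC : smooth (flow_box (0 : R) l r) phi.
  move=> k; apply: (Ck_pair oB).
    have oe1 : open (fun s : R => `|s| < e1).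
      have -> : (fun s : R => is_true (`|s| < e1)) = (fun s : R => is_true (`|0 - s| < e1)).
        by apply/funext => s; rewrite sub0r normrN.
      exact: open_norm_ball.
    have fc : continuous (fst : (R * R)%type -> R) by move=> q; exact: cvg_fst.
    have faff (q v : (R * R)%type) (h : R) : (h *: v + q).1 = h *: v.1 + q.1 by [].
    apply: Ck_sub (Ck_affine_comp oe1 fc faff (ZC k)).
    by move=> [s t] [/= /sE sr _]; exact: lt_trans re1.
  have sc : continuous (snd : (R * R)%type -> R) by move=> q; exact: cvg_snd.
  exact: (@Ck_affine _ _ _ k _ _ snd oB sc (fun _ _ _ => erefl)).
have famB := geo_family_reparametrize (findim_phase R n) fam oB phiC phi_aff phiA.
exists r, (sigma \o phi); split; [exact: r0|exact: famB| |].
  by move=> t tI; rewrite /phi /= Z0; exact: cur.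
move=> s sr; have [[Al ie] Zl Ge] := ZP s (lt_trans sr re1).
have [is_ st] := ini (rZ s (ltac:(by rewrite subr0))).
have z0l : lsubmx z0 = chart_map c0 (gam 0) by rewrite row_mxKl.
have R0 : chart_map c0 (sigma (Z s, 0)) = lsubmx (Z s).
  exact: (etrans (esym (row_mxKl _ _)) (congr1 lsubmx st)).
have E0 : endpoint z0 = chart_map c0 (gam 0).
  by rewrite /endpoint /rep cur ?Il// -loop.
split; last 2 first.
- exact: is_.
- by rewrite /= R0 Zl z0l.
- rewrite /phi /= -[LHS](chart_mapK is_) R0 Zl z0l -E0 -Ge.
  exact: chart_mapK ie.
Unshelve. all: by end_near. Qed.

End WithFamily.

Lemma loop_family (a : 'rV[R]_n) : exists (r : R) (tau : (R * R)%type -> M),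
  [/\ 0 < r, geo_family g ((0, 1) : (R * R)%type) (flow_box (0 : R) l r) tau,
     forall t, 0 <= t <= l -> tau (0, t) = gam t &
     forall s, `|s| < r -> [/\ tau (s, 0) = tau (s, l), chart_dom c0 (tau (s, 0)) &
       chart_map c0 (tau (s, 0)) = chart_map c0 (gam 0) + s *: a]].
Proof.
have [e [sigma [e0 fam ini cur]]] := geodesic_family_along l0 geo.
by apply: (loop_family_from e0 fam ini) => t /cur[].
Qed.

End Loop.

(** * First variation of the length *)

Section Variation.
Variables (R : realType) (n : nat) (M : topologicalType).
Variables (X : manifold R n M) (g : lorentz_metric X).
Variables (l : R) (gam : R -> M).
Hypotheses (l0 : 0 < l) (loop : gam 0 = gam l).
Local Notation P := (R * R)%type.
Local Notation dt := ((0, 1) : P).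
Local Notation ds := ((1, 0) : P).
Let c0 := chart_at X (gam 0).
Variables (a : 'rV[R]_n) (r : R) (sigma : P -> M).
Local Notation B := (flow_box (0 : R) l r).
Hypotheses (r0 : 0 < r) (fam : geo_family g dt B sigma).
Hypothesis sigma0 : forall t, 0 <= t <= l -> sigma (0, t) = gam t.
Hypothesis ends : forall s, `|s| < r -> [/\ sigma (s, 0) = sigma (s, l),
  chart_dom c0 (sigma (s, 0)) &
  chart_map c0 (sigma (s, 0)) = chart_map c0 (gam 0) + s *: a].
Implicit Types s t : R.

Let oB : open B. Proof. by case: fam. Qed.
Let smB : smooth_map X B sigma. Proof. by case: fam. Qed.
Let famE i q : rep_dom B sigma i q -> cov g sigma dt (vel sigma dt) i q = 0.
Proof. by case: fam => _ _; exact. Qed.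
Let fP : findim (P : normedModType R).
Proof. by apply: findim_prod; exact: findim_R. Qed.

Lemma strip_in s t : `|s| < r -> 0 <= t <= l -> B (s, t).
Proof.
move=> sr /andP[t0 tl]; split; first by rewrite /= sub0r normrN.
by have r0' := r0; rewrite /=; apply/andP; split; lra.
Qed.

Let norm0r : `|0 : R| < r. Proof. by rewrite normr0. Qed.
Let I0 : 0 <= (0 : R) <= l. Proof. by rewrite lexx ltW. Qed.
Let Il : 0 <= l <= l. Proof. by rewrite lexx ltW. Qed.

Let iaff s (h t1 t : R) : ((s, h *: t1 + t) : P) = h *: (t1 *: dt) + (s, t).
Proof.
have -> : h *: (t1 *: dt) + (s, t) = (h *: (t1 *: 0) + s, h *: (t1 *: 1) + t) by [].
by rewrite !scaler0 add0r [t1 *: 1]mulr1.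
Qed.

Let icont s : continuous (fun t : R => (s, t) : P).
Proof.
move=> t; apply: (@continuous_pair _ _ _ (fun=> s) id); last exact: cvg_id.
exact: continuous_at_cst.
Qed.

Let saff t (h s : R) : ((h *: 1 + s, t) : P) = h *: ds + (s, t).
Proof.
have -> : h *: ds + (s, t) = (h *: 1 + s, h *: 0 + t) by [].
by rewrite scaler0 add0r.
Qed.

Let nears : \forall s \near (0 : R), `|s| < r.
Proof.
have : \forall s \near (0 : R), `|0 - s| < r.
  by apply: open_nbhs_nbhs; split; [exact: open_norm_ball|rewrite subrr normr0].
by apply: filterS => s; rewrite sub0r normrN.
Qed.

Definition loop_energy s : R := energy g sigma dt (s, 0).

Lemma loop_energyE s t : `|s| < r -> 0 <= t <= l ->
  energy g sigma dt (s, t) = loop_energy s.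
Proof.
move=> sr /andP[t0 tl]; apply/eqP; rewrite -subr_eq0 /loop_energy; apply/eqP.
have := @constant_slope R (fun t => energy g sigma dt (s, t)) 0 0 t t0.
rewrite mul0r; apply => t' /andP[t0' tt']; apply: is_derive_snd.
apply: (energy_conserved fP oB smB famE); apply: strip_in => //.
by rewrite t0' (le_trans tt').
Qed.

Section Longitudinal.
Variables (s : R) (c : R -> M).
Hypotheses (sr : `|s| < r) (cE : forall t, 0 <= t <= l -> c t = sigma (s, t)).

Let gE t : `[0, l]%classic t -> [set: R] t -> B (s, t) /\ c t = sigma (s, t).
Proof. by rewrite /= in_itv/= => tI _; split; [exact: strip_in|exact: cE]. Qed.

Lemma loop_velocity t : `[0, l]%classic t ->
  velocity X 0 l c t = vel sigma dt (chart_at X (c t)) (s, t).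
Proof. by move=> tI; exact: (velocity_family oB smB (iaff s) l0 openT gE tI I). Qed.

Lemma loop_geodesic : geodesic g 0 l c.
Proof.
exact: (geodesic_family oB smB (iaff s) (@icont s) l0 openT gE (fun _ _ => I) famE).
Qed.

Lemma loop_inner t : `[0, l]%classic t ->
  inner g (c t) (velocity X 0 l c t) (velocity X 0 l c t) = loop_energy s.
Proof.
move=> tI; have [_ E] := gE tI I; have tI' : 0 <= t <= l by move: tI; rewrite /= in_itv.
by rewrite (loop_velocity tI) E -(loop_energyE sr tI').
Qed.

Lemma loop_length : curve_length g 0 l c = l * Num.sqrt `|loop_energy s|.
Proof.
rewrite /curve_length.
rewrite (@eq_Rintegral _ _ _ _ _ (fun=> Num.sqrt `|loop_energy s|)); last first.
  by move=> t; rewrite inE => tI; rewrite /vnorm loop_inner.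
rewrite Rintegral_cst; last exact: measurable_itv.
have E : lebesgue_measure (`[0, l]%classic : set R) = l%:E.
  by rewrite lebesgue_measure_itv/= lte_fin l0 sube0.
exact: (etrans (congr1 (fun z => _ * fine z) E) (mulrC _ _)).
Qed.

Lemma loop_timelike : loop_energy s < 0 -> timelike_geodesic_loop g 0 l c.
Proof.
move=> q0; split; last first.
  by rewrite !cE//; case: (ends sr).
split; first exact: loop_geodesic.
move=> t tI; split; last by rewrite loop_inner.
apply/eqP => v0; have := loop_inner tI; rewrite v0 /inner /tensor_form !mul0mx mxE.
by move=> E; move: q0; rewrite -E ltxx.
Qed.

End Longitudinal.

Let gam0 t : 0 <= t <= l -> gam t = sigma (0, t).
Proof. by move=> /sigma0. Qed.

Let i0 t : 0 <= t <= l -> chart_dom c0 (gam t) -> rep_dom B sigma c0 (0, t).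
Proof. by move=> tI ct; split; [exact: strip_in|rewrite /= sigma0]. Qed.

Let cl : chart_dom c0 (gam l). Proof. by rewrite -loop; exact: chart_at_dom. Qed.
Let cz : chart_dom c0 (gam 0). Proof. exact: chart_at_dom. Qed.

Let energy_slope t : 0 <= t <= l -> is_derive (0 : R) 1 loop_energy
  ('D_ds (energy g sigma dt) (0, t)).
Proof.
move=> tI; have H := is_derive_energy g dt fP oB smB ds (strip_in norm0r tI).
have [_ E] := H; rewrite -E in H.
have H2 := is_derive_affine_comp (A := fun s => (s, t) : P) (fun h => saff t h 0) H.
apply: near_eq_is_derive H2; apply: filterS nears => s sr.
exact: loop_energyE.
Qed.

Let base_slope : is_derive (0 : R) 1 (fun s => chart_map c0 (gam 0) + s *: a) a.
Proof.
by apply: is_derive_affine => h; rewrite scalerDl addrCA [h *: 1]mulr1.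
Qed.

Let end_variation t : t = 0 \/ t = l -> vel sigma ds c0 (0, t) = a.
Proof.
move=> te; have tI : 0 <= t <= l by case: te => ->.
have ct : chart_dom c0 (gam t) by case: te => ->.
have H := is_derive_affine_comp (A := fun s => (s, t) : P) (fun h => saff t h 0)
  (is_derive_rep oB smB ds (i0 tI ct)).
apply: (is_derive_unique H); apply: near_eq_is_derive base_slope.
apply: filterS nears => s /ends[E _ <-]; rewrite /= /rep.
by case: te => -> //; rewrite E.
Qed.

(** The energy is constant along each geodesic, so [first_variation] integrates to
    a difference of boundary terms; at both ends the variation field is [a]. *)
Lemma loop_energy_slope : is_derive (0 : R) 1 loop_energy
  (2 / l * bil (gmx g c0 (chart_map c0 (gam 0))) a
     (velocity X 0 l gam l - velocity X 0 l gam 0)).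
Proof.
have H := energy_slope I0; apply: (is_derive_eq H).
set k := 'D_ds _ _ in H *.
have vS := vel_along oB smB dt; have sS := vel_along oB smB ds.
pose Q t := pairing g sigma (vel sigma ds) (vel sigma dt) (0, t).
have Qd t : 0 <= t <= l -> is_derive t 1 Q (2^-1 * k).
  move=> tI; have -> : k = 'D_ds (energy g sigma dt) (0, t).
    exact: is_derive_unique H (energy_slope tI).
  apply: is_derive_snd; apply: (first_variation fP oB smB famE).
  exact: strip_in.
have QE := @constant_slope R Q (2^-1 * k) 0 l (ltW l0) Qd.
have Qend t : t = 0 \/ t = l -> Q t = bil (gmx g c0 (chart_map c0 (gam 0))) a
    (velocity X 0 l gam t).
  move=> te; have tI : 0 <= t <= l by case: te => ->.
  have ct : chart_dom c0 (gam t) by case: te => ->.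
  have tI' : `[0, l]%classic t by rewrite /= in_itv.
  rewrite /Q (pairingE g sS vS (i0 tI ct)) (end_variation te).
  rewrite (loop_velocity norm0r gam0 tI').
  rewrite /rep (sigma0 tI); have -> : gam t = gam 0 by case: te => ->.
  by [].
rewrite bilDr bilNr -!Qend; [|by left|by right].
rewrite QE subr0; field; exact: lt0r_neq0.
Qed.

End Variation.

(** * The deformation theorem *)

Lemma decreasing_at (R : realType) (f : R -> R) (k : R) : k < 0 ->
  is_derive (0 : R) 1 f k -> exists d : R, [/\ 0 < d,
    forall s, - d < s -> s < 0 -> f 0 < f s &
    forall s, 0 < s -> s < d -> f s < f 0].
Proof.
move=> k0 /cvg_is_derive fk.
have : \forall h \near (0 : R)^', h^-1 *: (f (h *: 1 + 0) - f 0) < 0.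
  exact: (cvgr_lt _ fk).
move=> [d /= d0 dP]; have dN s : `|s| < d -> s != 0 -> (f s - f 0) / s < 0.
  move=> sd s0; have := dP s; rewrite /= sub0r normrN => /(_ sd s0).
  by rewrite addr0 [s *: 1]mulr1 /GRing.scale/= mulrC.
exists d; split=> // s s1 s2.
  have := dN s; rewrite ltr0_norm// ltr0_neq0// => /(_ (ltac:(by lra)) isT).
  by rewrite ltr_ndivrMr// mul0r subr_gt0.
have := dN s; rewrite gtr0_norm// lt0r_neq0// => /(_ s2 isT).
by rewrite ltr_pdivrMr// mul0r subr_lt0.
Qed.

Theorem theorem3p3 (R : realType) (n : nat) (hn : (2 <= n)%N)
  (M : topologicalType) (X : manifold R n M) (g : lorentz_metric X)
  (l : R) (hl : 0 < l) (gam : R -> M)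
  (hloop : timelike_geodesic_loop g 0 l gam)
  (hnsc : ~ self_conjugate g 0 l gam) :
  closed_timelike_geodesic g 0 l gam \/
  exists (delta : R) (sigma : R * R -> M),
    [/\ 0 < delta,
        smooth_TG_homotopy g delta l sigma,
        forall t, 0 <= t <= l -> longitudinal sigma 0 t = gam t &
        forall s s', - delta <= s -> s < 0 -> 0 < s' -> s' <= delta ->
          curve_length g 0 l (longitudinal sigma s) < curve_length g 0 l gam
          /\ curve_length g 0 l gam < curve_length g 0 l (longitudinal sigma s')].
Proof.
have [[geo tl] loop] := hloop.
have nconj : ~ conjugate_ends g 0 l gam by move=> c; apply: hnsc.
have mono (x y : R) : x < 0 -> x < y -> l * Num.sqrt (- y) < l * Num.sqrt (- x).
  by move=> x0 xy; rewrite ltr_pM2l// ltr_sqrt ?ltrN2// oppr_gt0.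
set u := velocity X 0 l gam l - velocity X 0 l gam 0.
have [u0|un0] := eqVneq u 0.
  left; split; first exact: hloop.
  by exists 1 => //; rewrite scale1r; apply/esym/eqP; rewrite -subr_eq0; apply/eqP.
right.
pose c0 := chart_at X (gam 0); pose x0 := chart_map c0 (gam 0).
have ix : chart_img c0 x0 by apply: chart_img_map; exact: chart_at_dom.
have [b bu] : exists b, bil (gmx g c0 x0) b u != 0.
  apply: contrapT => nb; move/eqP: un0; apply.
  apply: (bil_nondegenerate (gmx_unit g ix)) => b; rewrite (bilC _ _ (gmx_sym g ix)).
  by apply: contrapT => bu; apply: nb; exists b; apply/eqP.
(* the sign makes the energy decrease, hence the length increase, with [s] *)
pose a := - bil (gmx g c0 x0) b u *: b.
have au : bil (gmx g c0 x0) a u < 0.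
  by rewrite bilZl mulNr oppr_lt0 -expr2 exprn_even_gt0.
have [r [sigma [r0 fam sigma0 ends]]] := loop_family hl geo loop nconj a.
pose q := loop_energy g sigma.
have qd := loop_energy_slope hl loop r0 fam sigma0 ends.
have k0 : 2 / l * bil (gmx g c0 x0) a u < 0 by rewrite pmulr_rlt0// divr_gt0.
have [d [d0 dN dP]] := decreasing_at k0 qd.
have r00 : `|0 : R| < r by rewrite normr0.
have I0 : `[0, l]%classic (0 : R) by rewrite /= in_itv/= lexx ltW.
have gE t : 0 <= t <= l -> gam t = sigma (0, t) by move=> /sigma0.
have q0 : q 0 < 0.
  rewrite /q -(loop_inner hl r0 fam r00 gE I0); exact: (tl 0 I0).2.
have qc : {for 0, continuous q}.
  by apply: differentiable_continuous; apply/derivable1_diffP; case: qd.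
have nq : \forall s \near (0 : R), q s < 0 by exact: continuous_lt_ball qc q0.
near (0 : R)^'+ => e.
have e0 : 0 < e by near: e; exact: nbhs_right_gt.
have er : e < r by near: e; exact: nbhs_right_lt.
have ed : e < d by near: e; exact: nbhs_right_lt.
have eq_ : forall s : R, `|s - 0| < e -> q s < 0 by near: e; exact: near_norm_lt.
exists (e / 2), sigma.
have se s : - (e / 2) <= s <= e / 2 -> `|s| < e.
  by move=> /andP[? ?]; rewrite ltr_norml; apply/andP; split; lra.
have sr s : - (e / 2) <= s <= e / 2 -> `|s| < r by move=> /se /lt_trans; exact.
have sq s : - (e / 2) <= s <= e / 2 -> q s < 0.
  by move=> sI; apply: eq_; rewrite subr0; exact: se.
have len s : - (e / 2) <= s <= e / 2 ->
    curve_length g 0 l (longitudinal sigma s) = l * Num.sqrt (- q s).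
  move=> sI; rewrite (loop_length hl r0 fam (sr s sI) (fun t _ => erefl)).
  by rewrite -/(q s) ltr0_norm ?sq.
have len0 : curve_length g 0 l gam = l * Num.sqrt (- q 0).
  by rewrite (loop_length hl r0 fam r00 gE) -/(q 0) ltr0_norm.
split.
- by lra.
- split; last first.
    move=> s sI; exact: (loop_timelike hl r0 fam ends (sr s sI) (fun t _ => erefl) (sq s sI)).
  have [_ smB _] := fam; move=> i [s t] [/= sI tI] it.
  have [U [F [oU Ux FC UF]]] := smB i (s, t) (strip_in r0 (sr s sI) tI) it.
  exists U, F; split=> // -[s' t'] [/= sI' tI'] Us'.
  exact: UF (strip_in r0 (sr s' sI') tI') Us'.
- exact: sigma0.
- move=> s s' s1 s2 s3 s4.
  have sI : - (e / 2) <= s <= e / 2 by apply/andP; split; lra.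
  have sI' : - (e / 2) <= s' <= e / 2 by apply/andP; split; lra.
  have qs : q 0 < q s by apply: dN => //; lra.
  have qs' : q s' < q 0 by apply: dP => //; lra.
  rewrite len0 (len s sI) (len s' sI').
  by split; [exact: mono q0 qs|exact: mono (sq s' sI') qs'].
Unshelve. all: by end_near. Qed.
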